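(* The following two statements are equivalent. (A) For every positive integer $k$, every finite connected graph $G$ and every $2k$-edge-connected subset $S\subseteq V(G)$, the graph $G$ contains $k$ pairwise edge-disjoint $S$-Steiner trees. (B) For every positive integer $k$, every connected, locally finite, infinite graph $G$ and every $2k$-edge-connected subset $S\subseteq V(G)$, the graph $G$ with the topology $\mathrm{Etop}(G)$ contains $k$ pairwise edge-disjoint topological $S$-Steiner trees.
   Context: All graphs are simple (no loops, no multiple edges). A subset $S\subseteq V(G)$ is $m$-edge-connected (in $G$) if for every pair of vertices $u,v\in S$ there are $m$ pairwise edge-disjoint $u$–$v$ paths in $G$ (the paths may leave $S$). An $S$-Steiner tree of $G$ is a tree $T\subseteq G$ (a subgraph that is a tree) with $S\subseteq V(T)$. A ray is a one-way infinite path; its infinite connected subgraphs are its tails. Two rays of $G$ are edge-equivalent if for every finite $X\subseteq E(G)$ they have tails in the same connected component of $G-X$. The equivalence classes $[r]_E$ are the edge-ends of $G$; their set is $\Omega_E(G)$. Let $\|G\|=G\cup\Omega_E(G)$, where $G$ is viewed as a $1$-complex (each edge is a copy of $[0,1]$). The topology $\mathrm{Etop}(G)$ on $\|G\|$ is defined as follows: inner points of edges have their usual neighbourhoods; basic open neighbourhoods of a vertex are the open stars of radius $1/n$ around it; for an edge-end $[r]_E$ and a finite $X\subseteq E(G)$, let $C_E(X,[r]_E)$ be the unique component of $G-X$ containing a tail of every ray in $[r]_E$, let $\Omega_E(X,[r]_E)=\{[r']_E\in\Omega_E(G): C_E(X,[r']_E)=C_E(X,[r]_E)\}$, let $E(X,[r]_E)$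 be the union of the half-edges between $C_E(X,[r]_E)$ and $X$ (i.e. the halves, at their endpoints in $C_E(X,[r]_E)$, of edges of $X$), and take $\Omega_E(X,[r]_E)\cup C_E(X,[r]_E)\cup E(X,[r]_E)$ as a basic open neighbourhood of $[r]_E$. For a locally finite graph $G$: a topological circle is a subspace of $\mathrm{Etop}(G)$ homeomorphic to $\mathbb{S}^1$. A topological tree of $G$ is a path-connected subspace $T$ of $\mathrm{Etop}(G)$ that contains no topological circle. $V(T)$ and $E(T)$ denote the sets of vertices and edges of $G$ contained in $T$. A topological $S$-Steiner tree is a topological tree $T$ with $S\subseteq V(T)$. (Topological) trees are edge-disjoint if they have no common edge. *)

(* Defs.v *)
From HB Require Import structures.
From mathcomp Require Import all_boot all_order all_algebra.
From mathcomp Require Import all_classical all_reals all_analysis.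
From mathcomp Require Import ring lra.
Import Order.TTheory GRing.Theory Num.Theory.
Import numFieldNormedType.Exports.

Set Implicit Arguments.
Unset Strict Implicit.
Unset Printing Implicit Defensive.

Local Open Scope classical_set_scope.
Local Open Scope ring_scope.

Record graph := Graph {
  vertex : choiceType;
  adj : rel vertex;
  adj_sym : symmetric adj;
  adj_irr : irreflexive adj }.

Section Combinatorics.
Variable G : graph.
Local Notation V := (vertex G).

(* An edge is identified with the set of its two ends. *)
Definition edge (u v : V) : set V := [set u; v].

Definition edges : set (set V) := [set e | exists u v, adj u v /\ e = edge u v].

Definition locally_finite : Prop :=
  forall v : V, finite_set [set w | adj v w].

(* The sequence [u :: p] is a path from [u] to [v] (no repeated vertex). *)
Definition is_path (u v : V) (p : seq V) : Prop :=
  [/\ path (@adj G) u p, last u p = v & uniq (u :: p)].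

Definition path_edges (u : V) (p : seq V) : set (set V) :=
  [set e | exists2 x, x \in zip (u :: p) p & e = edge x.1 x.2].

Definition connected_graph : Prop :=
  [set: V] !=set0 /\ forall u v : V, exists p, is_path u v p.

(* The paths form a family, so that for [u = v] the trivial path may be
   repeated [m] times and the condition is void. *)
Definition edge_connected_in (m : nat) (S : set V) : Prop :=
  forall u v, S u -> S v -> exists P : 'I_m -> seq V,
    (forall i, is_path u v (P i)) /\
    (forall i j, i != j -> path_edges u (P i) `&` path_edges u (P j) = set0).

Record subgraph := Subgraph {
  sub_vertices : set V;
  sub_edges : set (set V);
  sub_edgesP : sub_edges `<=` edges;
  sub_endsP : forall e, sub_edges e -> e `<=` sub_vertices }.

Definition sub_adj (T : subgraph) : rel V :=
  fun u v => edge u v \in sub_edges T.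

Definition sub_connected (T : subgraph) : Prop :=
  sub_vertices T !=set0 /\
  forall u v, sub_vertices T u -> sub_vertices T v ->
    exists2 p, path (sub_adj T) u p & last u p = v.

Definition sub_acyclic (T : subgraph) : Prop :=
  ~ exists c : seq V, (2 < size c)%N /\ ucycle (sub_adj T) c.

Definition is_tree (T : subgraph) : Prop := sub_connected T /\ sub_acyclic T.

Definition steiner_tree (S : set V) (T : subgraph) : Prop :=
  is_tree T /\ S `<=` sub_vertices T.

Definition edge_disjoint_subgraphs (T1 T2 : subgraph) : Prop :=
  sub_edges T1 `&` sub_edges T2 = set0.

(* Adjacency in G - X, for a set X of edges. *)
Definition adj_minus (X : set (set V)) : rel V :=
  fun u v => adj u v && (edge u v \notin X).

(* The vertex set of the component of G - X that contains [u]. *)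
Definition component (X : set (set V)) (u : V) : set V :=
  [set v | exists2 p, path (adj_minus X) u p & last u p = v].

Record ray := Ray {
  ray_fun :> nat -> V;
  ray_inj : injective ray_fun;
  ray_adj : forall n, adj (ray_fun n) (ray_fun n.+1) }.

(* Some tail of [r] is a subgraph of G - X with all its vertices in [C]. *)
Definition tail_in (X : set (set V)) (C : set V) (r : ray) : Prop :=
  exists N, forall n, (N <= n)%N -> C (r n) /\ adj_minus X (r n) (r n.+1).

Definition edge_equivalent (r1 r2 : ray) : Prop :=
  forall X : set (set V), finite_set X -> X `<=` edges ->
    exists c, tail_in X (component X c) r1 /\ tail_in X (component X c) r2.

Definition edge_end : Type :=
  {w : set ray | exists r, w = [set r' | edge_equivalent r r']}.

(* The vertex set of C_E(X, w): those [v] whose component in G - X contains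
   a tail of every ray in [w]. *)
Definition end_component (X : set (set V)) (w : edge_end) : set V :=
  [set v | forall r, sval w r -> tail_in X (component X v) r].

Lemma edgeC (u v : V) : edge u v = edge v u.
Proof. exact: setUC. Qed.

Lemma adj_minus_sym X : symmetric (adj_minus X).
Proof. by move=> u v; rewrite /adj_minus adj_sym edgeC. Qed.

Lemma component_refl X u : component X u u.
Proof. by exists [::]. Qed.

Lemma component_trans X u v w :
  component X u v -> component X v w -> component X u w.
Proof.
move=> [p pp pl] [q qq ql]; exists (p ++ q); last by rewrite last_cat pl.
by rewrite cat_path pp pl.
Qed.

Lemma component_sym X u v : component X u v -> component X v u.
Proof.
move=> [p pp <-]; exists (rev (belast u p)); last by case: p {pp} => //= ? ?; rewrite rev_cons last_rcons.
by rewrite rev_path; apply: sub_path pp => a b; rewrite adj_minus_sym.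
Qed.

Lemma component_adj X u v w :
  component X u v -> adj_minus X v w -> component X u w.
Proof.
by move=> uv vw; apply: component_trans uv _; exists [:: w] => //=; rewrite vw.
Qed.

Lemma adj_minus_sub X X' u v : X `<=` X' -> adj_minus X' u v -> adj_minus X u v.
Proof.
move=> XX' /andP[uv] /negP h; rewrite /adj_minus uv; apply/negP => /set_mem e.
by apply: h; apply/mem_set/XX'.
Qed.

Lemma component_sub X X' u : X `<=` X' -> component X' u `<=` component X u.
Proof.
move=> XX' v [p pp <-]; exists p => //.
by apply: sub_path pp => a b; exact: adj_minus_sub.
Qed.

Lemma tail_in_sub X X' (C C' : set V) r : X `<=` X' -> C' `<=` C ->
  tail_in X' C' r -> tail_in X C r.
Proof.
move=> XX' CC' [N h]; exists N => n /h[/CC' ? a]; split=> //.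
exact: adj_minus_sub a.
Qed.

Lemma edge_equivalent_refl r : edge_equivalent r r.
Proof.
move=> X finX XE.
have finU : finite_set (\bigcup_(e in X) e).
  apply: bigcup_finite => // e /XE [u [v [_ ->]]]; exact: finite_set2.
have finN : finite_set (r @^-1` (\bigcup_(e in X) e)).
  by apply: finite_preimage => // a b _ _; exact: ray_inj.
have [N hN] : exists N, forall n, (N <= n)%N -> ~ (\bigcup_(e in X) e) (r n).
  have /finite_seqP[A AE] := finN.
  exists (\max_(i <- A) i).+1 => n Nn Xn.
  have nA : n \in A by have : (r @^-1` (\bigcup_(e in X) e)) n by []; rewrite AE.
  by move: Nn; rewrite ltnNge (leq_bigmax_seq n).
have adjm n : (N <= n)%N -> adj_minus X (r n) (r n.+1).
  move=> Nn; rewrite /adj_minus ray_adj; apply/negP => /set_mem Xe.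
  by apply: (hN n Nn); exists (edge (r n) (r n.+1)) => //; left.
suff : tail_in X (component X (r N)) r by exists (r N).
exists N => n Nn; split; last exact: adjm.
rewrite -(subnKC Nn); elim: (n - N)%N => [|m IH].
  by rewrite addn0; exact: component_refl.
by rewrite addnS; apply: component_adj IH _; apply/adjm/leq_addr.
Qed.

Lemma tail_in_component X u v r :
  tail_in X (component X u) r -> tail_in X (component X v) r -> component X u v.
Proof.
move=> [N hN] [M hM].
have [uC _] := hN _ (leq_maxl N M); have [vC _] := hM _ (leq_maxr N M).
by apply: component_trans uC _; exact: component_sym.
Qed.

Lemma edge_end_ray (w : edge_end) : exists r, sval w r.
Proof. by case: w => w [r /= ->]; exists r; exact: edge_equivalent_refl. Qed.

Lemma end_componentE X w v : end_component X w v ->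
  end_component X w = component X v.
Proof.
move=> vC; have [r wr] := edge_end_ray w.
apply/seteqP; split=> u uC; first exact: tail_in_component (vC _ wr) (uC _ wr).
move=> r' wr'; apply: tail_in_sub (vC _ wr') => // x vx.
by apply: component_trans vx; exact: component_sym.
Qed.

Lemma end_component_neq0 X w : finite_set X -> X `<=` edges ->
  end_component X w !=set0.
Proof.
move=> finX XE; case: w => w [r wE].
have [c [_ rc]] := edge_equivalent_refl r finX XE.
exists c => r' /=; rewrite {1}wE => /= /(_ X finX XE)[c' [rc' r'c']].
apply: tail_in_sub r'c' => // x; apply: component_trans.
exact: tail_in_component rc rc'.
Qed.

Lemma end_component_adj X w u v :
  end_component X w u -> adj_minus X u v -> end_component X w v.
Proof.
move=> uC uv; rewrite (end_componentE uC).
exact: component_adj (component_refl X u) uv.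
Qed.

Lemma end_component_sub X X' w : X `<=` X' ->
  end_component X' w `<=` end_component X w.
Proof.
move=> XX' v vC r /vC; apply: tail_in_sub => //; exact: component_sub.
Qed.

Lemma end_component_eq_sub X X' w1 w2 : finite_set X' -> X' `<=` edges ->
  X `<=` X' -> end_component X' w1 = end_component X' w2 ->
  end_component X w1 = end_component X w2.
Proof.
move=> finX' X'E XX' E; have [v v1] := end_component_neq0 w1 finX' X'E.
have v2 := v1; rewrite E in v2.
by rewrite (end_componentE (end_component_sub XX' v1))
           (end_componentE (end_component_sub XX' v2)).
Qed.

End Combinatorics.

Section Etop.
Variables (R : realType) (G : graph).
Local Notation V := (vertex G).

(* The 1-complex of G in barycentric coordinates. *)
Definition vertex_coord (u : V) : V -> R := fun w => (w == u)%:R.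

Definition edge_coord (u v : V) (t : R) : V -> R :=
  fun w => (1 - t) * vertex_coord u w + t * vertex_coord v w.

Record complex_point := Point {
  coord : V -> R;
  coordP : (exists u, coord = vertex_coord u) \/
           (exists u v (t : R), [/\ adj u v, 0 <= t <= 1 & coord = edge_coord u v t])
}.

Definition vertex_point (u : V) : complex_point :=
  Point (or_introl (ex_intro _ u erefl)).

Definition edge_points (u v : V) : set complex_point :=
  [set x | exists2 t : R, 0 <= t <= 1 & coord x = edge_coord u v t].

Inductive Etop : Type :=
| OfPoint of complex_point
| OfEnd of edge_end G.

HB.instance Definition _ := gen_eqMixin Etop.
HB.instance Definition _ := gen_choiceMixin Etop.

(* Open star of radius 1 / (n + 1) around [v]; [1 - coord x v] is the distance
   of [x] from [v] along an edge at [v]. *)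
Definition star (v : V) (n : nat) : set Etop :=
  OfPoint @` [set x | 1 - coord x v < n.+1%:R^-1].

Definition inner_nbhd (u v : V) (t eps : R) : set Etop :=
  OfPoint @` [set x | exists s : R,
    [/\ 0 < s < 1, `|s - t| < eps & coord x = edge_coord u v s]].

(* The points of the subgraph of G - X induced by [C]. *)
Definition component_points (X : set (set V)) (C : set V) : set complex_point :=
  [set x | (exists2 u, C u & x = vertex_point u) \/
           (exists u v, [/\ C u, C v, adj_minus X u v & edge_points u v x])].

(* Half-edges do not contain the midpoint of the edge, so that the sets
   [end_nbhd] below are open. *)
Definition half_edges (X : set (set V)) (C : set V) : set complex_point :=
  [set x | exists u v (t : R), [/\ C u, adj u v, X (edge u v), 0 <= t < 2^-1 &
                             coord x = edge_coord u v t]].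

Definition end_nbhd (X : set (set V)) (w : edge_end G) : set Etop :=
  OfEnd @` [set w' | end_component X w' = end_component X w] `|`
  OfPoint @` component_points X (end_component X w) `|`
  OfPoint @` half_edges X (end_component X w).

Inductive basic_open : set (set Etop) :=
| basic_star v n : basic_open (star v n)
| basic_inner u v (t eps : R) : adj u v -> 0 < t < 1 -> 0 < eps ->
    basic_open (inner_nbhd u v t eps)
| basic_end X w : finite_set X -> X `<=` @edges G ->
    basic_open (end_nbhd X w).

Lemma vertex_coord_inj u v : vertex_coord u = vertex_coord v -> u = v.
Proof.
move=> /(congr1 (fun f => f u)); rewrite /vertex_coord eqxx.
by case: eqP => // _ /eqP; rewrite oner_eq0.
Qed.

Lemma vertex_pointP x a : coord x = vertex_coord a -> x = vertex_point a.
Proof. by case: x => c cP /= cE; rewrite cE in cP *; congr Point. Qed.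

Lemma edge_coordC u v (t : R) : edge_coord u v t = edge_coord v u (1 - t).
Proof. by apply/funext => w; rewrite /edge_coord; ring. Qed.

Lemma edge_coord_vertex a u v (t : R) : adj u v -> 0 <= t <= 1 ->
  vertex_coord a = edge_coord u v t -> (a = u /\ t = 0) \/ (a = v /\ t = 1).
Proof.
move=> uv /andP[t0 t1] /(congr1 (fun f => f a)).
rewrite /edge_coord /vertex_coord eqxx.
have [au|au] := eqVneq a u; have [av|av] := eqVneq a v => /= h.
- by rewrite -au -av adj_irr in uv.
- by left; split=> //; lra.
- by right; split=> //; lra.
- by lra.
Qed.

Lemma edge_coord_inj u v (t : R) u' v' (s : R) : adj u v -> adj u' v' ->
  0 < t < 1 -> 0 <= s <= 1 -> edge_coord u v t = edge_coord u' v' s ->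
  [/\ u = u', v = v' & t = s] \/ [/\ u = v', v = u' & t = 1 - s].
Proof.
move=> uv uv' /andP[t0 t1] /andP[s0 s1] E.
have := congr1 (fun f => f u) E; have := congr1 (fun f => f v) E.
have vu : (v == u) = false by apply/eqP => vu; rewrite vu adj_irr in uv.
have vu' : v' == u' = false by apply/eqP => vu'; rewrite vu' adj_irr in uv'.
rewrite /edge_coord /vertex_coord !eqxx vu (eq_sym u v) vu.
have [?|_] := eqVneq u u'; have [?|_] := eqVneq v v' => /=; subst.
- by rewrite vu' (eq_sym u') vu' /= => *; left; split=> //; lra.
- by rewrite vu (eq_sym u') vu' /=; lra.
- by have [?|_] := eqVneq u v'; subst; rewrite ?eqxx vu' //= in vu *; lra.
- have [?|_] := eqVneq u v'; have [?|_] := eqVneq v u' => /=; subst.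
  + by move=> *; right; split=> //; lra.
  + by lra.
  + by lra.
  + by lra.
Qed.

Lemma edge_coord_lip u v (t s : R) w :
  `|edge_coord u v s w - edge_coord u v t w| <= `|s - t|.
Proof.
rewrite /edge_coord /vertex_coord.
case: eqP => _; case: eqP => _ /=.
- by rewrite (_ : _ - _ = 0) ?normr0//; ring.
- by rewrite (_ : _ - _ = t - s) 1?distrC//; ring.
- by rewrite (_ : _ - _ = s - t)//; ring.
- by rewrite (_ : _ - _ = 0) ?normr0//; ring.
Qed.

Lemma basic_at_vertex (B : set Etop) a : basic_open B ->
  B (OfPoint (vertex_point a)) ->
  exists N, forall n, (N <= n)%N -> star a n `<=` B.
Proof.
case=> [v n|u v t eps uv t01 eps0|X w finX XE].
- move=> [x /= xv [xE]]; have {}xv : 1 - vertex_coord a v < n.+1%:R^-1.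
    by rewrite xE in xv.
  have -> : a = v.
    apply/eqP; apply: contraTT xv; rewrite eq_sym /vertex_coord => /negPf ->.
    by rewrite subr0 -leNgt invf_le1 ?ltr0n// ler1n.
  exists n => m nm _ [y ym <-]; exists y => //=.
  apply: lt_le_trans ym _; rewrite lef_pV2 ?ler_nat ?posrE ?ltr0n //.
- move=> [x /= [s [/andP[s0 s1] _ xs]] [xE]]; rewrite xE /= in xs.
  have s01 : 0 <= s <= 1 by rewrite !ltW.
  by case: (edge_coord_vertex uv s01 xs) => -[_ ?]; lra.
- move=> Ba; have aC : end_component X w a.
    case: Ba => [[[//]|[x + [xE]]]|[x + [xE]]]; rewrite {}xE {x}.
    + case=> [[u uC /(congr1 coord)/= /vertex_coord_inj -> //]|].
      move=> [u [v [uC vC /andP[uv _] [t t01 /= aE]]]].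
      by case: (edge_coord_vertex uv t01 aE) => -[-> _].
    + move=> [u [v [t [uC uv _ /andP[t0 t1] /= aE]]]].
      have t01 : 0 <= t <= 1 by rewrite t0; lra.
      by case: (edge_coord_vertex uv t01 aE) => -[? ?]; subst => //; lra.
  exists 1%N => n n1 _ [y /= ya <-].
  have {}ya : 1 - coord y a < 2^-1.
    apply: lt_le_trans ya _.
    by rewrite lef_pV2 ?posrE ?ltr0n// ler_nat.
  have key u v (t : R) : adj u v -> 0 <= t < 2^-1 -> end_component X w u ->
      coord y = edge_coord u v t -> end_nbhd X w (OfPoint y).
    move=> uv /andP[t0 t1] uC yE.
    have [Xe|Xe] := boolP (edge u v \in X).
      by right; exists y => //; exists u, v, t; split=> //;
        [apply/set_mem|rewrite t0].
    have am : adj_minus X u v by rewrite /adj_minus uv.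
    left; right; exists y => //; right; exists u, v; split=> //.
      exact: end_component_adj am.
    by exists t => //; rewrite t0; lra.
  have [[b yE]|[u [v [t [uv /andP[t0 t1] yE]]]]] := coordP y.
    rewrite yE /vertex_coord in ya; move: ya; case: eqP => [ab _|_ /=]; last by lra.
    left; right; exists y => //; left; exists a => //.
    by rewrite ab; exact: vertex_pointP.
  move: ya; rewrite yE /edge_coord /vertex_coord.
  have [au|au] := eqVneq a u; have [av|av] := eqVneq a v => /= ya.
  + by rewrite -au -av adj_irr in uv.
  + apply: (key u v t) => //; last by rewrite -au.
    by rewrite t0; lra.
  + apply: (key v u (1 - t)).
    * by rewrite adj_sym.
    * by apply/andP; split; lra.
    * by rewrite -av.
    * by rewrite yE edge_coordC.
  + by lra.
Qed.

Lemma basic_at_inner (B : set Etop) x u v (t : R) : basic_open B ->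
  adj u v -> 0 < t < 1 -> coord x = edge_coord u v t -> B (OfPoint x) ->
  exists2 eps : R, 0 < eps & inner_nbhd u v t eps `<=` B.
Proof.
move=> + uv t01 xE.
case=> [a n|u' v' t' eps uv' t01' eps0|X w finX XE].
- move=> [x' + [xx]]; rewrite xx {x' xx} /= => xa; exists (n.+1%:R^-1 - (1 - coord x a)).
    by rewrite subr_gt0.
  move=> _ [y [s [_ st yE]] <-]; exists y => //=.
  have h := le_lt_trans (edge_coord_lip u v t s a) st.
  by move: h => /=; rewrite -xE -yE ltr_norml; set c := n.+1%:R^-1; clearbody c => /andP[h1 h2]; lra.
- move=> [x' + [xx]]; rewrite xx {x' xx} => -[s [s01 st' xs]].
  have s01' : 0 <= s <= 1 by case/andP: s01 => ? ?; rewrite !ltW.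
  rewrite xE in xs; exists (eps - `|s - t'|); first by rewrite subr_gt0.
  move=> _ [y [r [r01 rt yE]] <-]; exists y => //=.
  case: (edge_coord_inj uv uv' t01 s01' xs) => -[? ? ?]; subst.
    exists r; split=> //; have := ler_distD s r t'; lra.
  exists (1 - r); split; last by rewrite yE edge_coordC.
    by case/andP: r01 => ? ?; apply/andP; split; lra.
  have := ler_distD s (1 - r) t'.
  rewrite (_ : 1 - r - s = - (r - (1 - s))) ?normrN; last by ring.
  lra.
- have in_edge u' v' (s : R) y (r : R) : adj u' v' -> 0 <= s <= 1 ->
      coord x = edge_coord u' v' s -> 0 < r < 1 -> coord y = edge_coord u v r ->
      exists r', [/\ 0 < r' < 1, `|r' - s| = `|r - t|
                   & coord y = edge_coord u' v' r'].
    move=> uv' s01 xs r01 yE; rewrite xE in xs.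
    case: (edge_coord_inj uv uv' t01 s01 xs) => -[? ? ?]; subst; first by exists r.
    exists (1 - r); split; last by rewrite yE edge_coordC.
      by case/andP: r01 => ? ?; apply/andP; split; lra.
    by rewrite -normrN; congr `|_|; ring.
  case=> [[[//]|[x' + [xx]]]|[x' + [xx]]]; rewrite xx {x' xx}.
  + case=> [[a aC /(congr1 coord)/= aE]|[u' [v' [uC vC am [s s01 xs]]]]].
      rewrite xE in aE; case/andP: (t01) => t0 t1.
      have t01' : 0 <= t <= 1 by rewrite !ltW.
      by case: (edge_coord_vertex uv t01' (esym aE)) => -[_ ?]; lra.
    exists 1 => // _ [y [r [r01 _ yE]] <-].
    left; right; exists y => //; right; exists u', v'; split=> //.
    case/andP: (am) => uv' _.
    have [r' [/andP[r'0 r'1] _ yE']] := in_edge _ _ _ _ _ uv' s01 xs r01 yE.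
    by exists r' => //; rewrite !ltW.
  + move=> [u' [v' [s [uC uv' Xe /andP[s0 s1] xs]]]].
    exists (2^-1 - s); first by rewrite subr_gt0.
    move=> _ [y [r [r01 rt yE]] <-].
    have s01 : 0 <= s <= 1 by rewrite s0; lra.
    have [r' [/andP[r'0 r'1] rE yE']] := in_edge _ _ _ _ _ uv' s01 xs r01 yE.
    right; exists y => //; exists u', v', r'; split=> //.
    move: rt; rewrite -rE ltr_norml => /andP[_ rt].
    by rewrite ltW //=; lra.
Qed.

Lemma basic_at_end (B : set Etop) w : basic_open B -> B (OfEnd w) ->
  exists X, [/\ finite_set X, X `<=` @edges G & forall X', finite_set X' ->
    X' `<=` @edges G -> X `<=` X' -> end_nbhd X' w `<=` B].
Proof.
case=> [a n [//]|u v t eps _ _ _ [//]|X w0 finX XE].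
case=> [[[w' + [ww]]|[//]]|[//]]; rewrite ww {w' ww} /= => wE.
exists X; split=> // X' finX' X'E XX' p; rewrite /end_nbhd -wE.
case=> [[[w' w'E <-]|[x xC <-]]|[x xC <-]].
- left; left; exists w' => //=; exact: end_component_eq_sub w'E.
- left; right; exists x => //; case: xC => [[u uC xE]|].
    by left; exists u => //; exact: end_component_sub uC.
  move=> [u [v [uC vC uv xe]]]; right; exists u, v; split=> //.
  + exact: end_component_sub uC.
  + exact: end_component_sub vC.
  + exact: adj_minus_sub uv.
- case: xC => u [v [t [/(end_component_sub XX') uC uv _ t01 xE]]].
  have [Xe|Xe] := boolP (edge u v \in X).
    by right; exists x => //; exists u, v, t; split=> //; apply/set_mem.
  have am : adj_minus X u v by rewrite /adj_minus uv.
  left; right; exists x => //; right; exists u, v; split=> //.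
    exact: end_component_adj am.
  by case/andP: t01 => t0 t1; exists t => //; rewrite t0; lra.
Qed.

Lemma star_center v n : star v n (OfPoint (vertex_point v)).
Proof.
exists (vertex_point v) => //=.
by rewrite /vertex_coord eqxx subrr invr_gt0 ltr0n.
Qed.

Lemma inner_nbhd_center u v (t eps : R) x : 0 < t < 1 -> 0 < eps ->
  coord x = edge_coord u v t -> inner_nbhd u v t eps (OfPoint x).
Proof. by move=> t01 e0 xE; exists x => //; exists t; rewrite subrr normr0. Qed.

Lemma end_nbhd_center X w : end_nbhd X w (OfEnd w).
Proof. by left; left; exists w. Qed.

Lemma inner_nbhd_sub u v (t e e' : R) : e <= e' ->
  inner_nbhd u v t e `<=` inner_nbhd u v t e'.
Proof.
move=> ee' _ [x [s [s01 st xE]] <-]; exists x => //; exists s; split=> //.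
exact: lt_le_trans ee'.
Qed.

Variant point_spec (x : complex_point) : Prop :=
| PointVertex a of x = vertex_point a
| PointInner u v (t : R) of adj u v & 0 < t < 1 & coord x = edge_coord u v t.

Lemma point_case x : point_spec x.
Proof.
have [[a /vertex_pointP]|[u [v [t [uv t01 xE]]]]] := coordP x; first exact: PointVertex.
have [t0|t0] := eqVneq t 0.
  apply: (@PointVertex _ u); apply: vertex_pointP; rewrite xE t0.
  by apply/funext => w; rewrite /edge_coord; ring.
have [t1|t1] := eqVneq t 1.
  apply: (@PointVertex _ v); apply: vertex_pointP; rewrite xE t1.
  by apply/funext => w; rewrite /edge_coord; ring.
by apply: (@PointInner _ u v t) => //; rewrite !lt_neqAle t1 eq_sym t0.
Qed.

Lemma basic_open_cover : \bigcup_(B in basic_open) B = setT.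
Proof.
apply/seteqP; split=> // -[x|w] _.
  have [a ->|u v t uv t01 xE] := point_case x.
    by exists (star a 0); [exact: basic_star|exact: star_center].
  exists (inner_nbhd u v t 1); first exact: basic_inner.
  exact: inner_nbhd_center.
exists (end_nbhd set0 w); last exact: end_nbhd_center.
by apply: basic_end; [exact: finite_set0|exact: sub0set].
Qed.

Lemma basic_open_join (A B : set Etop) p :
  basic_open A -> basic_open B -> A p -> B p ->
  exists C, [/\ basic_open C, C p & C `<=` A `&` B].
Proof.
case: p => [x|w] bA bB Ap Bp.
  have [a xE|u v t uv t01 xE] := point_case x.
    rewrite xE in Ap Bp *.
    have [N hN] := basic_at_vertex bA Ap; have [M hM] := basic_at_vertex bB Bp.
    exists (star a (maxn N M)); split; [exact: basic_star|exact: star_center|].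
    by rewrite subsetI; split; [apply: hN; exact: leq_maxl|apply: hM; exact: leq_maxr].
  have [e e0 he] := basic_at_inner bA uv t01 xE Ap.
  have [f f0 hf] := basic_at_inner bB uv t01 xE Bp.
  have m0 : 0 < Num.min e f by rewrite lt_min e0.
  exists (inner_nbhd u v t (Num.min e f)); split.
  - exact: basic_inner.
  - exact: inner_nbhd_center.
  - rewrite subsetI; split.
      by apply: subset_trans he; apply: inner_nbhd_sub; rewrite ge_min lexx.
    by apply: subset_trans hf; apply: inner_nbhd_sub; rewrite ge_min lexx orbT.
have [X [fX XE hX]] := basic_at_end bA Ap.
have [Y [fY YE hY]] := basic_at_end bB Bp.
have fXY : finite_set (X `|` Y) by rewrite finite_setU.
have XYE : X `|` Y `<=` @edges G by rewrite subUset.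
exists (end_nbhd (X `|` Y) w); split.
- exact: basic_end.
- exact: end_nbhd_center.
- by rewrite subsetI; split; [apply: hX|apply: hY].
Qed.

HB.instance Definition _ :=
  @isBaseTopological.Build Etop (set Etop) basic_open id
    basic_open_cover basic_open_join.

End Etop.

Section TopologicalTrees.
Variable R : realType.

Definition homeomorphic_subspaces (T U : topologicalType)
    (A : set T) (B : set U) : Prop :=
  exists (f : T -> U) (g : U -> T),
    [/\ {within A, continuous f}, {within B, continuous g},
        (forall x, A x -> B (f x) /\ g (f x) = x) &
        (forall y, B y -> A (g y) /\ f (g y) = y)].

Definition path_connected (T : topologicalType) (A : set T) : Prop :=
  A !=set0 /\ forall x y, A x -> A y -> exists f : R -> T,
    [/\ {within `[0, 1], continuous f}, f 0 = x, f 1 = y &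
        forall t : R, 0 <= t <= 1 -> A (f t)].

Definition unit_circle : set (R * R) := [set p | p.1 ^+ 2 + p.2 ^+ 2 = 1].

Variable G : graph.
Local Notation V := (vertex G).

Definition topological_circle (C : set (Etop R G)) : Prop :=
  homeomorphic_subspaces unit_circle C.

Definition topological_tree (T : set (Etop R G)) : Prop :=
  path_connected T /\ ~ exists2 C, C `<=` T & topological_circle C.

Definition top_vertices (T : set (Etop R G)) : set V :=
  [set u | T (OfPoint (vertex_point R u))].

(* An edge, being a copy of [0, 1], contains its two ends. *)
Definition top_edges (T : set (Etop R G)) : set (set V) :=
  [set e | exists u v, [/\ adj u v, e = edge u v &
    forall x, edge_points u v x -> T (OfPoint x)]].

Definition topological_steiner_tree (S : set V) (T : set (Etop R G)) : Prop :=
  topological_tree T /\ S `<=` top_vertices T.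

Definition edge_disjoint_top (T1 T2 : set (Etop R G)) : Prop :=
  top_edges T1 `&` top_edges T2 = set0.

End TopologicalTrees.

(* Main.v *)
Require Import Defs.
From mathcomp Require Import all_boot all_order all_algebra.
From mathcomp Require Import all_classical all_reals all_analysis.
From mathcomp Require Import ring lra zify.
Import Order.TTheory GRing.Theory Num.Theory.
Import numFieldNormedType.Exports.

Set Implicit Arguments.
Unset Strict Implicit.
Unset Printing Implicit Defensive.

Local Open Scope classical_set_scope.

Local Notation coord := Defs.coord.

(** Both kinds of packing come down to edge sets. Call a set [F] of edges linked
for [S] if it meets every finite cut that separates two vertices of [S].

A linked set contains a tree. Linkedness concerns finite cuts only, so it
survives intersections of chains, and Zorn's lemma gives a minimal linked subset
[F] ([linked_minimal]): every edge of [F] is the only edge of [F] in some finite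
separating cut, its private cut. In a finite graph such an [F] is acyclic,
because a cycle never crosses a cut exactly once, and the component of [F] that
contains [S] is a Steiner tree ([finite_linked_tree]). In an infinite, connected,
locally finite graph [F] spans the closed subspace [edge_space F] of all
vertices, all ends and the edges of [F]. The basic tool there is the continuous
function that a finite cut induces on the whole space: it is 0 on one side, 1 on
the other, and passes from 0 to 1 along each edge of the cut ([cut_function]).
- [edge_space F] contains no circle ([no_circle]): the function of the private
  cut of an edge [e] takes each value strictly between 0 and 1 just once on
  [edge_space F], namely on [e], while a circle takes every intermediate value
  at least twice; and a circle cannot live on vertices and ends alone, as finite
  cuts separate these.
- Any two vertices of [S] are joined by a curve in [edge_space F]
  ([linked_path]). Pass to a minimal set that is linked for just these two
  vertices. Its private cuts order its edges linearly. The closure of the union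
  of its edges is compact, because the whole space is ([Etop_compact]), and the
  sum of the private cut functions, with weights 1/2, 1/4, ..., maps this closure
  bijectively onto an interval ([ordered_compact_path]). The inverse is a curve.

A path component of [edge_space F] is therefore a topological Steiner tree all
of whose edges are in [F] ([linked_topological_tree]).

From finite to infinite graphs ([topological_packing]) one needs [k] disjoint
linked sets, that is, a colouring of the edges with [k] colours such that each
finite separating cut sees all of them. By compactness it is enough to deal with
finitely many cuts at a time ([exists_rainbow]). Contract each class of vertices
that these cuts do not distinguish: what remains is a finite graph in which the
image of [S] is as edge-connected as before, and its [k] edge-disjoint Steiner
trees provide the colours ([finite_rainbow]).

From infinite to finite graphs, attach a ray to the finite graph. The edges
contained in a path-connected set are linked for the vertices in that set
([top_edges_linked]), since a curve that misses a point of each edge of a finite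
cut stays on one side. So the edge sets of the topological trees, restricted to
the finite graph, are disjoint linked sets, and each contains a Steiner tree. *)

(** * Cuts and linked edge sets *)

Section Cuts.
Local Open Scope ring_scope.
Variable G : graph.
Local Notation V := (vertex G).
Implicit Types (A B S : set V) (E F : set (set V)).

Definition cut A : set (set V) :=
  [set e | exists u v, [/\ A u, ~ A v, adj u v & e = edge u v]].

Definition linked S F : Prop :=
  forall A, finite_set (cut A) ->
    (exists2 u, S u & A u) -> (exists2 v, S v & ~ A v) -> cut A `&` F !=set0.

(** Minimality is recorded through its consequence: each edge is alone in some
finite separating cut. *)
Definition minimal_linked S F : Prop :=
  [/\ F `<=` @edges G, linked S F &
      forall e, F e -> exists A, [/\ finite_set (cut A),
        exists2 u, S u & A u, exists2 v, S v & ~ A v & cut A `&` F = [set e]]].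

Lemma edge_inj (u v u' v' : V) : edge u v = edge u' v' ->
  (u = u' /\ v = v') \/ (u = v' /\ v = u').
Proof.
move=> E.
have : edge u' v' u by rewrite -E; left.
have : edge u' v' v by rewrite -E; right.
have : edge u v u' by rewrite E; left.
have : edge u v v' by rewrite E; right.
by move=> [] /= ? [] /= ? [] /= ? [] /= ?; subst; auto.
Qed.

Lemma cut_sub_edges A : cut A `<=` @edges G.
Proof. by move=> _ [u [v [_ _ uv ->]]]; exists u, v. Qed.

Lemma cutC A : cut (~` A) = cut A.
Proof.
by apply/seteqP; split=> _ [u [v [Au Av uv ->]]]; exists v, u;
  split=> //; rewrite 1?adj_sym// 1?edgeC//; apply: contrapT.
Qed.

Lemma mem_cut A u v : adj u v -> cut A (edge u v) <-> ~ (A u <-> A v).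
Proof.
move=> uv; split=> [[u' [v' [Au' Av' _ /edge_inj E]]]|h].
  by case: E => -[? ?]; subst; tauto.
have [Au|Au] := pselect (A u); have [Av|Av] := pselect (A v); try tauto.
  by exists u, v.
by exists v, u; split=> //; rewrite 1?adj_sym 1?edgeC.
Qed.

Lemma notin_cut A u v : adj u v -> ~ cut A (edge u v) -> (A u <-> A v).
Proof. by move=> uv; rewrite mem_cut// => /contrapT. Qed.

Lemma cutI A B : cut (A `&` B) `<=` cut A `|` cut B.
Proof.
move=> _ [u [v [[Au Bu] /not_andP[Av|Bv] uv ->]]]; [left|right];
  by exists u, v.
Qed.

Lemma cutD A B : cut (A `\` B) `<=` cut A `|` cut B.
Proof. by rewrite setDE -(cutC B); exact: cutI. Qed.

Lemma cutU A B : cut (A `|` B) `<=` cut A `|` cut B.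
Proof. by rewrite -cutC setCU -(cutC A) -(cutC B); exact: cutI. Qed.

Lemma finite_cutI A B : finite_set (cut A) -> finite_set (cut B) ->
  finite_set (cut (A `&` B)).
Proof. by move=> fA fB; apply: sub_finite_set (@cutI A B) _; rewrite finite_setU. Qed.

Lemma finite_cutD A B : finite_set (cut A) -> finite_set (cut B) ->
  finite_set (cut (A `\` B)).
Proof. by move=> fA fB; apply: sub_finite_set (@cutD A B) _; rewrite finite_setU. Qed.

Lemma finite_cutU A B : finite_set (cut A) -> finite_set (cut B) ->
  finite_set (cut (A `|` B)).
Proof. by move=> fA fB; apply: sub_finite_set (@cutU A B) _; rewrite finite_setU. Qed.

Lemma linked_sub S S' F : S' `<=` S -> linked S F -> linked S' F.
Proof.
move=> SS' h A fA [u Su Au] [v Sv Av].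
by apply: h => //; [exists u|exists v] => //; exact: SS'.
Qed.

Lemma component_closed A X u : cut A `<=` X -> A u -> component X u `<=` A.
Proof.
move=> AX Au v [p pp <-] {v}; elim: p u Au pp => [//|w p IH] u Au /= /andP[uw].
apply: IH; have /andP[auw /negP uwX] := uw.
have ncut : ~ cut A (edge u w) by move/AX/mem_set.
by have [h _] := notin_cut auw ncut; exact: h.
Qed.

Lemma cut_component X u : cut (component X u) `<=` X.
Proof.
move=> _ [v [w [uv uw vw ->]]]; apply: contrapT => nX; apply: uw.
apply: component_adj uv _; rewrite /adj_minus vw /=.
by apply/negP => /set_mem.
Qed.

(** A finite set is caught by a single member of a chain that covers it; this is
how finiteness of cuts enters both Zorn's lemma and exhaustions. *)
Lemma chain_bound (T : choiceType) (C : set (set T)) (L : set T) :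
  total_on C subset -> C !=set0 -> finite_set L -> L `<=` \bigcup_(D in C) D ->
  exists2 D, C D & L `<=` D.
Proof.
move=> tot [D0 CD0] /finite_seqP[s ->]; elim: s => [|x s IH] sC.
  by exists D0 => // x /=; rewrite in_nil.
have [|D1 CD1 sD1] := IH; first by move=> y /= ys; apply: sC; rewrite /= in_cons ys orbT.
have [|D2 CD2 xD2] := sC x; first by rewrite /= mem_head.
have [D12|D21] := tot _ _ CD1 CD2; [exists D2|exists D1] => // y /=;
  rewrite in_cons => /orP[/eqP -> //|/sD1 //].
- exact: D12.
- exact: D21.
Qed.

(** Zorn's lemma is applied to the sets [D] whose removal keeps [F] linked. A
finite cut that lost all its edges to a chain of such [D] would lose them to a
single member of the chain. *)
Lemma linked_minimal S F : F `<=` @edges G -> linked S F ->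
  exists2 F', F' `<=` F & minimal_linked S F'.
Proof.
move=> FE lF; pose P (D : set (set V)) := linked S (F `\` D).
have [C CP totC|D [PD maxD]] := @Zorn_bigcup _ P.
  move=> A fA Su Sv; apply: contrapT => /set0P/negP; rewrite negbK => /eqP none.
  have [C0|C0] := eqVneq C set0.
    have [e [Ae Fe]] := lF A fA Su Sv.
    have : (cut A `&` (F `\` \bigcup_(X in C) X)) e.
      by rewrite C0 bigcup_set0 setD0.
    by rewrite none.
  have [||D CD LD] := chain_bound totC _ (finite_setIl F fA).
  - exact/set0P.
  - move=> e [Ae Fe]; apply: contrapT => nC.
    have : (cut A `&` (F `\` \bigcup_(X in C) X)) e by [].
    by rewrite none.
  - have [e [Ae [Fe De]]] := CP _ CD A fA Su Sv.
    by apply: De; apply: LD.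
exists (F `\` D); first exact: subDsetl.
split=> [||e [Fe De]]; [by move=> e [/FE]|exact: PD|].
have : ~ P (D `|` [set e]).
  apply: maxD; split; last by move=> /(_ e)/= h; apply/De/h; right.
  by move=> x; left.
move=> /existsNP[A /not_implyP[fA /not_implyP[Su /not_implyP[Sv none]]]].
exists A; split=> //; apply/seteqP; split=> [e' [Ae' [Fe' De']]|_ ->].
  apply: contrapT => e'e; apply: none; exists e'; split=> //; split=> // -[//|].
  by move=> /= E; apply: e'e.
have [e' [Ae' [Fe' De']]] := PD A fA Su Sv.
have [E|ne] := pselect (e' = e); first by rewrite -E.
by case: none; exists e'; split=> //; split=> // -[].
Qed.

End Cuts.

(** * Continuous functions induced by finite cuts *)

Section CutFunction.
Local Open Scope ring_scope.
Variables (R : realType) (G : graph).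
Local Notation V := (vertex G).
Implicit Types (A S : set V) (E F X : set (set V)) (p : Etop R G).

Lemma basic_open_open (B : set (Etop R G)) : basic_open B -> open B.
Proof. by move=> bB; exists [set B]; [move=> _ -> | rewrite bigcup_set1]. Qed.

Lemma nbhs_basic p (N : set (Etop R G)) :
  nbhs p N <-> exists B, [/\ basic_open B, B p & B `<=` N].
Proof.
rewrite nbhsE; split=> [[U [[D DB UE] Up] UN]|[B [bB Bp BN]]].
  move: Up; rewrite -UE => -[B DB' Bp]; exists B; split=> //; first exact: DB.
  by move=> q Bq; apply: UN; rewrite -UE; exists B.
by exists B => //; split=> //; exact: basic_open_open.
Qed.

Lemma nbhs_vertex a (N : set (Etop R G)) :
  nbhs (OfPoint (vertex_point R a)) N <-> exists n, star a n `<=` N.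
Proof.
rewrite nbhs_basic; split=> [[B [bB Ba BN]]|[n aN]].
  have [n /(_ n (leqnn n)) h] := basic_at_vertex bB Ba.
  by exists n; exact: subset_trans BN.
by exists (star a n); split=> //; [exact: basic_star|exact: star_center].
Qed.

Lemma nbhs_inner x u v (t : R) (N : set (Etop R G)) :
  adj u v -> 0 < t < 1 -> coord x = edge_coord u v t ->
  nbhs (OfPoint x) N <-> exists2 eps : R, 0 < eps & inner_nbhd u v t eps `<=` N.
Proof.
move=> uv t01 xE; rewrite nbhs_basic; split=> [[B [bB Ba BN]]|[e e0 eN]].
  have [e e0 h] := basic_at_inner bB uv t01 xE Ba.
  by exists e => //; exact: subset_trans BN.
exists (inner_nbhd u v t e); split=> //; first exact: basic_inner.
exact: inner_nbhd_center.
Qed.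

Lemma nbhs_end w (N : set (Etop R G)) :
  nbhs (OfEnd R w) N <-> exists X, [/\ finite_set X, X `<=` @edges G
    & end_nbhd X w `<=` N].
Proof.
rewrite nbhs_basic; split=> [[B [bB Ba BN]]|[X [fX XE XN]]].
  have [X [fX XE /(_ X fX XE (@subset_refl _ _)) h]] := basic_at_end bB Ba.
  by exists X; split=> //; exact: subset_trans BN.
by exists (end_nbhd X w); split=> //; [exact: basic_end|exact: end_nbhd_center].
Qed.

Lemma edge_coord0 u v : edge_coord u v 0 = vertex_coord R u :> (V -> R).
Proof. by apply/funext => w; rewrite /edge_coord subr0 mul1r mul0r addr0. Qed.

Lemma edge_coord1 u v : edge_coord u v 1 = vertex_coord R v :> (V -> R).
Proof. by rewrite edge_coordC subrr edge_coord0. Qed.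

(** A point has two barycentric descriptions at most, related by reversing the
edge; so values that agree under reversal and at the vertices define a function. *)
Lemma glue_function (a : V -> R) (k : V -> V -> R -> R) (b : edge_end G -> R) :
  (forall u v t, adj u v -> k u v t = k v u (1 - t)) ->
  (forall u v, adj u v -> k u v 0 = a u) ->
  exists phi : Etop R G -> R,
    [/\ forall w, phi (OfEnd R w) = b w,
        forall u, phi (OfPoint (vertex_point R u)) = a u &
        forall x u v t, adj u v -> 0 <= t <= 1 -> coord x = edge_coord u v t ->
          phi (OfPoint x) = k u v t].
Proof.
move=> kC k0.
have k1 u v : adj u v -> k u v 1 = a v.
  by move=> uv; rewrite kC// subrr k0// adj_sym.
have val x : exists y, (forall u, coord x = vertex_coord R u -> y = a u) /\
    (forall u v t, adj u v -> 0 <= t <= 1 -> coord x = edge_coord u v t ->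
      y = k u v t).
  have [c ->|u v t uv t01 xE] := point_case x.
    exists (a c); split=> [u /vertex_coord_inj -> //|u v t uv t01 /= E].
    by case: (edge_coord_vertex uv t01 E) => -[-> ->]; rewrite ?k0 ?k1.
  have t01' : 0 <= t <= 1 by case/andP: t01 => ? ?; rewrite !ltW.
  exists (k u v t); split=> [c|u' v' t' uv' t'01]; rewrite xE.
    by move/esym/(edge_coord_vertex uv t01') => [] [-> ->]; rewrite ?k0 ?k1.
  move/(edge_coord_inj uv uv' t01 t'01) => [] [-> -> ->] //.
  by rewrite -kC.
have [f fP] := choice val.
exists (fun p => match p with OfPoint x => f x | OfEnd w => b w end); split=> //.
- by move=> u; apply: (fP _).1.
- by move=> x u v t uv t01 xE; apply: (fP x).2.
Qed.

Hypothesis lf : locally_finite G.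

(** Local finiteness makes one radius work for all edges at [a]. *)
Lemma star_near (a : V) (P : V -> R -> Prop) :
  (forall v, adj a v -> \forall t \near (0 : R), P v t) ->
  exists n, forall v t, adj a v -> 0 <= t < n.+1%:R^-1 -> P v t.
Proof.
move=> h; have /finite_seqP[s sE] := lf a.
have [n hn] : exists n, forall v t, v \in s -> 0 <= t < n.+1%:R^-1 -> P v t.
  have : {subset s <= [pred v | adj a v]}.
    by move=> v vs; have : [set w | adj a w] v by rewrite sE.
  elim: {sE} s => [|v s IH] sub; first by exists 0.
  have [|n hn] := IH; first by move=> w ws; apply: sub; rewrite in_cons ws orbT.
  have /nbhs_ballP[e /= e0 he] := h v (sub v (mem_head _ _)).
  have [m me] : exists m, m.+1%:R^-1 < e.
    have := near_infty_natSinv_lt (PosNum e0) => -[m _ hm].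
    by exists m; apply: hm => /=.
  exists (maxn n m) => w t; rewrite in_cons => /orP[/eqP ->|ws] /andP[t0 tn].
    apply: he; rewrite /ball /= sub0r normrN ger0_norm//.
    apply: lt_trans me; apply: lt_le_trans tn _.
    by rewrite lef_pV2 ?posrE ?ltr0n// ler_nat ltnS leq_maxr.
  apply: hn => //; rewrite t0; apply: lt_le_trans tn _.
  by rewrite lef_pV2 ?posrE ?ltr0n// ler_nat ltnS leq_maxl.
exists n => v t av; apply: hn.
by have : [set w | adj a w] v by []; rewrite sE.
Qed.

Lemma starP (a : V) n (y : complex_point R G) : star a n (OfPoint y) -> y = vertex_point R a \/
  exists v t, [/\ adj a v, 0 <= t <= 1, t < n.+1%:R^-1 & coord y = edge_coord a v t].
Proof.
move=> [y' /= + [yy]]; rewrite yy {y' yy}.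
have [c ->|u v t uv /andP[t0 t1] yE] := point_case y.
  rewrite /= /vertex_coord; have [-> _|_] := eqVneq a c; first by left.
  by rewrite subr0 ltNge invf_le1 ?ltr0n// ler1n.
rewrite yE /edge_coord /vertex_coord.
have n1 : n.+1%:R^-1 <= 1 :> R by rewrite invf_le1 ?ltr0n// ler1n.
have [au|au] := eqVneq a u; have [av|av] := eqVneq a v => /= ya.
- by rewrite -au -av adj_irr in uv.
- right; exists v, t; subst; split=> //; last by move: ya n1; set c := _^-1; clearbody c; lra.
  by rewrite !ltW.
- right; exists u, (1 - t); subst; rewrite adj_sym; split=> //.
  + by apply/andP; split; lra.
  + by move: ya n1; set c := _^-1; clearbody c; lra.
  + exact: edge_coordC.
- by exfalso; move: ya n1; set c := _^-1; clearbody c; lra.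
Qed.

(** The conditions on [phi] are continuity along each edge and local constancy
at the ends; at a vertex they suffice because its degree is finite. *)
Lemma continuous_glue (phi : Etop R G -> R) (k : V -> V -> R -> R) :
  (forall x u v t, adj u v -> 0 <= t <= 1 -> coord x = edge_coord u v t ->
     phi (OfPoint x) = k u v t) ->
  (forall u v, adj u v -> continuous (k u v)) ->
  (forall w, exists X, [/\ finite_set X, X `<=` @edges G &
     forall p, end_nbhd X w p -> phi p = phi (OfEnd R w)]) ->
  continuous phi.
Proof.
move=> phiE kc phiw [x|w]; last first.
  have [X [fX XE Xphi]] := phiw w.
  move=> N N0; apply/nbhs_end; exists X; split=> // p /Xphi.
  by rewrite /= => ->; exact: nbhs_singleton N0.
have [a ->|u v t uv t01 xE] := point_case x => N /= N0; last first.
  apply/(nbhs_inner _ uv t01 xE).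
  have t01' : 0 <= t <= 1 by case/andP: t01 => ? ?; rewrite !ltW.
  rewrite (phiE _ _ _ _ uv t01' xE) in N0.
  have /nbhs_ballP[e /= e0 he] := kc _ _ uv _ _ N0.
  exists e => // _ [y [s [s01 st yE]] <-] /=.
  have s01' : 0 <= s <= 1 by case/andP: s01 => ? ?; rewrite !ltW.
  rewrite (phiE _ _ _ _ uv s01' yE); apply: he.
  by rewrite /ball /= distrC.
apply/nbhs_vertex.
have [|n hn] := @star_near a (fun v t => N (k a v t)).
  move=> v av.
  have kphi : k a v 0 = phi (OfPoint (vertex_point R a)).
    by rewrite (@phiE _ a v 0)//= ?edge_coord0// lexx ler01.
  by apply: (kc _ _ av 0); rewrite kphi.
exists n => -[y|w] ya; last by case: ya.
case/starP: (ya) => [->|[v [t [av t01 tn yE]]]]; first exact: nbhs_singleton N0.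
by rewrite /= (phiE _ _ _ _ av t01 yE); apply: hn => //; case/andP: t01 => ->.
Qed.

Definition edges_at (W : set V) : set (set V) :=
  [set e | edges e /\ exists2 v, W v & e v].

Lemma finite_edges_at W : finite_set W -> finite_set (edges_at W).
Proof.
move=> fW.
apply: (@sub_finite_set _ _ (\bigcup_(v in W) (edge v @` [set w | adj v w]))).
  move=> _ [[a [b [ab ->]]] [v Wv [] /= E]]; subst; first by exists a => //; exists b.
  by exists b => //; exists a; rewrite 1?edgeC//= adj_sym.
by apply: bigcup_finite => // v _; apply: finite_image; exact: lf.
Qed.

Lemma edges_at_sub W : edges_at W `<=` @edges G.
Proof. by move=> e []. Qed.

(** A vertex all of whose edges are deleted is a component by itself and holds
no tail of a ray. *)
Lemma end_component_avoid X w v :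
  (forall e, edges e -> e v -> X e) -> ~ end_component X w v.
Proof.
move=> vX vC; have [r wr] := edge_end_ray w.
have stuck u : ~ adj_minus X v u.
  move=> /andP[vu /negP nX]; apply: nX; apply/mem_set/vX; first by exists v, u.
  by left.
have [N /(_ N (leqnn N))[[p + rN]]] := vC r wr.
case: p rN => [/= <- _|u p _ /= /andP[vu]]; first exact: stuck.
by case: (stuck u).
Qed.

(** The component where an end lives has no edge of the cut. *)
Lemma end_component_side A w :
  end_component (cut A) w `<=` A \/ end_component (cut A) w `<=` ~` A.
Proof.
have [[v [vC Av]]|h] := pselect (end_component (cut A) w `&` A !=set0).
  by left; rewrite (end_componentE vC); exact: component_closed.
by right=> v vC Av; apply: h; exists v.
Qed.

(** The value at parameter [t] of the edge from [u] to [v]; [g] is read in the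
direction that leaves [A]. *)
Definition cut_value A (g : V -> V -> R -> R) u v t : R :=
  if `[< A u >] then if `[< A v >] then 0 else g u v t
  else if `[< A v >] then g v u (1 - t) else 1.

(** The profile [g] along the edges of the cut is left free: the identity will
serve for the private cuts of a minimal linked set, and a reparametrization will
be needed for curves that miss one prescribed point on each edge of a cut. *)
Record cut_function A (g : V -> V -> R -> R) (phi : Etop R G -> R) : Prop := {
  cutf_continuous : continuous phi;
  cutf_in : forall u, A u -> phi (OfPoint (vertex_point R u)) = 0;
  cutf_out : forall u, ~ A u -> phi (OfPoint (vertex_point R u)) = 1;
  cutf_end_in : forall w, end_component (cut A) w `<=` A -> phi (OfEnd R w) = 0;
  cutf_end_out : forall w, end_component (cut A) w `<=` ~` A -> phi (OfEnd R w) = 1;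
  cutf_edge : forall x u v t, adj u v -> 0 <= t <= 1 ->
    coord x = edge_coord u v t -> phi (OfPoint x) = cut_value A g u v t }.

(** Only continuity at an end needs an idea: deleting all edges at the endpoints
of cut edges leaves the end in a component that contains none of these endpoints,
so the half-edges that belong to its neighbourhood carry a constant value too. *)
Lemma cut_function_exists A (g : V -> V -> R -> R) : finite_set (cut A) ->
  (forall u v, A u -> ~ A v -> adj u v ->
     [/\ continuous (g u v), g u v 0 = 0 & g u v 1 = 1]) ->
  exists phi, cut_function A g phi.
Proof.
move=> fA gP.
have [||phi [phiw phiv phie]] := @glue_function (fun u => (~~ `[< A u >])%:R) (cut_value A g)
   (fun w => if `[< end_component (cut A) w `<=` A >] then 0 else 1).
- move=> u v t uv; rewrite /cut_value.
  by case: (`[< A u >]); case: (`[< A v >]) => //; congr (g _ _ _); lra.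
- move=> u v uv; rewrite /cut_value.
  case: asboolP => Au; case: asboolP => Av //=.
    by have [] := gP u v Au Av uv.
  by rewrite subr0; have [] := gP v u Av Au; rewrite // adj_sym.
exists phi; split; last exact: phie.
- apply: (continuous_glue phie) => [u v uv|w].
    rewrite /cut_value; case: asboolP => Au; case: asboolP => Av.
    + exact: cst_continuous.
    + by have [] := gP u v Au Av uv.
    + have vu : adj v u by rewrite adj_sym.
      move=> t; have [gc _ _] := gP v u Av Au vu.
      apply: (@continuous_comp R R R (fun t : R => 1 - t) (g v u) t); last exact: gc.
      by apply: cvgB; [exact: cvg_cst|exact: cvg_id].
    + exact: cst_continuous.
  have fE : finite_set (\bigcup_(e in cut A) e).
    by apply: bigcup_finite => // e [u [v [_ _ _ ->]]]; exact: finite_set2.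
  set X := edges_at (\bigcup_(e in cut A) e).
  have cX : cut A `<=` X.
    move=> _ [u [v [Au Av uv ->]]]; split; first by exists u, v.
    by exists u; [exists (edge u v); [exists u, v|left]|left].
  exists X; split; [exact: finite_edges_at|exact: edges_at_sub|].
  have avoid u v : end_component X w u -> adj u v -> (A u <-> A v).
    move=> uC uv; apply: notin_cut => // cuv; apply: end_component_avoid uC.
    by move=> e eE eu; split=> //; exists u => //; exists (edge u v) => //; left.
  have sideC u : end_component X w u ->
      (~~ `[< A u >])%:R = phi (OfEnd R w).
    move=> /(end_component_sub cX) uC; rewrite phiw.
    case: (end_component_side A w) => sub.
      by rewrite (asboolT sub) asboolT//; exact: sub.
    have Au := sub _ uC; rewrite (asboolF Au) asboolF// => /(_ _ uC); exact: Au.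
  move=> p [[[w' w'E <-]|[x xC <-]]|[x xC <-]].
  + have := end_component_eq_sub (finite_edges_at fE) (@edges_at_sub _) cX w'E.
    by rewrite !phiw => ->.
  + case: xC => [[u uC ->]|[u [v [uC vC /andP[uv _] [t t01 xE]]]]].
      by rewrite phiv sideC.
    rewrite (phie _ _ _ _ uv t01 xE) -(sideC u)// /cut_value.
    have := avoid u v uC uv.
    by case: asboolP => Au; case: asboolP => Av //= [] h h'; [case: Av|case: Au]; auto.
  + case: xC => [u [v [t [uC uv _ /andP[t0 t1] xE]]]].
    have t01 : 0 <= t <= 1 by rewrite t0; lra.
    rewrite (phie _ _ _ _ uv t01 xE) -(sideC u)// /cut_value.
    have := avoid u v uC uv.
    by case: asboolP => Au; case: asboolP => Av //= [] h h'; [case: Av|case: Au]; auto.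
- by move=> u Au; rewrite phiv asboolT.
- by move=> u Au; rewrite phiv asboolF.
- by move=> w wA; rewrite phiw asboolT.
- move=> w wA; rewrite phiw asboolF// => wA'.
  have [v vC] := end_component_neq0 w fA (@cut_sub_edges _ A).
  by apply: (wA v vC); exact: wA'.
Qed.

Lemma cutf_inner A g phi p : cut_function A g phi -> phi p != 0 -> phi p != 1 ->
  exists x u v t, [/\ p = OfPoint x, A u /\ ~ A v, adj u v,
    0 < t < 1 /\ coord x = edge_coord u v t & phi p = g u v t].
Proof.
move=> [_ phi0 phi1 phiw0 phiw1 phie]; case: p => [x|w]; last first.
  by case: (end_component_side A w) => [/phiw0 ->|/phiw1 ->]; rewrite eqxx.
have [a ->|u v t uv t01 xE] := point_case x.
  by have [/phi0 ->|/phi1 ->] := pselect (A a); rewrite eqxx.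
have t01' : 0 <= t <= 1 by case/andP: t01 => ? ?; rewrite !ltW.
rewrite (phie _ _ _ _ uv t01' xE) /cut_value.
case: asboolP => Au; case: asboolP => Av; rewrite ?eqxx// => _ _.
  by exists x, u, v, t; split.
exists x, v, u, (1 - t); split=> //; first by rewrite adj_sym.
by rewrite xE edge_coordC; split=> //; case/andP: t01 => ? ?; apply/andP; split; lra.
Qed.

End CutFunction.

(** * Punctured circles are parametrized by the line *)

Section Circle.
Local Open Scope ring_scope.
Variable R : realType.
Implicit Types (z : R * R) (t : R).

(** Stereographic projection from (-1, 0), turned so that the missing point is
[z]; in complex notation it is - z (1 - t^2 + 2 t i) / (1 + t^2). *)
Definition rotated_circle z t : R * R :=
  (- (((1 - t ^+ 2) / (1 + t ^+ 2)) * z.1 - (2 * t / (1 + t ^+ 2)) * z.2),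
   - (((1 - t ^+ 2) / (1 + t ^+ 2)) * z.2 + (2 * t / (1 + t ^+ 2)) * z.1)).

Lemma den_neq0 t : 1 + t ^+ 2 != 0.
Proof. by apply: lt0r_neq0; rewrite ltr_wpDr ?sqr_ge0. Qed.

Lemma continuous_rotated_circle z : continuous (rotated_circle z).
Proof.
have c2 t : (fun s : R => s ^+ 2) @ t --> t ^+ 2 by exact: exprn_continuous.
have cden t : (fun s : R => (1 + s ^+ 2)^-1) @ t --> (1 + t ^+ 2)^-1.
  apply: cvgV; first exact: den_neq0.
  by apply: cvgD; [exact: cvg_cst|exact: c2].
have cx t : (fun s : R => (1 - s ^+ 2) / (1 + s ^+ 2)) @ t -->
    (1 - t ^+ 2) / (1 + t ^+ 2).
  by apply: cvgM (cden t); apply: cvgB; [exact: cvg_cst|exact: c2].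
have cy t : (fun s : R => 2 * s / (1 + s ^+ 2)) @ t --> 2 * t / (1 + t ^+ 2).
  by apply: cvgM (cden t); apply: cvgM; [exact: cvg_cst|exact: cvg_id].
move=> t; apply: (@cvg_pair _ _ _ _ (nbhs (rotated_circle z t).1) (nbhs (rotated_circle z t).2)).
  by apply: cvgN; apply: cvgB; [apply: cvgM (cx t) _|apply: cvgM (cy t) _]; exact: cvg_cst.
by apply: cvgN; apply: cvgD; [apply: cvgM (cx t) _|apply: cvgM (cy t) _]; exact: cvg_cst.
Qed.

Lemma rotated_circle_on z t : unit_circle z -> unit_circle (rotated_circle z t).
Proof.
rewrite /unit_circle /rotated_circle /= => z1.
have den : 1 + t ^+ 2 != 0 := den_neq0 t.
have -> : forall a b c d : R, (- (a * c - b * d)) ^+ 2 + (- (a * d + b * c)) ^+ 2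
   = (a ^+ 2 + b ^+ 2) * (c ^+ 2 + d ^+ 2) by move=> *; ring.
rewrite z1 mulr1; field; exact: den.
Qed.

Lemma rotated_circle_inj z : unit_circle z -> injective (rotated_circle z).
Proof.
rewrite /unit_circle /= => z1 t t' [E1 E2].
pose X s : R := (1 - s ^+ 2) / (1 + s ^+ 2).
pose Y s : R := 2 * s / (1 + s ^+ 2).
rewrite -/(X t) -/(X t') -/(Y t) -/(Y t') in E1 E2.
have xE a c : a * (z.1 ^+ 2 + z.2 ^+ 2) =
    - (- (a * z.1 - c * z.2) * z.1 + - (a * z.2 + c * z.1) * z.2) by ring.
have yE a c : c * (z.1 ^+ 2 + z.2 ^+ 2) =
    - (a * z.2 + c * z.1) * - z.1 + - (a * z.1 - c * z.2) * z.2 by ring.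
have EX : X t = X t'.
  suff : X t * (z.1 ^+ 2 + z.2 ^+ 2) = X t' * (z.1 ^+ 2 + z.2 ^+ 2) by rewrite z1 !mulr1.
  rewrite (xE _ (Y t)) (xE _ (Y t')) E1 E2 //.
have EY : Y t = Y t'.
  suff : Y t * (z.1 ^+ 2 + z.2 ^+ 2) = Y t' * (z.1 ^+ 2 + z.2 ^+ 2) by rewrite z1 !mulr1.
  rewrite (yE (X t)) (yE (X t')) E1 E2 //.
have back s : s = Y s / (1 + X s).
  have d := den_neq0 s; rewrite /X /Y; field.
  by rewrite d /= (_ : _ + (1 - _) = 2) ?pnatr_eq0 //; ring.
by rewrite (back t) (back t') EX EY.
Qed.

Lemma rotated_circle_neq z t : unit_circle z -> rotated_circle z t != z.
Proof.
rewrite /unit_circle /= => z1; apply/eqP => E.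
pose X s : R := (1 - s ^+ 2) / (1 + s ^+ 2).
pose Y s : R := 2 * s / (1 + s ^+ 2).
have E1 := congr1 fst E; have E2 := congr1 snd E; rewrite /= in E1 E2.
rewrite -/(X t) -/(Y t) in E1 E2.
have EX : X t = -1.
  suff : X t * (z.1 ^+ 2 + z.2 ^+ 2) = - (z.1 ^+ 2 + z.2 ^+ 2) by rewrite z1 !mulr1.
  have -> : X t * (z.1 ^+ 2 + z.2 ^+ 2) = - (- (X t * z.1 - Y t * z.2) * z.1
      + - (X t * z.2 + Y t * z.1) * z.2) by ring.
  by rewrite E1 E2; ring.
have := den_neq0 t => d.
have : X t * (1 + t ^+ 2) = 1 - t ^+ 2 by rewrite /X divfK.
by rewrite EX; lra.
Qed.

Lemma stereographic (x y : R) : x ^+ 2 + y ^+ 2 = 1 -> 1 + x != 0 ->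
  (1 - (y / (1 + x)) ^+ 2) / (1 + (y / (1 + x)) ^+ 2) = x /\
  2 * (y / (1 + x)) / (1 + (y / (1 + x)) ^+ 2) = y.
Proof.
move=> xy x1.
have x2 : 1 + (y / (1 + x)) ^+ 2 = 2 / (1 + x).
  have -> : 1 + (y / (1 + x)) ^+ 2 = (x ^+ 2 + y ^+ 2 + 1 + 2 * x) / (1 + x) ^+ 2.
    by field.
  by rewrite xy; field.
rewrite (_ : 1 - _ = 2 - (1 + (y / (1 + x)) ^+ 2)); last by ring.
by rewrite x2; split; field.
Qed.

Lemma rotated_circle_onto z z' : unit_circle z -> unit_circle z' -> z' != z ->
  exists t, rotated_circle z t = z'.
Proof.
case: z z' => a b [c d]; rewrite /unit_circle /= => ab cd neq.
pose x := - (c * a + d * b); pose y := - (d * a - c * b).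
have xy : x ^+ 2 + y ^+ 2 = 1.
  have -> : x ^+ 2 + y ^+ 2 = (a ^+ 2 + b ^+ 2) * (c ^+ 2 + d ^+ 2) by rewrite /x /y; ring.
  by rewrite ab cd mulr1.
have x1 : 1 + x != 0.
  apply: contra_neq neq => x1.
  have h : (c - a) ^+ 2 + (d - b) ^+ 2 = 0.
    have -> : (c - a) ^+ 2 + (d - b) ^+ 2 =
      (a ^+ 2 + b ^+ 2) + (c ^+ 2 + d ^+ 2) + 2 * x by rewrite /x; ring.
    by rewrite ab cd; lra.
  move/eqP: h; rewrite paddr_eq0 ?sqr_ge0// !sqrf_eq0 !subr_eq0.
  by move=> /andP[/eqP -> /eqP ->].
exists (y / (1 + x)); have [EX EY] := stereographic xy x1.
rewrite /rotated_circle EX EY /=; congr pair.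
  have -> : - (x * a - y * b) = c * (a ^+ 2 + b ^+ 2) by rewrite /x /y; ring.
  by rewrite ab mulr1.
have -> : - (x * b + y * a) = d * (a ^+ 2 + b ^+ 2) by rewrite /x /y; ring.
by rewrite ab mulr1.
Qed.

Lemma IVT_continuous (k : R -> R) a b v : continuous k -> k a < v < k b ->
  exists t, k t = v.
Proof.
move=> kc /andP[av vb].
have kw A : {within A, continuous k} by exact: continuous_subspaceT.
have [ab|ba] := leP a b.
  have [|c _ <-] := @IVT _ k a b v ab (kw _); last by exists c.
  by rewrite ge_min le_max (ltW av) (ltW vb) orbT.
have [|c _ <-] := @IVT _ k b a v (ltW ba) (kw _); last by exists c.
by rewrite ge_min le_max (ltW av) (ltW vb) orbT.
Qed.

End Circle.

(** * Minimal linked sets span no circle *)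

Section NoCircle.
Local Open Scope ring_scope.
Variables (R : realType) (G : graph).
Local Notation V := (vertex G).
Implicit Types (A S : set V) (E F X : set (set V)) (p q : Etop R G).

Lemma coord_inj : injective (@Defs.coord R G).
Proof. by move=> [c cP] [d dP] /= E; rewrite E in cP *; congr Point. Qed.

(** Meant for vertices and ends; an inner point of an edge is on no side. *)
Definition side A p : Prop :=
  match p with
  | OfPoint x => exists2 u, A u & x = vertex_point R u
  | OfEnd w => end_component (cut A) w `<=` A
  end.

(** This holds for vertices and ends, and for no inner point of an edge. *)
Definition sided p : Prop := forall A, side A p \/ side (~` A) p.

Definition edge_space F : set (Etop R G) :=
  [set p | forall x u v t, adj u v -> 0 < t < 1 -> p = OfPoint x ->
     coord x = edge_coord u v t -> F (edge u v)].

Lemma edge_space_vertex F u : edge_space F (OfPoint (vertex_point R u)).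
Proof.
move=> x a b t ab t01 [<-] /= E.
have t01' : 0 <= t <= 1 by case/andP: t01 => ? ?; rewrite !ltW.
by case: (edge_coord_vertex ab t01' E) => -[_ ?]; lra.
Qed.

Lemma edge_space_sub F F' : F `<=` F' -> edge_space F `<=` edge_space F'.
Proof. by move=> FF' p pF x u v t uv t01 px xE; apply: FF'; exact: pF px xE. Qed.

Lemma edge_space_case F p : edge_space F p -> sided p \/
  exists x u v t, [/\ adj u v, 0 < t < 1, p = OfPoint x, coord x = edge_coord u v t &
                     F (edge u v)].
Proof.
case: p => [x|w] pF; last first.
  left=> A; rewrite /side cutC; exact: end_component_side.
have [a xE|u v t uv t01 xE] := point_case x.
  left=> A; rewrite xE /=; have [Aa|Aa] := pselect (A a); [left|right]; by exists a.
by right; exists x, u, v, t; split=> //; exact: pF xE.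
Qed.

Lemma closed_edge_space F : closed (edge_space F).
Proof.
rewrite -openC openE => -[x|w] nF; last by case: nF => x u v t _ _.
move: nF => /existsNP[x' /existsNP[u /existsNP[v /existsNP[t]]]].
move=> /not_implyP[uv /not_implyP[t01 /not_implyP[[->] /not_implyP[xE nF]]]].
apply/(nbhs_inner _ uv t01 xE); exists 1 => // _ [y [s [s01 _ yE]] <-] yF.
by apply: nF; exact: (yF y u v s).
Qed.

Lemma cutf_side_in A g phi p : cut_function A g phi -> side A p -> phi p = 0.
Proof.
move=> phiP; case: p => [x [u Au ->]|w wA].
  exact: (cutf_in phiP).
exact: (cutf_end_in phiP).
Qed.

Lemma cutf_side_out A g phi p : cut_function A g phi -> side (~` A) p -> phi p = 1.
Proof.
move=> phiP; case: p => [x [u Au ->]|w wA].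
  exact: (cutf_out phiP).
by apply: (cutf_end_out phiP); rewrite -cutC.
Qed.

Lemma cut_function_id A : locally_finite G -> finite_set (cut A) ->
  exists phi : Etop R G -> R, cut_function A (fun _ _ t => t) phi.
Proof.
move=> lf fA; apply: cut_function_exists => // u v _ _ _; split=> //.
by move=> t; exact: cvg_id.
Qed.

Lemma finite_cut1 (u : V) : locally_finite G -> finite_set (cut [set u]).
Proof.
move=> lf; apply: sub_finite_set (finite_edges_at lf (finite_set1 u)).
move=> _ [a [b [-> _ ab ->]]]; split; first by exists u, b.
by exists u => //; left.
Qed.

Lemma end_out1 (u : V) w : end_component (cut [set u]) w `<=` ~` [set u].
Proof.
move=> v vC /= vu; subst v; apply: end_component_avoid vC.
move=> _ [a [b [ab ->]]] E.
apply/(mem_cut _ ab); case: E => /= uE; subst; move=> [h h'].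
  by have ba := h erefl; rewrite /= ba adj_irr in ab.
by have ba := h' erefl; rewrite /= ba adj_irr in ab.
Qed.

(** A vertex is cut off by its finitely many edges. For two ends, inequivalent
rays give a finite set [X] of edges that puts the ends in distinct components of
G - X, and one such component is the required side. *)
Lemma separate_sides p q : locally_finite G -> sided p ->
  sided q -> p <> q ->
  exists A, [/\ finite_set (cut A), side A p & side (~` A) q].
Proof.
move=> lf; case: p => [x|w] xs; case: q => [y|w'] ys pq.
- have {xs} [[u _ xu]|[u _ xu]] := xs setT; have {ys} [[v _ yv]|[v _ yv]] := ys setT;
    subst; exists [set u]; (split; [exact: finite_cut1|by exists u|]);
    exists v => // /= vu; exact: pq (f_equal _ (f_equal _ (esym vu))).
- have {xs} [[u _ xu]|[u _ xu]] := xs setT; subst; exists [set u];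
    (split; [exact: finite_cut1|by exists u|]); rewrite /side cutC; exact: end_out1.
- have {ys} [[u _ yu]|[u _ yu]] := ys setT; subst; exists (~` [set u]);
    (split; [by rewrite cutC; exact: finite_cut1| |by exists u => //=; rewrite setCK]);
    rewrite /side cutC; exact: end_out1.
- have [X [fX XE XC]] : exists X, [/\ finite_set X, X `<=` @edges G &
      end_component X w != end_component X w'].
    apply: contrapT => none; apply: pq; congr OfEnd.
    have eqX X : finite_set X -> X `<=` @edges G ->
        end_component X w = end_component X w'.
      by move=> fX XE; apply: contrapT => /eqP XC; apply: none; exists X.
    have in_end v v' r r' : sval v r -> sval v' r' ->
        (forall X, finite_set X -> X `<=` @edges G ->
          end_component X v = end_component X v') -> edge_equivalent r r'.
      move=> vr vr' E X fX XE; have [c cC] := end_component_neq0 v fX XE.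
      exists c; split; first exact: (cC r).
      have c' : end_component X v' c by rewrite -E.
      exact: (c' r').
    have rr' s s' : sval w s -> sval w' s' -> edge_equivalent s s'.
      by move=> ws ws'; exact: in_end ws ws' eqX.
    have E : sval w = sval w'.
      have [r wr] := edge_end_ray w; have [r' wr'] := edge_end_ray w'.
      have [[r0 w0] [r0' w0']] := (proj2_sig w, proj2_sig w').
      have mem0 : sval w r0 by rewrite w0; exact: edge_equivalent_refl.
      have mem0' : sval w' r0' by rewrite w0'; exact: edge_equivalent_refl.
      have symm x y : edge_equivalent x y -> edge_equivalent y x.
        by move=> xy Y fY YE; have [c [h h']] := xy Y fY YE; exists c.
      apply/seteqP; split=> x wx.
        by rewrite w0'; apply: symm; exact: rr'.
      by rewrite w0; exact: rr'.
    by case: w w' E {xs ys none eqX rr'} => [W ?] [W' ?] /= WW; subst W'; congr exist; exact: Prop_irrelevance.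
  have [v vC] := end_component_neq0 w fX XE.
  have [v' vC'] := end_component_neq0 w' fX XE.
  have sub (z : V) (u : edge_end G) : end_component X u z ->
    end_component (cut (component X v)) u z.
    exact: end_component_sub (@cut_component _ _ _) _.
  have fin : finite_set (cut (component X v)).
    exact: sub_finite_set (@cut_component _ _ _) fX.
  exists (component X v); split=> //.
    rewrite /side; have [//|/(_ v (sub _ _ vC)) []] := end_component_side (component X v) w.
    exact: component_refl.
  rewrite /side cutC; have [/(_ v' (sub _ _ vC')) vv'|//] :=
    end_component_side (component X v) w'.
  case/eqP: XC; rewrite (end_componentE vC) (end_componentE vC').
  apply/seteqP; split=> z; apply: component_trans => //; exact: component_sym.
Qed.

(** An intermediate value of the cut function determines the point: the edge
must be the one edge of [F] in the cut, and the value is its parameter. *)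
Lemma cutf_edge_inj A F e phi p q : cut A `&` F = [set e] ->
  cut_function A (fun _ _ t => t) phi -> edge_space F p -> edge_space F q ->
  0 < phi p < 1 -> phi p = phi q -> p = q.
Proof.
move=> AF phiP pF qF /andP[p0 p1] pq.
have inner r : edge_space F r -> phi r = phi p -> exists x u v t, [/\ r = OfPoint x,
    A u /\ ~ A v, edge u v = e, coord x = edge_coord u v t & t = phi p].
  move=> rF rp; rewrite -rp in p0 p1.
  have [x [u [v [t [rx [Au Av] uv [_ xE] tE]]]]] :=
    cutf_inner phiP (lt0r_neq0 p0) (negbT (lt_eqF p1)).
  exists x, u, v, t; split=> //; last by rewrite -tE rp.
  have t01 : 0 < t < 1 by rewrite -tE p0.
  have : (cut A `&` F) (edge u v).
    by split; [exists u, v|exact: (rF x u v t)].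
  by rewrite AF.
have [x [u [v [t [px [Au Av] uv xE tE]]]]] := inner p pF erefl.
have [y [u' [v' [t' [qy [Au' Av'] uv' yE tE']]]]] := inner q qF (esym pq).
rewrite px qy; congr OfPoint; apply: coord_inj; rewrite xE yE tE tE'.
case: (edge_inj (etrans uv (esym uv'))) => -[uu vv]; first by rewrite uu vv.
by case: Av; rewrite vv.
Qed.

Lemma within_comp_continuous (T U : topologicalType) (D : set T) (f : T -> U)
    (b : R -> T) : {within D, continuous f} -> continuous b ->
  (forall t, D (b t)) -> continuous (f \o b).
Proof.
move=> /subspace_continuousP fc bc bD t.
move=> N /(fc (b t) (bD t)) /= wN.
have bN : nbhs t (b @^-1` [set x | D x -> N (f x)]) := bc t _ wN.
by apply: filterS bN => s /(_ (bD s)).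
Qed.

(** A punctured circle is connected, so a level between two others cannot be
attained at one point only. *)
Lemma no_circle S F (f : R * R -> Etop R G) : locally_finite G ->
  minimal_linked S F -> {within @unit_circle R, continuous f} ->
  {in @unit_circle R &, injective f} ->
  (forall z, unit_circle z -> edge_space F (f z)) -> False.
Proof.
move=> lf [FE _ minF] fc finj fF.
have ivt (phi : Etop R G -> R) z z1 z2 v : continuous phi -> unit_circle z ->
    unit_circle z1 -> unit_circle z2 -> z1 != z -> z2 != z ->
    phi (f z1) < v < phi (f z2) ->
    exists z', [/\ unit_circle z', z' != z & phi (f z') = v].
  move=> phic Cz Cz1 Cz2 z1z z2z.
  have [t1 <-] := rotated_circle_onto Cz Cz1 z1z.
  have [t2 <-] := rotated_circle_onto Cz Cz2 z2z.
  have kc : continuous (phi \o (f \o rotated_circle z)).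
    move=> t; apply: continuous_comp; last exact: phic.
    apply: within_comp_continuous fc _ _ _; first exact: continuous_rotated_circle.
    by move=> s; exact: rotated_circle_on.
  move=> /(IVT_continuous kc) [t kt]; exists (rotated_circle z t); split=> //.
    exact: rotated_circle_on.
  exact: rotated_circle_neq.
(* On a small arc around an inner point of an edge the cut function is injective
   and so takes three distinct values, the middle one nowhere else. *)
have no_inner z0 x u v t : unit_circle z0 -> adj u v -> 0 < t < 1 ->
    f z0 = OfPoint x -> coord x = edge_coord u v t -> False.
  move=> Cz0 uv t01 z0x xE.
  have Fe : F (edge u v) by apply: (fF z0 Cz0 x u v t).
  have [A [fA _ _ AF]] := minF _ Fe.
  have [phi phiP] := cut_function_id lf fA.
  have phic := cutf_continuous phiP.
  have kinj z z' : unit_circle z -> unit_circle z' -> 0 < phi (f z) < 1 ->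
      phi (f z) = phi (f z') -> z = z'.
    move=> Cz Cz' z01 E; apply: finj; rewrite ?inE//.
    exact: cutf_edge_inj AF phiP (fF _ Cz) (fF _ Cz') z01 E.
  have three z1 z2 z3 : unit_circle z1 -> unit_circle z2 -> unit_circle z3 ->
      0 < phi (f z2) < 1 -> phi (f z1) < phi (f z2) -> phi (f z2) < phi (f z3) -> False.
    move=> C1 C2 C3 z01 h12 h23.
    have [|||z [Cz zz2 /esym/kinj E]] := ivt phi z2 z1 z3 (phi (f z2)) phic C2 C1 C3.
    - by apply: contraTneq h12 => ->; rewrite ltxx.
    - by apply: contraTneq h23 => ->; rewrite ltxx.
    - by rewrite h12.
    - by move: zz2; rewrite -E// eqxx.
  have phi01 : 0 < phi (f z0) < 1.
    have t01' : 0 <= t <= 1 by case/andP: t01 => ? ?; rewrite !ltW.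
    have : cut A (edge u v).
      by have : [set edge u v] (edge u v) by []; rewrite -AF => -[].
    rewrite z0x (cutf_edge phiP uv t01' xE) /cut_value (mem_cut _ uv).
    by case/andP: (t01) => t0 t1; case: asboolP => Au; case: asboolP => Av //=;
      [case; tauto| |case; tauto] => _; apply/andP; split; lra.
  have Cz : unit_circle (- z0.1, - z0.2) by rewrite /unit_circle /= !sqrrN; exact: Cz0.
  have zz0 : z0 != (- z0.1, - z0.2).
    apply/eqP => E; have E1 := congr1 fst E; have E2 := congr1 snd E.
    move: Cz0 E1 E2; case: (z0) => a b /=; rewrite /unit_circle /= => ab E1 E2.
    have a0 : a = 0 by lra. have b0 : b = 0 by lra.
    by move: ab; rewrite a0 b0; lra.
  have [t0 t0E] := rotated_circle_onto Cz Cz0 zz0.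
  set r := rotated_circle _ in t0E.
  have rC s : unit_circle (r s) by exact: rotated_circle_on.
  have kc : continuous (phi \o (f \o r)).
    move=> s; apply: continuous_comp; last exact: phic.
    by apply: within_comp_continuous fc _ _ _ => //; exact: continuous_rotated_circle.
  have : nbhs t0 ((phi \o (f \o r)) @^-1` [set y | 0 < y < 1]).
    apply: (kc t0); rewrite /= t0E.
    have in01 : phi (f z0) \in `]0, 1[ by rewrite in_itv.
    by apply: filterS (near_in_itvoo in01) => y; rewrite in_itv.
  move=> /nbhs_ballP[d /= d0 hd].
  have h1 : 0 < phi (f (r t0)) < 1 by apply: hd; exact: ballxx.
  have h2 : 0 < phi (f (r (t0 + d / 2))) < 1.
    by apply: hd; rewrite /ball /= opprD addNKr normrN ger0_norm; lra.
  have h3 : 0 < phi (f (r (t0 - d / 2))) < 1.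
    by apply: hd; rewrite /ball /= subKr ger0_norm; lra.
  have neq s s' : 0 < phi (f (r s)) < 1 -> s != s' -> phi (f (r s)) != phi (f (r s')).
    by move=> s01; apply: contra_neq => /(kinj _ _ (rC s) (rC s') s01); exact: rotated_circle_inj.
  have n12 : phi (f (r t0)) != phi (f (r (t0 + d / 2))) by apply: neq => //; apply/eqP; lra.
  have n13 : phi (f (r t0)) != phi (f (r (t0 - d / 2))) by apply: neq => //; apply/eqP; lra.
  have n23 : phi (f (r (t0 + d / 2))) != phi (f (r (t0 - d / 2))).
    by apply: neq => //; apply/eqP; lra.
  have C1 := rC t0; have C2 := rC (t0 + d / 2); have C3 := rC (t0 - d / 2).
  move: (r t0) (r (t0 + d / 2)) (r (t0 - d / 2)) h1 h2 h3 n12 n13 n23 C1 C2 C3.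
  move=> y1 y2 y3 h1 h2 h3.
  case: (ltgtP (phi (f y1)) (phi (f y2))) => // o12 _;
  case: (ltgtP (phi (f y1)) (phi (f y3))) => // o13 _;
  case: (ltgtP (phi (f y2)) (phi (f y3))) => // o23 _ C1 C2 C3; try lra.
  - exact: (three y1 y2 y3).
  - exact: (three y1 y3 y2).
  - exact: (three y3 y1 y2).
  - exact: (three y2 y1 y3).
  - exact: (three y2 y3 y1).
  - exact: (three y3 y2 y1).
(* Without inner points of edges, a finite cut splits the circle at level 1/2. *)
have bd z : unit_circle z -> sided (f z).
  move=> Cz; case: (edge_space_case (fF z Cz)) => // [] [x [u [v [t [uv t01 zx xE _]]]]].
  by case: (no_inner z x u v t).
pose z1 : R * R := (1, 0); pose z2 : R * R := (-1, 0); pose z3 : R * R := (0, 1).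
have C1 : unit_circle z1 by rewrite /unit_circle /=; lra.
have C2 : unit_circle z2 by rewrite /unit_circle /=; lra.
have C3 : unit_circle z3 by rewrite /unit_circle /=; lra.
have z12 : f z1 <> f z2.
  by move/finj; rewrite !inE => /(_ C1 C2) [] E; lra.
have [A [fA s1 s2]] := separate_sides lf (bd _ C1) (bd _ C2) z12.
have [phi phiP] := cut_function_id lf fA.
have [|||z [Cz _ zE]] := ivt phi z3 z1 z2 (2^-1) (cutf_continuous phiP) C3 C1 C2.
- by apply/eqP => -[]; lra.
- by apply/eqP => -[]; lra.
- by rewrite (cutf_side_in phiP s1) (cutf_side_out phiP s2); lra.
have := bd z Cz A => -[/(cutf_side_in phiP)|/(cutf_side_out phiP)]; rewrite zE; lra.
Qed.

End NoCircle.

(** * Rays from infinite walks *)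

(** Finite walks from [v n] to [v n.+1] are concatenated. As none of them is
empty, the first n pieces have total length at least n, which makes the m-th
vertex of the limit readable off the first m pieces. *)
Lemma infinite_walk (T : eqType) (e : nat -> rel T) (v : nat -> T) :
  (forall n m, (n <= m) -> subrel (e m) (e n)) ->
  (forall n, exists p, [/\ path (e n) (v n) p, last (v n) p = v n.+1 & p != [::]]) ->
  exists W : nat -> T, (forall m, e 0 (W m) (W m.+1)) /\
    forall n, exists N, W N = v n /\ forall m, N <= m -> e n (W m) (W m.+1).
Proof.
move=> emono /choice[p pP].
pose P := fix P n : seq T := if n is n'.+1 then P n' ++ p n' else [::].
have lastP n : last (v 0) (P n) = v n.
  by elim: n => //= n IH; rewrite last_cat IH; have [] := pP n.
have sizeP n : (n <= size (P n)).
  elim: n => //= n IH; rewrite size_cat; have [_ _] := pP n.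
  by rewrite -size_eq0; lia.
have prefP n k : exists s, P (n + k) = P n ++ s.
  elim: k => [|k [s IH]]; first by exists [::]; rewrite addn0 cats0.
  by exists (s ++ p (n + k)); rewrite addnS /= IH catA.
pose x n m := nth (v 0) (v 0 :: P n) m.
have stable n n' m : (m <= size (P n)) -> (m <= size (P n')) -> x n m = x n' m.
  wlog nn' : n n' / (n <= n').
    by move=> H; case: (leqP n n') => [|/ltnW] h h1 h2; [|apply/esym]; exact: H.
  move=> mn _; rewrite /x; have [s] := prefP n (n' - n); rewrite subnKC// => ->.
  by rewrite -cat_cons nth_cat /= ltnS mn.
have step n k m : (size (P n) <= m < size (P (n + k))) ->
    e n (x (n + k) m) (x (n + k) m.+1).
  elim: k => [|k IH] in m *; first by rewrite addn0; lia.
  rewrite addnS => /andP[nm mk].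
  have [mk'|km] := ltnP m (size (P (n + k))).
    have E j : (j <= size (P (n + k))) -> x (n + k).+1 j = x (n + k) j.
      by move=> jk; apply: stable => //=; rewrite size_cat (leq_trans jk) // leq_addr.
    by rewrite !E //; [apply: IH; rewrite nm|exact: ltnW].
  have [pth _ _] := pP (n + k).
  have -> : x (n + k).+1 m = nth (v 0) (v (n + k) :: p (n + k)) (m - size (P (n + k))).
    rewrite /x /= -cat_cons nth_cat /= ltnS.
    have [mk2|?] := leqP m (size (P (n + k))).
      have -> : m = size (P (n + k)) by lia.
      by rewrite subnn /= -(lastP (n + k)) (last_nth (v 0)).
    by have -> : (m - size (P (n + k)) = (m - (size (P (n + k))).+1).+1) by lia.
  have -> : x (n + k).+1 m.+1 = nth (v 0) (p (n + k)) (m - size (P (n + k))).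
    by rewrite /x /= nth_cat ltnNge km.
  apply: (emono n (n + k) (leq_addr _ _)); move/(pathP (v 0)) : pth; apply.
  by move: mk; rewrite /= size_cat; lia.
have steps n m : size (P n) <= m -> e n (x m m) (x m.+1 m.+1).
  move=> nm; have big j : (j <= m.+1)%N -> (j <= size (P (n + m.+1)))%N.
    by move=> jm; apply: leq_trans (sizeP _); rewrite (leq_trans jm) ?leq_addl.
  rewrite (stable m (n + m.+1) m (sizeP m) (big m (leqnSn m))).
  rewrite (stable m.+1 (n + m.+1) m.+1 (sizeP m.+1) (big m.+1 (leqnn _))).
  by apply: step; rewrite nm big.
exists (fun m => x m m); split=> [m|n]; first exact: (steps 0).
exists (size (P n)); split; last exact: steps.
by rewrite -[RHS]lastP (last_nth (v 0)) (stable _ n).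
Qed.

Section Ray.
Variable G : graph.
Local Notation V := (vertex G).

(** Loop erasure: leave each vertex at the time of the last visit to it. The
function [sg] records these times. *)
Lemma ray_of_walk (W : nat -> V) : (forall m, adj (W m) (W m.+1)) ->
  (forall v, exists N, forall m, (N <= m) -> W m != v) ->
  exists (r : ray G) (sg : nat -> nat), forall i,
    [/\ (i <= sg i), r i = W (sg i) & r i.+1 = W (sg i).+1].
Proof.
move=> Wadj Wfin.
have lastv m : exists l, W l = W m /\ forall j, (l < j) -> W j != W m.
  have [N hN] := Wfin (W m).
  have exP : exists j, W j == W m by exists m.
  have bnd j : W j == W m -> (j <= N).
    by move=> /eqP E; rewrite leqNgt; apply/negP => /ltnW/hN; rewrite E eqxx.
  case: (ex_maxnP exP bnd) => l /eqP lm max; exists l; split=> // j lj.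
  by apply: contraTneq lj => /eqP/max; rewrite -leqNgt.
have [l lP] := choice lastv.
have l_ge m : (m <= l m).
  have [_ max] := lP m; rewrite leqNgt; apply/negP => /max.
  by rewrite eqxx.
pose sg := fix sg i := if i is j.+1 then l (sg j).+1 else l 0.
have sgS i : sg i.+1 = l (sg i).+1 by [].
have sg_mono i : (sg i < sg i.+1) by rewrite sgS; exact: leq_trans (l_ge _).
have sg_lt i j : (i < j) -> (sg i < sg j).
  by elim: j => // j IH; rewrite ltnS leq_eqVlt => /orP[/eqP <-//|/IH/ltn_trans]; exact.
have sg_last i j : (sg i < j) -> W j != W (sg i).
  by case: i => [|i] /=; [have [E max] := lP 0|have [E max] := lP (sg i).+1];
    rewrite E; exact: max.
have inj : injective (W \o sg).
  move=> i j /= E; apply/eqP; apply: contraT; rewrite neq_ltn => /orP[] /sg_lt/sg_last;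
    by rewrite E eqxx.
have radj i : adj ((W \o sg) i) ((W \o sg) i.+1).
  by rewrite /=; have [-> _] := lP (sg i).+1.
exists (Ray inj radj), sg => i; split=> //.
  elim: i => // i IH; exact: leq_ltn_trans IH (sg_mono i).
by rewrite /=; have [-> _] := lP (sg i).+1.
Qed.

End Ray.

Lemma ultra_bigcup (T : Type) (I : choiceType) (U : set_system T)
    (D : set I) (P : I -> set T) : UltraFilter U -> finite_set D ->
  U (\bigcup_(i in D) P i) -> exists2 i, D i & U (P i).
Proof.
move=> UU /finite_seqP[s ->]; elim: s => [|i s IH].
  rewrite (_ : \bigcup_(_ in _) _ = set0); first by move/filter_ex => [].
  by rewrite -subset0 => x [j] /=.
move=> Us; have [Ui|Ui] := in_ultra_setVsetC (P i) UU; first by exists i => //=; exact: mem_head.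
have [|j js Uj] := IH; last by exists j => //=; rewrite in_cons; apply/orP; right.
apply: filterS (filterI Us Ui) => x [[j /=]]; rewrite in_cons => /orP[/eqP ->|js] Pj ni //.
by exists j.
Qed.

(** * Compactness of the edge-end compactification *)

Section Exhaustion.
Local Open Scope ring_scope.
Variable G : graph.
Local Notation V := (vertex G).
Hypotheses (lf : locally_finite G) (conn : connected_graph G).

Fixpoint ball_at (v0 : V) n : set V :=
  if n is m.+1 then ball_at v0 m `|` \bigcup_(v in ball_at v0 m) [set w | adj v w]
  else [set v0].

Lemma finite_ball_at v0 n : finite_set (ball_at v0 n).
Proof.
elim: n => [|n IH] /=; first exact: finite_set1.
by rewrite finite_setU; split=> //; apply: bigcup_finite => // v _; exact: lf.
Qed.

Lemma ball_at_mono v0 n m : (n <= m)%N -> ball_at v0 n `<=` ball_at v0 m.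
Proof.
elim: m => [|m IH]; first by rewrite leqn0 => /eqP ->.
by rewrite leq_eqVlt ltnS => /orP[/eqP -> //|/IH h] v /h; left.
Qed.

Lemma ball_at_cover v0 v : exists n, ball_at v0 n v.
Proof.
have [p [pp <- _]] := conn.2 v0 v.
elim/last_ind: p pp => [|p w IH] pp; first by exists 0%N.
move: pp; rewrite rcons_path last_rcons => /andP[/IH[n vn] vw].
by exists n.+1; right; exists (last v0 p).
Qed.

(** An exhaustion of the edge set by finite sets. *)
Definition edge_ball v0 n := edges_at (ball_at v0 n).

Lemma finite_edge_ball v0 n : finite_set (edge_ball v0 n).
Proof. by apply: finite_edges_at => //; exact: finite_ball_at. Qed.

Lemma edge_ball_mono v0 n m : (n <= m)%N -> edge_ball v0 n `<=` edge_ball v0 m.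
Proof. by move=> nm e [eE [v vn ev]]; split=> //; exists v => //; exact: ball_at_mono nm _ vn. Qed.

Lemma edge_ball_cover v0 X : finite_set X -> X `<=` @edges G ->
  exists n, X `<=` edge_ball v0 n.
Proof.
move=> fX XE; pose C := range (edge_ball v0).
have [||||_ [n _ <-] sub] := @chain_bound _ C X; last by exists n.
- move=> _ _ [n _ <-] [m _ <-]; case: (leqP n m) => [|/ltnW] nm.
    by left; exact: edge_ball_mono.
  by right; exact: edge_ball_mono.
- by exists (edge_ball v0 0), 0%N.
- exact: fX.
- move=> e eX; have [u [v [uv eE]]] := XE _ eX; have [n un] := ball_at_cover v0 u.
  exists (edge_ball v0 n); first by exists n.
  by split; [exact: XE|exists u => //; rewrite eE; left].
Qed.

Lemma countable_edges : countable (@edges G).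
Proof.
have [v0 _] := conn.1.
apply: (@sub_countable _ _ _ (\bigcup_n edge_ball v0 n)).
  apply: subset_card_le => e eE.
  have [n en] := edge_ball_cover v0 (finite_set1 e) (fun x (h : x = e) => eq_ind_r _ eE h).
  by exists n => //; exact: en.
by apply: bigcup_countable => // n _; exact/finite_set_countable/finite_edge_ball.
Qed.

(** So G - X has finitely many components: each meets the finite set of
endpoints of edges in [X]. *)
Lemma component_touch X a : X !=set0 -> X `<=` @edges G ->
  exists v, (\bigcup_(e in X) e) v /\ component X a v.
Proof.
move=> [e0 Xe0] XE; have [b [c [bc e0E]]] := XE _ Xe0.
have Eb : (\bigcup_(e in X) e) b by exists e0 => //; rewrite e0E; left.
have [p [pp pb _]] := conn.2 a b; rewrite -pb in Eb.
elim: p a pp Eb {pb} => [|w p IH] a /= pp Eb.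
  by exists a; split=> //; exact: component_refl.
have [Ea|Ea] := pselect ((\bigcup_(e in X) e) a).
  by exists a; split=> //; exact: component_refl.
have /andP[aw /IH/(_ Eb)[v [Ev wv]]] := pp; exists v; split=> //.
apply: component_trans wv; apply: component_adj (component_refl X a) _.
rewrite /adj_minus aw; apply/negP => /set_mem Xaw.
by apply: Ea; exists (edge a w) => //; left.
Qed.

Lemma has_neighbor (u : V) : infinite_set [set: V] -> exists v, adj u v.
Proof.
move=> inf; apply: contrapT => none; apply: inf.
apply: sub_finite_set (finite_set1 u) => v _.
have [[|w p] [/= pp <- _]] := conn.2 u v => //.
by case: none; exists w; case/andP: pp.
Qed.

End Exhaustion.

Section Compactness.
Local Open Scope ring_scope.
Variables (R : realType) (G : graph).
Local Notation V := (vertex G).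
Hypotheses (lf : locally_finite G) (conn : connected_graph G).
Hypothesis inf : infinite_set [set: V].
Implicit Types (X : set (set V)) (p : Etop R G).

Definition closed_edge (u v : V) : set (Etop R G) := (@OfPoint R G) @` edge_points u v.

(** The trace on the space of one component of G - X. Together with the edges in
[X], finitely many regions cover the space. *)
Definition region X v : set (Etop R G) :=
  (@OfEnd R G) @` [set w | end_component X w v] `|`
  (@OfPoint R G) @` component_points X (component X v).

Lemma edge_coord_right (u v : V) (t : R) : adj u v -> edge_coord u v t v = t.
Proof.
move=> uv; rewrite /edge_coord /vertex_coord eqxx.
have -> : v == u = false by apply/eqP => vu; rewrite vu adj_irr in uv.
by rewrite mulr0 mulr1 add0r.
Qed.

Lemma edge_coord_left (u v : V) (t : R) : adj u v -> edge_coord u v t u = 1 - t.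
Proof. by move=> uv; rewrite edge_coordC edge_coord_right// adj_sym. Qed.

Lemma component_points_mem X (C : set V) (x : complex_point R G) a :
  component_points X C x -> 0 < coord x a -> C a.
Proof.
case=> [[u uC ->]|[u [v [uC vC uv [t t01 ->]]]]] /=; rewrite ?/edge_coord /vertex_coord.
  by have [-> //|_] := eqVneq a u; rewrite ltxx.
by have [-> //|_] := eqVneq a u; have [-> //|_] := eqVneq a v; rewrite !mulr0 addr0 ltxx.
Qed.

Lemma point_pos (x : complex_point R G) : exists a, 0 < coord x a.
Proof.
have [a ->|u v t uv /andP[t0 t1] ->] := point_case x.
  by exists a; rewrite /= /vertex_coord eqxx.
by exists u; rewrite edge_coord_left// subr_gt0.
Qed.

Lemma region_meet X a b p : region X a p -> region X b p -> component X a b.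
Proof.
case: p => [x|w] [[w' wa [//]]|[x' xa [//]]].
  move=> E [[w' _ [//]]|[y xb [yE]]]; rewrite E {x' E} in xa; rewrite yE in xb.
  have [c c0] := point_pos x.
  have ac := component_points_mem xa c0; have bc := component_points_mem xb c0.
  by apply: component_trans ac _; exact: component_sym.
move=> E; rewrite E {w' E} in wa => -[[w' wb [E]]|[x _ [//]]]; rewrite E in wb.
have [r wr] := edge_end_ray w; exact: tail_in_component (wa _ wr) (wb _ wr).
Qed.

Lemma region_sub X X' v : X `<=` X' -> region X' v `<=` region X v.
Proof.
move=> XX' p [[w wv <-]|[x xv <-]]; [left|right].
  by exists w => //; exact: end_component_sub wv.
exists x => //; case: xv => [[u uC ->]|[a [b [aC bC ab xab]]]].
  by left; exists u => //; exact: component_sub uC.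
by right; exists a, b; split=> //; [exact: component_sub aC|exact: component_sub bC
  |exact: adj_minus_sub ab].
Qed.

Lemma isolated_component X a v : (forall e, edges e -> e a -> X e) ->
  component X a v -> v = a.
Proof.
move=> aX [[|w p] /= + <- //] => /andP[/andP[aw /negP nX] _]; case: nX.
by apply/mem_set/aX; [exists a, w|left].
Qed.

(** Such a region is contained in a closed edge, so an ultrafilter without closed
edges does not contain it. *)
Lemma region_isolated X a : (forall e, edges e -> e a -> X e) ->
  region X a `<=` [set OfPoint (vertex_point R a)].
Proof.
move=> aX p [[w wa]|[x xa <-]]; first by case: (end_component_avoid aX wa).
case: xa => [[u /(isolated_component aX) -> -> //]|[u [v [uC vC uv _]]]].
have ua := isolated_component aX uC; have va := isolated_component aX vC.
by case/andP: uv; rewrite ua va adj_irr.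
Qed.

Lemma region_cover X p : finite_set X -> X !=set0 -> X `<=` @edges G ->
  (exists u v, [/\ adj u v, X (edge u v) & closed_edge u v p]) \/
  exists2 v, (\bigcup_(e in X) e) v & region X v p.
Proof.
move=> fX X0 XE; case: p => [x|w]; last first.
  have [a aC] := end_component_neq0 w fX XE.
  have [v [Ev av]] := component_touch conn a X0 XE.
  right; exists v => //; left; exists w => //=.
  by rewrite (end_componentE aC).
have [a ->|u v t uv t01 xE] := point_case x.
  have [v [Ev av]] := component_touch conn a X0 XE.
  by right; exists v => //; right; exists (vertex_point R a) => //; left; exists a => //;
    exact: component_sym.
have t01' : 0 <= t <= 1 by case/andP: t01 => ? ?; rewrite !ltW.
have [Xuv|Xuv] := pselect (X (edge u v)).
  by left; exists u, v; split=> //; exists x => //; exists t.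
have am : adj_minus X u v by rewrite /adj_minus uv; apply/negP => /set_mem.
have [b [Eb ub]] := component_touch conn u X0 XE.
right; exists b => //; right; exists x => //; right; exists u, v.
have bu := component_sym ub.
by split=> //; [exact: component_adj bu am|exists t].
Qed.

(** The parameters along the edge cluster in the unit interval, and an
ultrafilter converges to its cluster points. *)
Lemma closed_edge_ultra_cvg u v (U : set_system (Etop R G)) : adj u v ->
  UltraFilter U -> U (closed_edge u v) -> exists p, U --> p.
Proof.
move=> uv UU Ue.
pose T p : R := if p is OfPoint x then coord x v else 0.
have Tedge p : closed_edge u v p -> exists x, [/\ p = OfPoint x, 0 <= T p <= 1 &
    coord x = edge_coord u v (T p)].
  by move=> [x [t t01 xE] <-]; exists x; rewrite /= xE edge_coord_right.
have UT : U (T @^-1` `[0, 1]%classic).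
  by apply: filterS Ue => p /Tedge[x [_ Tp _]]; change (is_true (T p \in `[0, 1])); rewrite in_itv.
have [t0 [t01 clt]] := @segment_compact R 0 1 (T @ U) _ UT.

have {}t01 : 0 <= t0 <= 1 by move: t01; rewrite /= in_itv.
suff [p0 near_p0] : exists p0 : Etop R G, forall N, nbhs p0 N ->
    exists2 d : R, 0 < d & forall p, closed_edge u v p -> `|T p - t0| < d -> N p.
  exists p0; have : cluster U p0; last by rewrite ultra_cvg_clusterE.
  move=> A N UA /near_p0[d d0 dN].
  have UTA : U (T @^-1` (T @` (A `&` closed_edge u v))).
    by apply: filterS (filterI UA Ue) => p pA; exists p.
  have [t [[p [Ap pe] <-] td]] := clt _ _ UTA (nbhsx_ballx t0 d d0).
  by exists p; split=> //; apply: dN => //; rewrite distrC.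
have small n : 0 < n.+1%:R^-1 :> R by rewrite invr_gt0.
have [t00|t0n0] := eqVneq t0 0.
  exists (OfPoint (vertex_point R u)) => N /nbhs_vertex[n nN].
  exists n.+1%:R^-1 => // p /Tedge[x [-> /andP[Tp0 _] xE]] Td; apply: nN.
  exists x => //=; rewrite xE edge_coord_left// subKr.
  by move: Td; rewrite t00 subr0 ger0_norm.
have [t11|t0n1] := eqVneq t0 1.
  exists (OfPoint (vertex_point R v)) => N /nbhs_vertex[n nN].
  exists n.+1%:R^-1 => // p /Tedge[x [-> /andP[_ Tp1] xE]] Td; apply: nN.
  exists x => //=; rewrite xE edge_coord_right//.
  by move: Td; rewrite t11 ler0_norm ?opprB// subr_le0.
have {}t01 : 0 < t0 < 1 by rewrite !lt_neqAle t0n1 eq_sym t0n0.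
have [x0 x0E] : exists x0 : complex_point R G, coord x0 = edge_coord u v t0.
  have cP : (exists u0, edge_coord u v t0 = vertex_coord R u0) \/
      (exists u0 v0 t, [/\ adj u0 v0, 0 <= t <= 1 & edge_coord u v t0 = edge_coord u0 v0 t]).
    by right; exists u, v, t0; split=> //; case/andP: t01 => ? ?; rewrite !ltW.
  by exists (Point cP).
exists (OfPoint x0) => N /(nbhs_inner _ uv t01 x0E)[e e0 eN].
case/andP: t01 => t0_gt0 t0_lt1.
exists (Num.min e (Num.min t0 (1 - t0))).
  by rewrite !lt_min e0 t0_gt0 subr_gt0.
move=> p /Tedge[x [-> _ xE]]; rewrite !lt_min => /andP[Te].
rewrite !ltr_norml => /andP[/andP[T1 T2] /andP[T3 T4]]; apply: eN.
exists x => //; exists (T (OfPoint x)); split=> //.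
by rewrite /= in T1 T2 T3 T4 *; apply/andP; split; lra.
Qed.

(** An ultrafilter that contains no closed edge picks, for each finite set [X n]
of the exhaustion, one component of G - X n. These components decrease and leave
every finite set of vertices, so a walk through all of them contains a ray, and
the ultrafilter converges to the end of this ray. *)
Theorem Etop_compact : compact [set: Etop R G].
Proof.
rewrite compact_ultra => U UU _.
suff [p pU] : exists p, U --> p by exists p.
have [[u [v [uv Ue]]]|noedge] := pselect (exists u v, adj u v /\ U (closed_edge u v)).
  exact: closed_edge_ultra_cvg Ue.
have [v0 _] := conn.1.
have [v1 v01] := has_neighbor conn v0 inf.
pose X := edge_ball v0.
have XE n : X n `<=` @edges G by exact: edges_at_sub.
have fX n : finite_set (X n) by exact: finite_edge_ball.
have ball0 n : ball_at v0 n v0 by apply: (@ball_at_mono _ _ 0).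
have X0 n : X n !=set0.
  exists (edge v0 v1); split; first by exists v0, v1.
  by exists v0 => //; left.
have vP n : exists v, (\bigcup_(e in X n) e) v /\ U (region (X n) v).
  have : U ([set p | exists u v, [/\ adj u v, X n (edge u v) & closed_edge u v p]] `|`
            \bigcup_(v in \bigcup_(e in X n) e) region (X n) v).
    apply: filterS (@filterT _ U _) => p _.
    by have [h|[v Ev vp]] := region_cover p (fX n) (X0 n) (XE n); [left|right; exists v].
  move=> Ucov.
  have [Uc|Uc] := in_ultra_setVsetC (\bigcup_(v in \bigcup_(e in X n) e) region (X n) v) UU.
    have [|v Ev Uv] := ultra_bigcup UU _ Uc; last by exists v.
    by apply: bigcup_finite => // e /XE [u [v [_ ->]]]; exact: finite_set2.
  pose P (e : set V) := [set p | exists u v, [/\ adj u v, e = edge u v & closed_edge u v p]].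
  have Ub : U (\bigcup_(e in X n) P e).
    apply: filterS (filterI Ucov Uc) => p [[|//] + _].
    by move=> [u [v [uv Xuv uvp]]]; exists (edge u v) => //; exists u, v.
  have [e Xe Ue] := ultra_bigcup UU (fX n) Ub.
  case: noedge; have [u [v [uv eE]]] := XE _ _ Xe; exists u, v; split=> //.
  apply: filterS Ue => p [u' [v' [uv' eE' [x [t t01 xE] <-]]]].
  exists x => //; have [[-> ->]|[-> ->]] := edge_inj (etrans (esym eE) eE'); first by exists t.
  exists (1 - t); last by rewrite -edge_coordC.
  by case/andP: t01 => ? ?; apply/andP; split; lra.
have [v /all_and2[vE Uv]] := choice vP.
have comp_v n m : (n <= m)%N -> component (X n) (v n) (v m).
  move=> nm; have Um : U (region (X n) (v m)).
    by apply: filterS (Uv m); exact/region_sub/edge_ball_mono.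
  by have [p [pn pm]] := filter_ex (filterI (Uv n) Um); exact: region_meet pn pm.
(* If the n-th component met the n-th ball it would be a single vertex, whose
   region lies in a closed edge. *)
have far n a : component (X n) (v n) a -> ~ ball_at v0 n a.
  move=> na Ba.
  have aX e : edges e -> e a -> X n e by move=> eE ea; split=> //; exists a.
  have va := isolated_component aX (component_sym na).
  have [b ab] := has_neighbor conn a inf; case: noedge; exists a, b; split=> //.
  apply: filterS (Uv n); rewrite va => p /(region_isolated aX) ->.
  exists (vertex_point R a) => //; exists 0; first by rewrite lexx ler01.
  by rewrite edge_coord0.
have [||W [W0 WP]] := @infinite_walk V (fun n => adj_minus (X n)) v.
- move=> n m nm a b; exact/adj_minus_sub/edge_ball_mono.
- move=> n; have [p pp pl] := comp_v n n.+1 (leqnSn n); exists p; split=> //.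
  apply/eqP => p0; rewrite p0 /= in pl.
  apply: (far n.+1 (v n.+1) (component_refl _ _)); rewrite -pl.
  have [e [eE [a Ba ea]] ev] := vE n; move: eE ea ev => [b [c [bc ->]]].
  move=> [] /= ab [] /= ->; rewrite ab {ab} in Ba.
  + by left.
  + by right; exists b.
  + by right; exists c => //=; rewrite adj_sym.
  + by left.
have [N NP] := choice WP.
have WC n m : (N n <= m)%N -> component (X n) (v n) (W m).
  have [WN step] := NP n; move=> /subnKC <-; elim: (m - N n)%N => [|k IH].
    by rewrite addn0 WN; exact: component_refl.
  by rewrite addnS; apply: component_adj IH _; apply: step; exact: leq_addr.
have Wadj m : adj (W m) (W m.+1).
  by case/andP: (W0 m).
have [|r [sg rP]] := ray_of_walk Wadj.
  move=> a; have [n an] := ball_at_cover conn v0 a; exists (N n) => m /WC mC.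
  by apply/eqP => E; rewrite E in mC; exact: far mC an.
have rC n : tail_in (X n) (component (X n) (v n)) r.
  exists (N n) => i ni; have [isg -> ->] := rP i.
  have nsg := leq_trans ni isg.
  by split; [exact: WC|exact: (NP n).2].
pose w : edge_end G := exist _ _ (ex_intro _ r erefl).
exists (OfEnd R w) => M /nbhs_basic[B [bB Bw BM]].
have [Y [fY YE YB]] := basic_at_end bB Bw.
have [n Yn] := edge_ball_cover conn v0 fY YE.
have vw : end_component (X n) w (v n).
  move=> r' /= rr'; have [c [cr cr']] := rr' (X n) (fX n) (XE n).
  apply: tail_in_sub cr' => // x cx; apply: component_trans cx.
  exact: tail_in_component (rC n) cr.
apply: filterS (Uv n) => p pn; apply/BM/(YB _ (fX n) (XE n) Yn).
case: pn => [[w' w'v <-]|[x xv <-]].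
  by left; left; exists w' => //=; rewrite (end_componentE w'v) (end_componentE vw).
by left; right; exists x => //; rewrite (end_componentE vw).
Qed.

End Compactness.

(** * Arcs from compact linearly ordered sets *)

Section WeightedSum.
Local Open Scope ring_scope.
Variables (R : realType) (T : topologicalType) (psi : nat -> T -> R).
Hypotheses (psic : forall n, continuous (psi n)) (psi01 : forall n p, 0 <= psi n p <= 1).

Definition partial_sum N p : R := \sum_(n < N) psi n p * 2^-1 ^+ n.+1.

(** A continuous function that is strictly increasing for the order defined by
the family [psi]. *)
Definition weighted_sum p : R := limn (partial_sum ^~ p).

Lemma partial_sumS N p : partial_sum N.+1 p = partial_sum N p + psi N p * 2^-1 ^+ N.+1.
Proof. exact: big_ord_recr. Qed.

Lemma half_gt0 n : 0 < 2^-1 ^+ n :> R.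
Proof. by rewrite exprn_gt0 // invr_gt0. Qed.

Lemma partial_sum_nondecreasing p : nondecreasing_seq (partial_sum ^~ p).
Proof.
apply/nondecreasing_seqP => n; rewrite partial_sumS lerDl.
by apply: mulr_ge0; [case/andP: (psi01 n p)|exact/ltW/half_gt0].
Qed.

Lemma partial_sum_le N k p : partial_sum (N + k)%N p + 2^-1 ^+ (N + k)%N <=
  partial_sum N p + 2^-1 ^+ N.
Proof.
elim: k => [|k]; first by rewrite addn0.
apply: le_trans; rewrite addnS partial_sumS exprS.
have /andP[_ h] := psi01 (N + k)%N p; have g := half_gt0 (N + k)%N.
by move: h g; move: (partial_sum _ _) (psi _ p) (_ ^+ _) => a b c; nra.
Qed.

Lemma partial_sum_cvg p : cvgn (partial_sum ^~ p).
Proof.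
apply: nondecreasing_is_cvgn; first exact: partial_sum_nondecreasing.
exists (partial_sum 0 p + 2^-1 ^+ 0) => _ [k _ <-].
apply: le_trans (partial_sum_le 0 k p); rewrite add0n lerDl.
exact/ltW/half_gt0.
Qed.

Lemma weighted_sum_bounds N p :
  partial_sum N p <= weighted_sum p <= partial_sum N p + 2^-1 ^+ N.
Proof.
rewrite /weighted_sum; apply/andP; split.
  exact: (nondecreasing_cvgn_le (@partial_sum_nondecreasing p) (@partial_sum_cvg p)).
apply: limr_le; first exact: partial_sum_cvg.
exists N => // k /= Nk; apply: le_trans (partial_sum_le N (k - N)%N p).
by rewrite subnKC// lerDl; exact/ltW/half_gt0.
Qed.

Lemma weighted_sum_continuous : continuous weighted_sum.
Proof.
have sc N : continuous (partial_sum N).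
  elim: N => [|N IH].
    rewrite (_ : partial_sum 0 = cst 0); first exact: cst_continuous.
    by apply/funext => p; rewrite /partial_sum big_ord0.
  rewrite (_ : partial_sum N.+1 = fun p => partial_sum N p + psi N p * 2^-1 ^+ N.+1).
    by move=> p; apply: cvgD; [exact: IH|apply: cvgM; [exact: psic|exact: cvg_cst]].
  by apply/funext => p; exact: partial_sumS.
move=> p; apply/cvgrPdist_lt => e e0.
have [N hN] : exists N, 2^-1 ^+ N < e / 2 :> R.
  have h2 : `|2^-1 : R| < 1 by rewrite ger0_norm ?invr_ge0// invf_lt1// ltr1n.
  have /cvgrPdist_lt/(_ (e / 2) (divr_gt0 e0 (ltr0n _ 2)))[N _ /(_ N (leqnn N))] := cvg_expr h2.
  by rewrite /= sub0r normrN ger0_norm ?(ltW (half_gt0 _))//; exists N.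
have /cvgrPdist_lt/(_ (e / 2) (divr_gt0 e0 (ltr0n _ 2))) := sc N p.
apply: filterS => q /=.
have /andP[p1 p2] := weighted_sum_bounds N p; have /andP[q1 q2] := weighted_sum_bounds N q.
rewrite !ltr_norml => /andP[h1 h2]; move: p1 p2 q1 q2 h1 h2 hN.
move: (weighted_sum p) (weighted_sum q) (partial_sum N p) (partial_sum N q) (_ ^+ N).
by move=> a b c d f *; apply/andP; split; lra.
Qed.

Lemma weighted_sum_mono p q n : (forall m, psi m p <= psi m q) ->
  weighted_sum p + (psi n q - psi n p) * 2^-1 ^+ n.+1 <= weighted_sum q.
Proof.
move=> pq.
have step N : partial_sum N q - partial_sum N p <= weighted_sum q - weighted_sum p.
  have dec k : partial_sum N q - partial_sum N p <=
      partial_sum (N + k)%N q - partial_sum (N + k)%N p.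
    elim: k => [|k]; first by rewrite addn0.
    move/le_trans; apply; rewrite addnS !partial_sumS.
    have h := pq (N + k)%N; have g := half_gt0 (N + k).+1.
    move: h g; move: (partial_sum _ q) (partial_sum _ p) (psi _ p) (psi _ q) (_ ^+ _).
    by move=> a b c d f; nra.
  have cv : (partial_sum ^~ q - partial_sum ^~ p) @ \oo --> weighted_sum q - weighted_sum p.
    by apply: cvgB; exact: partial_sum_cvg.
  rewrite -(cvg_lim (@Rhausdorff R) cv); apply: limr_ge; first by apply/cvg_ex; eexists; exact: cv.
  by exists N => // k /= Nk; rewrite -(subnKC Nk); exact: dec.
have h0 : 0 <= partial_sum n q - partial_sum n p.
  rewrite subr_ge0; apply: ler_sum => i _; apply: ler_wpM2r => //; exact/ltW/half_gt0.
have := step n.+1; rewrite !partial_sumS.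
move: h0; move: (partial_sum n q) (partial_sum n p) (weighted_sum q) (weighted_sum p).
move: (psi n q) (psi n p) (_ ^+ _) => a b c d f g h; nra.
Qed.

End WeightedSum.

Section OrderedCompact.
Local Open Scope ring_scope.
Variables (R : realType) (T : topologicalType) (K : set T) (psi : nat -> T -> R).
Hypotheses (psic : forall n, continuous (psi n)) (psi01 : forall n p, 0 <= psi n p <= 1).
Hypothesis compactK : compact K.
Hypothesis totalK : forall p q, K p -> K q ->
  (forall n, psi n p <= psi n q) \/ (forall n, psi n q <= psi n p).
Hypothesis sepK : forall p q, K p -> K q -> (forall n, psi n p = psi n q) -> p = q.
Hypothesis denseK : forall n p q, K p -> K q -> psi n p < psi n q ->
  exists2 x, K x & psi n p < psi n x < psi n q.

(** The weighted sum of the [psi n] is injective on [K]; its inverse is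
continuous because it maps the compact traces of closed sets to closed sets. It
attains every intermediate value: at a gap in the image, the last point of [K]
below and the first one above differ in some [psi n], and the density hypothesis
puts a point of [K] between them. *)
Lemma ordered_compact_path s s' : K s -> K s' -> (forall n, psi n s <= psi n s') ->
  exists f : R -> T, [/\ continuous f, f 0 = s, f 1 = s' & forall t, K (f t)].
Proof.
move=> Ks Ks' ss'; pose tau := weighted_sum psi.
have tauc : continuous tau by exact: weighted_sum_continuous.
have tau_lt p q n : K p -> K q -> psi n p < psi n q -> tau p < tau q.
  move=> Kp Kq pq; have [le|le] := totalK Kp Kq; last by have := le n; lra.
  apply: lt_le_trans (weighted_sum_mono psi01 n le).
  by rewrite ltrDl mulr_gt0 ?subr_gt0// half_gt0.
have tau_le : tau s <= tau s'.
  apply: le_trans (weighted_sum_mono psi01 0%N ss').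
  by rewrite lerDl mulr_ge0 ?subr_ge0// ltW// half_gt0.
have tau_inj p q : K p -> K q -> tau p = tau q -> p = q.
  move=> Kp Kq E; apply: sepK => // n; apply/eqP.
  by case: ltgtP => // [/(tau_lt p q n Kp Kq)|/(tau_lt q p n Kq Kp)]; rewrite E ltxx.
have tau_onto t : tau s <= t <= tau s' -> exists p, K p /\ tau p = t.
  move=> /andP[st ts']; apply: contrapT => none.
  have clK (D : set R) : closed D -> compact (K `&` tau @^-1` D).
    by move=> cD; apply: compact_closedI => //; apply: preimage_closed => // x _; exact: tauc.
  have wc (D : set T) : {within D, continuous tau} by exact: continuous_subspaceT.
  have [|p] := compact_EVT_max _ (clK [set y | y <= t] (@closed_le R t)) (wc _).
    by exists s.
  rewrite inE => -[Kp /= pt] pmax.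
  have [|q] := compact_EVT_min _ (clK [set y | t <= y] (@closed_ge R t)) (wc _).
    by exists s'.
  rewrite inE => -[Kq /= tq] qmin.
  have ptl : tau p < t by rewrite lt_neqAle pt andbT; apply/eqP => E; apply: none; exists p.
  have tql : t < tau q by rewrite lt_neqAle tq andbT; apply/eqP => E; apply: none; exists q.
  have [n pq] : exists n, psi n p < psi n q.
    apply: contrapT => nopq.
    have qp m : psi m q <= psi m p by rewrite leNgt; apply/negP => h; apply: nopq; exists m.
    have := weighted_sum_mono psi01 0%N qp; rewrite -!/(tau _).
    have : 0 <= (psi 0%N p - psi 0%N q) * 2^-1 ^+ 1.
      by rewrite mulr_ge0 ?subr_ge0// ltW// half_gt0.
    by lra.
  have [x Kx /andP[px xq]] := denseK Kp Kq pq.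
  have [xt|tx] := leP (tau x) t.
    have : tau x <= tau p by apply: pmax; rewrite inE.
    by have := tau_lt _ _ _ Kp Kx px; lra.
  have : tau q <= tau x by apply: qmin; rewrite inE; split=> //; exact: ltW.
  by have := tau_lt _ _ _ Kx Kq xq; lra.
pose c t : R := tau s + Num.max 0 (Num.min t 1) * (tau s' - tau s).
have clamp (t : R) : 0 <= Num.max 0 (Num.min t 1) <= 1.
  by rewrite le_max lexx /= ge_max ler01 /= ge_min lexx orbT.
have c_in t : tau s <= c t <= tau s'.
  rewrite /c; have := clamp t; move: (Num.max _ _) => a /andP[a0 a1].
  by move: tau_le; move: (tau s) (tau s') => x y xy; apply/andP; split; nra.
have cc : continuous c.
  move=> t; apply: cvgD; first exact: cvg_cst.
  apply: cvgM; last exact: cvg_cst.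
  apply: (@continuous_max R R (cst 0) (fun t => Num.min t 1) t); first exact: cst_continuous.
  by apply: (@continuous_min R R id (cst 1) t); [exact: cvg_id|exact: cst_continuous].
have /choice[f fP] t : exists p, K p /\ tau p = c t by exact: tau_onto.
exists f; split; last by move=> t; exact: (fP t).1.
- apply/continuous_closedP => C cC.
  have -> : f @^-1` C = c @^-1` (tau @` (K `&` C)).
    apply/seteqP; split=> t /=.
      by move=> Ct; exists (f t); [split=> //; exact: (fP t).1|exact: (fP t).2].
    move=> [p [Kp Cp] pt]; have [Kf ft] := fP t.
    by rewrite (tau_inj (f t) p) // ft pt.
  apply: preimage_closed; first by move=> t _; exact: cc.
  apply: compact_closed; first exact: Rhausdorff.
  apply: continuous_compact; last exact: compact_closedI.
  exact: continuous_subspaceT.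
- apply: tau_inj => //; first exact: (fP 0).1.
  by rewrite (fP 0).2 /c minElt ltr01 maxxx mul0r addr0.
- apply: tau_inj => //; first exact: (fP 1).1.
  by rewrite (fP 1).2 /c minxx maxElt ltr01 mul1r addrC subrK.
Qed.

End OrderedCompact.

(** * Curves along linked sets *)

Section SideVertex.
Local Open Scope ring_scope.
Variables (R : realType) (G : graph).
Local Notation V := (vertex G).

(** Finitely many cuts cannot tell a vertex or an end from a suitable vertex. *)
Lemma side_vertex (p : Etop R G) X : finite_set X -> X `<=` @edges G ->
  sided p ->
  exists v, forall A, cut A `<=` X -> (A v <-> side A p).
Proof.
case: p => [x|w] fX XE bd.
  have [a xa] : exists a, x = vertex_point R a.
    by have [] := bd setT; move=> [a _ ->]; exists a.
  exists a => A _; split=> [Aa|]; first by exists a.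
  by rewrite xa => -[b Ab /(congr1 (@Defs.coord R G))/= /vertex_coord_inj ->].
have [v vC] := end_component_neq0 w fX XE.
exists v => A AX; have vA := end_component_sub AX vC.
split=> [Av|wA]; last exact: wA.
by have [//|wA] := bd A; rewrite /side cutC in wA; case: (wA v).
Qed.

Lemma cutf01 (A : set V) (phi : Etop R G -> R) p :
  cut_function A (fun _ _ t => t) phi -> 0 <= phi p <= 1.
Proof.
move=> phiP; have [->|n0] := eqVneq (phi p) 0; first by rewrite lexx ler01.
have [->|n1] := eqVneq (phi p) 1; first by rewrite lexx ler01.
by have [x [u [v [t [_ _ _ [/andP[t0 t1] _] ->]]]]] := cutf_inner phiP n0 n1; rewrite !ltW.
Qed.

End SideVertex.

(** In this section [F] is minimal linked for the two vertices [s] and [s'], the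
set [A e] contains [s] and has the private cut of [e], and [e] leaves [A e] from
[u e] to [v e]. *)
Section ArcOrder.
Local Open Scope ring_scope.
Variable G : graph.
Local Notation V := (vertex G).
Variables (F : set (set V)) (s s' : V) (A : set V -> set V) (u v : set V -> V).
Hypothesis linkF : linked [set s; s'] F.
Hypothesis finA : forall e, F e -> finite_set (cut (A e)).
Hypothesis sA : forall e, F e -> A e s.
Hypothesis s'A : forall e, F e -> ~ A e s'.
Hypothesis cutA : forall e, F e -> cut (A e) `&` F = [set e].
Hypothesis uA : forall e, F e -> A e (u e).
Hypothesis vA : forall e, F e -> ~ A e (v e).
Hypothesis uv : forall e, F e -> adj (u e) (v e).
Hypothesis uvE : forall e, F e -> e = edge (u e) (v e).
Implicit Types (B P Q : set V) (e f g h k : set V).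

Lemma mem_u e : F e -> e (u e).
Proof. by move=> Fe; rewrite {1}(uvE Fe); left. Qed.

Lemma mem_v e : F e -> e (v e).
Proof. by move=> Fe; rewrite {1}(uvE Fe); right. Qed.

Lemma mem_end e a : F e -> e a -> a = u e \/ a = v e.
Proof. by move=> Fe; rewrite {1}(uvE Fe) => -[] /= ->; auto. Qed.

Lemma cut_uv B e : F e -> cut B e <-> ~ (B (u e) <-> B (v e)).
Proof. by move=> Fe; rewrite {1}(uvE Fe); apply: mem_cut; exact: uv. Qed.

Lemma cutA_eq e f : F e -> F f -> cut (A e) f -> f = e.
Proof. by move=> Fe Ff c; have : (cut (A e) `&` F) f by []; rewrite cutA. Qed.

Lemma same_side e f a b : F e -> F f -> f <> e -> f a -> f b -> (A e a <-> A e b).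
Proof.
move=> Fe Ff fe fa fb.
have uvf : A e (u f) <-> A e (v f).
  by apply: contrapT => /(cut_uv (A e) Ff)/(cutA_eq Fe Ff).
by case: (mem_end Ff fa) => ->; case: (mem_end Ff fb) => ->; tauto.
Qed.

(** This is how linkedness is used below: new sets are built from the [A e] by
Boolean operations until no edge of [F] is left in their cut. *)
Lemma linked_uncut B : finite_set (cut B) -> (forall f, F f -> ~ cut B f) ->
  B s -> B s'.
Proof.
move=> fB noB Bs; apply: contrapT => Bs'.
have [||f [Bf Ff]] := linkF fB; last exact: noB Bf.
- by exists s => //; left.
- by exists s' => //; right.
Qed.

(** If edges [e] and [f] of [F] lay on different sides of [B], say [e] inside,
then removing [B] from [A e], or intersecting [A f] with [B], would destroy the
private cut and still separate [s] from [s']. *)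
Lemma uncut_dichotomy B : finite_set (cut B) -> (forall f, F f -> ~ cut B f) ->
  (forall e a, F e -> e a -> ~ B a) \/ (forall e a, F e -> e a -> B a).
Proof.
move=> fB noB.
have whole e a b : F e -> e a -> e b -> B a -> B b.
  move=> Fe ea eb; have := noB _ Fe; rewrite (cut_uv _ Fe) => /contrapT h.
  by case: (mem_end Fe ea) => ->; case: (mem_end Fe eb) => ->; tauto.
apply: contrapT => /not_orP[/existsNP[e /existsNP[a]]].
move=> /not_implyP[Fe /not_implyP[ea /contrapT Ba]].
move=> /existsNP[f /existsNP[b]] /not_implyP[Ff /not_implyP[fb Bb]].
have eB c : e c -> B c by move=> ec; exact: (whole e a).
have fB' c : f c -> ~ B c by move=> fc Bc; apply: Bb; exact: (whole f c).
have ss' : B s -> B s' by exact: linked_uncut.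
have s's : B s' -> B s.
  move=> Bs'; apply: contrapT => Bs.
  by have := @linked_uncut (~` B); rewrite cutC => /(_ fB noB Bs) nBs'; exact: nBs'.
have [Bs|Bs] := pselect (B s).
  have [] := @linked_uncut (A f `&` B) _ _ _ => //.
  - exact: finite_cutI (finA Ff) fB.
  - move=> g Fg cg; have [/(cutA_eq Ff Fg) gf|] := cutI cg; last exact: noB.
    subst g; have := fB' _ (mem_u Ff); have := fB' _ (mem_v Ff).
    by move: cg; rewrite (cut_uv _ Ff) /setI /=; tauto.
  - by split=> //; exact: sA.
  - by move/(s'A Ff).
have [] := @linked_uncut (A e `\` B) _ _ _ => //.
- exact: finite_cutD (finA Fe) fB.
- move=> g Fg cg; have [/(cutA_eq Fe Fg) ge|] := cutD cg; last exact: noB.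
  subst g; have := eB _ (mem_u Fe); have := eB _ (mem_v Fe).
  by move: cg; rewrite (cut_uv _ Fe) /setD /=; tauto.
- by split=> //; exact: sA.
- by move/(s'A Fe).
Qed.

(** Otherwise the private cuts of [e] and [f] would both disappear from the union,
or from the intersection, of [A e] and [A f]. *)
Lemma edge_order e f : F e -> F f -> e <> f -> (A e (u f) <-> ~ A f (u e)).
Proof.
move=> Fe Ff ef; have fe := nesym ef.
have Euv := same_side Ff Fe ef (mem_u Fe) (mem_v Fe).
have Fuv := same_side Fe Ff fe (mem_u Ff) (mem_v Ff).
split=> [ef1 fe1|nfe].
  have [] := @linked_uncut (A e `|` A f) _ _ _.
  - exact: finite_cutU (finA Fe) (finA Ff).
  - move=> g Fg cg; have [/(cutA_eq Fe Fg)|/(cutA_eq Ff Fg)] := cutU cg => gE; subst g.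
      by move: cg; rewrite (cut_uv _ Fe) /setU /=; have := uA Fe; tauto.
    by move: cg; rewrite (cut_uv _ Ff) /setU /=; have := uA Ff; tauto.
  - by left; exact: sA.
  - exact: s'A.
  - exact: s'A.
apply: contrapT => nef.
have [] := @linked_uncut (A e `&` A f) _ _ _.
- exact: finite_cutI (finA Fe) (finA Ff).
- move=> g Fg cg; have [/(cutA_eq Fe Fg)|/(cutA_eq Ff Fg)] := cutI cg => gE; subst g.
    by move: cg; rewrite (cut_uv _ Fe) /setI /=; tauto.
  by move: cg; rewrite (cut_uv _ Ff) /setI /=; tauto.
- by split; exact: sA.
- by move/(s'A Fe).
Qed.

(** The order in which the arc from [s] to [s'] runs through the edges. *)
Definition before e f := e <> f /\ ~ A e (u f).

Lemma before_total e f : F e -> F f -> e <> f -> before e f \/ before f e.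
Proof.
move=> Fe Ff ef; have := edge_order Fe Ff ef; rewrite /before.
by have := nesym ef; have := EM (A e (u f)); tauto.
Qed.

(** Otherwise [g] is trapped in [A e] minus [A f], a set whose cut contains no
edge of [F], contrary to [uncut_dichotomy]. *)
Lemma before_trans e f g : F e -> F f -> F g ->
  before e f -> before f g -> before e g.
Proof.
move=> Fe Ff Fg [ef nef] [fg nfg].
have fe : A f (u e) by apply: contrapT => h; apply: nef; apply/(edge_order Fe Ff ef).
have eg : e <> g by move=> E; subst g.
split=> // Aeg.
have fev : A f (v e) by apply/(same_side Ff Fe ef (mem_u Fe) (mem_v Fe)).
have nefv : ~ A e (v f).
  by move=> h; apply: nef; apply/(same_side Fe Ff (nesym ef) (mem_u Ff) (mem_v Ff)).
have [|h|h] := @uncut_dichotomy (A e `\` A f) (finite_cutD (finA Fe) (finA Ff)).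
- move=> h Fh ch; have [/(cutA_eq Fe Fh)|/(cutA_eq Ff Fh)] := cutD ch => hE; subst h.
    by move: ch; rewrite (cut_uv _ Fe) /setD /=; tauto.
  by move: ch; rewrite (cut_uv _ Ff) /setD /=; tauto.
- by apply: (h g (u g) Fg (mem_u Fg)).
- by have [] := h e (u e) Fe (mem_u Fe).
Qed.

(** At each position of the order, as far as finitely many private cuts can see,
at most one piece carries edges of [F]. For if [g] enters the first piece and [h]
leaves the second one, then no edge of [F] leaves the first piece, and adding
this piece to [A g] gives a set without any edge of [F] in its cut. *)
Lemma one_piece P Q : finite_set (cut P) -> finite_set (cut Q) ->
  (forall x, P x -> ~ Q x) ->
  (forall k, F k -> cut P k \/ cut Q k ->
    forall x y, (P `|` Q) x -> (P `|` Q) y -> (A k x <-> A k y)) ->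
  (exists e a, [/\ F e, e a & P a]) -> (exists e a, [/\ F e, e a & Q a]) -> False.
Proof.
wlog : P Q / exists g h, [/\ F g, F h, cut P g /\ cut Q h & before g h].
  move=> wl fP fQ PQ same tP tQ.
  have crossed B C : finite_set (cut B) -> (forall x, B x -> ~ C x) ->
      (exists e a, [/\ F e, e a & B a]) -> (exists e a, [/\ F e, e a & C a]) ->
      exists2 g, F g & cut B g.
    move=> fB BC [e [a [Fe ea Ba]]] [f [b [Ff fb Cb]]].
    apply: contrapT => none; have [|h|h] := uncut_dichotomy fB.
    - by move=> g Fg cg; apply: none; exists g.
    - exact: h ea Ba.
    - exact: BC (h _ _ Ff fb) Cb.
  have QP x : Q x -> ~ P x by move=> Qx /PQ.
  have [g Fg gP] := crossed P Q fP PQ tP tQ.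
  have [h Fh hQ] := crossed Q P fQ QP tQ tP.
  have gh : g <> h.
    move=> E; subst h; have := same g Fg (or_introl gP) (u g) (v g).
    have := PQ (u g); have := PQ (v g); have := uA Fg; have := vA Fg.
    by move: gP hQ; rewrite !cut_uv// /setU /=; tauto.
  have [lt|lt] := before_total Fg Fh gh.
    by apply: (wl P Q) => //; exists g, h.
  apply: (wl Q P) => //; first by exists h, g.
  move=> k Fk ck x y; rewrite setUC; apply: same => //; tauto.
move=> [g [h [Fg Fh [gP hQ] [gh ngh]]]] fP fQ PQ same tP tQ.
have touches k B : F k -> cut B k -> exists2 x, k x & B x.
  move=> Fk; rewrite cut_uv// => cB.
  by have [Bu|Bu] := pselect (B (u k)); [exists (u k)|exists (v k)];
    rewrite //; [exact: mem_u|exact: mem_v|apply: contrapT; tauto].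
have [x gx Px] := touches _ _ Fg gP; have [y hy Qy] := touches _ _ Fh hQ.
have Ahg : A h (u g) by apply: contrapT => n; apply: ngh; apply/(edge_order Fg Fh gh).
(* Both pieces lie between [g] and [h], so [g] can only enter and [h] only leave. *)
have afterg z : (P `|` Q) z -> ~ A g z.
  move=> Dz gz; apply: ngh; apply/(same_side Fg Fh (nesym gh) (mem_u Fh) hy).
  by apply/(same g Fg (or_introl gP) z y) => //; right.
have beforeh z : (P `|` Q) z -> A h z.
  move=> Dz; apply/(same h Fh (or_intror hQ) x z) => //; first by left.
  by apply/(same_side Fh Fg gh gx (mem_u Fg)).
have xv : x = v g.
  case: (mem_end Fg gx) => // xu; case: (afterg x); first by left.
  by rewrite xu; exact: uA.
have [] := @linked_uncut (A g `|` P).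
- exact: finite_cutU (finA Fg) fP.
- move=> k Fk ck.
  have [kg|kg] := pselect (k = g).
    subst k; move: ck; rewrite (cut_uv _ Fg) /setU /=.
    by rewrite xv in Px; have := uA Fg; tauto.
  have kP : cut P k.
    by have [/(cutA_eq Fg Fk)//|] := cutU ck.
  have kh : k <> h.
    move=> E; subst k; have := same h Fh (or_introl kP) (u h) (v h).
    have := PQ (u h); have := PQ (v h); have := uA Fh; have := vA Fh.
    by move: kP hQ; rewrite !cut_uv// /setU /=; tauto.
  have [z kz Pz] := touches _ _ Fk kP.
  have Dz : (P `|` Q) z by left.
  have [Akz|Akz] := pselect (A k z).
    have huk : A h (u k).
      by apply/(same_side Fh Fk kh (mem_u Fk) kz); exact: beforeh.
    have kuh : A k (u h).
      apply/(same_side Fk Fh (nesym kh) (mem_u Fh) hy).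
      by apply/(same k Fk (or_introl kP) z y) => //; right.
    by have := edge_order Fk Fh kh; tauto.
  have gk : ~ A g (u k).
    by move/(same_side Fg Fk kg (mem_u Fk) kz); exact: afterg.
  have kug : ~ A k (u g).
    move/(same_side Fk Fg (nesym kg) (mem_u Fg) gx) => kx; apply: Akz.
    by apply/(same k Fk (or_introl kP) x z) => //; left.
  by have := edge_order Fg Fk (nesym kg); tauto.
- by left; exact: sA.
- exact: s'A.
- by move=> Ps'; apply: (s'A Fh); apply: beforeh; left.
Qed.

Variable R : realType.
Hypotheses (lf : locally_finite G) (conn : connected_graph G).
Hypothesis inf : infinite_set [set: V].
Hypothesis FE : F `<=` @edges G.
Variable phi : set V -> Etop R G -> R.
Hypothesis phiP : forall e, F e -> cut_function (A e) (fun _ _ t => t) (phi e).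
Implicit Types p q : Etop R G.

Definition edge_union : set (Etop R G) :=
  [set p | exists2 e, F e & closed_edge (u e) (v e) p].

Definition arc := closure edge_union.

Lemma compact_arc : compact arc.
Proof.
apply: (@subclosed_compact _ _ setT); [exact: closed_closure|exact: Etop_compact|by []].
Qed.

Lemma arc_edge_point e t : F e -> 0 <= t <= 1 -> exists p,
  arc p /\ phi e p = t.
Proof.
move=> Fe t01.
have cP : (exists a, edge_coord (u e) (v e) t = vertex_coord R a) \/
   (exists a b r, [/\ adj a b, 0 <= r <= 1 & edge_coord (u e) (v e) t = edge_coord a b r]).
  by right; exists (u e), (v e), t; split=> //; exact: uv.
pose x := Point cP; have xE : coord x = edge_coord (u e) (v e) t by [].
have pe : closed_edge (u e) (v e) (OfPoint x) by exists x => //; exists t.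
exists (OfPoint x); split=> //; first by apply: subset_closure; exists e.
rewrite (cutf_edge (phiP Fe) (uv Fe) t01 xE) /cut_value asboolT ?asboolF//.
  exact: vA.
exact: uA.
Qed.

Lemma phi_other e f p : F e -> F f -> e <> f -> closed_edge (u f) (v f) p ->
  phi e p = if `[< A e (u f) >] then 0 else 1.
Proof.
move=> Fe Ff ef [x [t t01 xE] <-].
have same := same_side Fe Ff (nesym ef) (mem_u Ff) (mem_v Ff).
rewrite (cutf_edge (phiP Fe) (uv Ff) t01 xE) /cut_value.
by case: asboolP => Au; case: asboolP => Av //; tauto.
Qed.

(** The condition is closed and holds on each edge of [F] by transitivity of the
order. *)
Lemma arc_before e f p : F e -> F f -> before e f -> arc p ->
  phi f p = 0 \/ phi e p = 1.
Proof.
move=> Fe Ff ef; pose Z := [set p | phi f p = 0] `|` [set p | phi e p = 1].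
have cZ : closed Z.
  have c (h : set V) (y : R) : F h -> closed [set p | phi h p = y].
    move=> Fh; apply: (@preimage_closed _ _ (phi h) [set x | x = y]).
      by move=> q _; exact: cutf_continuous (phiP Fh) q.
    exact: closed_eq.
  by apply: closedU; exact: c.
suff sub : edge_union `<=` Z by move=> /(closureS sub); rewrite -(proj1 (closure_id Z) cZ).
move=> {}p [g Fg pg].
have [ge|ge] := pselect (g = e).
  subst g; left; have [ne _] := ef.
  rewrite /= (phi_other Ff Fe (nesym ne) pg) asboolT//.
  by have := edge_order Fe Ff ne; have [_] := ef; have := EM (A f (u e)); tauto.
have [gf|gf] := pselect (g = f).
  subst g; right; have [ne nA] := ef.
  by rewrite /= (phi_other Fe Ff ne pg) asboolF.
have [fg|fg] := pselect (A f (u g)).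
  by left; rewrite /= (phi_other Ff Fg (nesym gf) pg) asboolT.
right; rewrite /= (phi_other Fe Fg (nesym ge) pg) asboolF//.
by have [] := before_trans Fe Ff Fg ef (conj (nesym gf) fg).
Qed.

(** By [arc_before], a point that is strictly behind another one for some edge is
not ahead of it for a later or an earlier edge. *)
Lemma arc_total p q : arc p -> arc q ->
  (forall e, F e -> phi e p <= phi e q) \/ (forall e, F e -> phi e q <= phi e p).
Proof.
move=> ap aq; apply: contrapT => /not_orP[].
move=> /existsNP[e /not_implyP[Fe /negP]]; rewrite -ltNge => qp.
move=> /existsNP[f /not_implyP[Ff /negP]]; rewrite -ltNge => pq.
have ef : e <> f by move=> E; subst f; move: (lt_trans qp pq); rewrite ltxx.
have /andP[e0 e1] := cutf01 p (phiP Fe); have /andP[f0 f1] := cutf01 q (phiP Ff).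
have /andP[e0' e1'] := cutf01 q (phiP Fe); have /andP[f0' f1'] := cutf01 p (phiP Ff).
have [ltef|ltfe] := before_total Fe Ff ef.
  by have [] := arc_before Fe Ff ltef aq; lra.
by have [] := arc_before Ff Fe ltfe ap; lra.
Qed.

Lemma arc_edge_space p : arc p -> edge_space F p.
Proof.
have sub : edge_union `<=` edge_space F.
  move=> {}p [e Fe [x [t t01 xE] <-]] y a b r ab r01 [<-] yE.
  have [] := edge_coord_inj ab (uv Fe) r01 t01 (etrans (esym yE) xE).
    by move=> [-> -> _]; rewrite -uvE.
  by move=> [-> -> _]; rewrite edgeC -uvE.
by move=> /(closureS sub); rewrite -(proj1 (closure_id _) (@closed_edge_space R G F)).
Qed.

Lemma arc_touch p P : finite_set (cut P) -> arc p -> side P p ->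
  exists e a, [/\ F e, e a & P a].
Proof.
move=> fP ap Pp; have [psi psiP] := cut_function_id R lf fP.
have psic := cutf_continuous psiP.
have : nbhs p (psi @^-1` [set y | y < 1]).
  apply: (psic p); rewrite /= (cutf_side_in psiP Pp).
  exact: lt_nbhsl.
move=> /ap[q [[e Fe [x [t t01 xE] <-]] /= q1]].
apply: contrapT => none; move: q1.
rewrite (cutf_edge psiP (uv Fe) t01 xE) /cut_value.
have nu : ~ P (u e) by move=> h; apply: none; exists e, (u e); split=> //; exact: mem_u.
have nv : ~ P (v e) by move=> h; apply: none; exists e, (v e); split=> //; exact: mem_v.
by rewrite !asboolF// ltxx.
Qed.

(** Inner points of edges are determined by the value of one cut function. Two
other points in the same position are separated by a finite cut with side [B],
and the parts of that position inside and outside [B] both carry edges of [F], as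
the points are limits of edges. This contradicts [one_piece]. *)
Lemma arc_inj p q : arc p -> arc q -> (forall e, F e -> phi e p = phi e q) -> p = q.
Proof.
move=> ap aq pq; have pF := arc_edge_space ap; have qF := arc_edge_space aq.
have inner (r r' : Etop R G) : edge_space F r -> edge_space F r' ->
    (forall e, F e -> phi e r = phi e r') ->
    (exists x a b t, [/\ adj a b, 0 < t < 1, r = OfPoint x, coord x = edge_coord a b t
      & F (edge a b)]) -> r = r'.
  move=> rF r'F rr' [x [a [b [t [ab t01 rx xE Fab]]]]].
  apply: (cutf_edge_inj (cutA Fab) (phiP Fab)) => //; last exact: rr'.
  have t01' : 0 <= t <= 1 by case/andP: t01 => ? ?; rewrite !ltW.
  have cab : cut (A (edge a b)) (edge a b).
    by have : [set edge a b] (edge a b) by []; rewrite -(cutA Fab) => -[].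
  rewrite rx (cutf_edge (phiP Fab) ab t01' xE) /cut_value.
  move: cab; rewrite mem_cut//; case/andP: t01 => t0 t1.
  by case: asboolP => Aa; case: asboolP => Ab //= h; try tauto; apply/andP; split; lra.
have [bp|h] := edge_space_case pF; last exact: inner pF qF pq h.
have [bq|h] := edge_space_case qF; last first.
  by apply/esym; apply: inner qF pF _ h => e Fe; rewrite pq.
apply: contrapT => neq.
have [B [fB pB qB]] := separate_sides lf bp bq neq.
(* [D] is the position of [p] and [q] with respect to the edges of [F] that cross
   the cut of [B]. *)
pose L := cut B `&` F.
pose D := [set x | forall k, L k -> (A k x <-> phi k p = 0)].
pose X := cut B `|` \bigcup_(k in L) cut (A k).
have fX : finite_set X.
  rewrite finite_setU; split=> //; apply: bigcup_finite; first exact: finite_setIl.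
  by move=> k [_ Fk]; exact: finA.
have XE : X `<=` @edges G by move=> e [|[k _]]; exact: cut_sub_edges.
have DX : cut D `<=` \bigcup_(k in L) cut (A k).
  move=> _ [x [y [Dx Dy xy ->]]]; apply: contrapT => none; apply: Dy => k Lk.
  have -> : A k y <-> A k x.
    apply: iff_sym; apply: notin_cut => // c; apply: none; exists k => //.
  exact: Dx.
have PX : cut (D `&` B) `<=` X.
  by move=> e /cutI[/DX|]; [right|left].
have QX : cut (D `\` B) `<=` X.
  by move=> e /cutD[/DX|]; [right|left].
have AX k : L k -> cut (A k) `<=` X by move=> Lk e ke; right; exists k.
have BX : cut B `<=` X by move=> e; left.
have phi_side k r : F k -> sided r ->
    (side (A k) r <-> phi k r = 0).
  move=> Fk br; split; first exact: cutf_side_in (phiP Fk).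
  case: (br (A k)) => // /(cutf_side_out (phiP Fk)) ->.
  by move/eqP; rewrite oner_eq0.
have inD r z : sided r -> (forall e, F e -> phi e r = phi e p) ->
    (forall C, cut C `<=` X -> (C z <-> side C r)) -> D z.
  move=> br rp zr k Lk; have Fk := Lk.2.
  by rewrite (zr _ (AX k Lk)) phi_side// rp.
(* The vertices [a] and [b] stand for [p] and [q] as far as [B] and the private
   cuts of the edges in [L] are concerned. *)
have [a aP] := side_vertex fX XE bp; have [b bP] := side_vertex fX XE bq.
have Da : D a by exact: (inD p).
have Db : D b by apply: (inD q) => // e Fe; rewrite pq.
have Ba : B a by apply/(aP _ BX).
have nBb : ~ B b.
  by have BCX : cut (~` B) `<=` X; [rewrite cutC|apply/(bP _ BCX)].
have fP : finite_set (cut (D `&` B)) := sub_finite_set PX fX.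
have fQ : finite_set (cut (D `\` B)) := sub_finite_set QX fX.
apply: (@one_piece (D `&` B) (D `\` B)) => //.
- by move=> x [_ Bx] [_].
- move=> k Fk ck x y Dx Dy.
  have inDD z : (D `&` B `|` D `\` B) z -> D z by case=> -[].
  suff Lk : L k by rewrite (inDD _ Dx k Lk) (inDD _ Dy k Lk).
  split=> //; apply: contrapT => nBk.
  have Dk : cut D k by case: ck => [/cutI[]|/cutD[]].
  by have [k' [Bk' Fk'] /(cutA_eq Fk' Fk) E] := DX _ Dk; apply: nBk; rewrite E.
- by apply: arc_touch ap _ => //; apply/(aP _ PX).
- by apply: arc_touch aq _ => //; apply/(bP _ QX).
Qed.

Lemma arc_vertex z : (exists2 e, F e & e z) -> arc (OfPoint (vertex_point R z)).
Proof.
move=> [e Fe ez]; apply: subset_closure; exists e => //; exists (vertex_point R z) => //.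
case: (mem_end Fe ez) => ->.
  by exists 0; rewrite ?edge_coord0// lexx ler01.
by exists 1; rewrite ?edge_coord1// lexx ler01.
Qed.

Lemma arc_path : s <> s' -> exists f : R -> Etop R G,
  [/\ continuous f, f 0 = OfPoint (vertex_point R s),
      f 1 = OfPoint (vertex_point R s') & forall t, arc (f t)].
Proof.
move=> ss'.
have [code codeI] : exists c : set V -> nat, {in F &, injective c}.
  by apply/countable_injP; apply: sub_countable (countable_edges lf conn); exact: subset_card_le.
have /choice[psi psiP] n : exists g : Etop R G -> R,
    (exists e, [/\ F e, code e = n & g = phi e]) \/
    g = cst 0 /\ forall e, F e -> code e <> n.
  have [[e [Fe en]]|none] := pselect (exists e, F e /\ code e = n).
    by exists (phi e); left; exists e.
  by exists (cst 0); right; split=> // e Fe en; apply: none; exists e.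
have psi_code e : F e -> psi (code e) = phi e.
  move=> Fe; case: (psiP (code e)) => [[f [Ff fe ->]]|[_ /(_ e Fe)//]].
  by congr phi; apply: codeI => //; exact: mem_set.
have incident_edge z C : finite_set (cut [set z]) -> [set s; s'] z -> [set s; s'] C -> z <> C ->
    exists2 e, F e & e z.
  move=> fz Sz SC zC.
  have [||e [[a [b [-> _ _ ->]]] Fe]] := linkF fz; first by exists z.
    by exists C => // E; exact: zC.
  by exists (edge z b) => //; left.
have as_ : arc (OfPoint (vertex_point R s)).
  by apply/arc_vertex/(incident_edge _ s'); [exact: finite_cut1|left|right|].
have as' : arc (OfPoint (vertex_point R s')).
  by apply/arc_vertex/(incident_edge _ s); [exact: finite_cut1|right|left|exact: nesym].
apply: (@ordered_compact_path R _ arc psi) => //.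
- move=> n; case: (psiP n) => [[e [Fe _ ->]]|[-> _]].
    exact: cutf_continuous (phiP Fe).
  exact: cst_continuous.
- move=> n p; case: (psiP n) => [[e [Fe _ ->]]|[-> _]].
    exact: cutf01 (phiP Fe).
  by rewrite lexx ler01.
- exact: compact_arc.
- move=> p q ap aq; case: (arc_total ap aq) => h; [left|right] => n;
    by case: (psiP n) => [[e [Fe _ ->]]|[-> _]]; [exact: h|exact: lexx].
- by move=> p q ap aq h; apply: arc_inj => // e Fe; rewrite -psi_code.
- move=> n p q ap aq; case: (psiP n) => [[e [Fe _ ->]]|[-> _]]; last by rewrite ltxx.
  move=> pq; have /andP[p0 _] := cutf01 p (phiP Fe); have /andP[_ q1] := cutf01 q (phiP Fe).
  have [|x [ax xE]] := @arc_edge_point e ((phi e p + phi e q) / 2) Fe.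
    by apply/andP; split; lra.
  by exists x => //; rewrite xE; apply/andP; split; lra.
- move=> n; case: (psiP n) => [[e [Fe _ ->]]|[-> _]]; last exact: lexx.
  rewrite (cutf_in (phiP Fe) (sA Fe)).
  by case/andP: (cutf01 (OfPoint (vertex_point R s')) (phiP Fe)).
Qed.

End ArcOrder.

Section LinkedPath.
Local Open Scope ring_scope.
Variables (R : realType) (G : graph).
Local Notation V := (vertex G).
Hypotheses (lf : locally_finite G) (conn : connected_graph G).
Hypothesis inf : infinite_set [set: V].

Lemma minimal_linked_path F (s s' : V) : minimal_linked [set s; s'] F -> s <> s' ->
  exists f : R -> Etop R G, [/\ continuous f, f 0 = OfPoint (vertex_point R s),
    f 1 = OfPoint (vertex_point R s') & forall t, edge_space F (f t)].
Proof.
move=> [FE linkF minF] ss'.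
have /choice[A AP] (e : set V) : exists A : set V, F e ->
    [/\ finite_set (cut A), A s, ~ A s' & cut A `&` F = [set e]].
  have [Fe|nF] := pselect (F e); last by exists set0.
  have [A [fA [a Sa Aa] [b Sb Ab] AF]] := minF e Fe.
  have ab : a <> b by move=> E; rewrite E in Aa.
  have [As|As] := pselect (A s).
    exists A => _; split=> //; case: Sb => /= bE; rewrite bE // in Ab.
  exists (~` A) => _; rewrite cutC; split=> //.
  case: Sa => /= aE; rewrite aE // in Aa; by move=> nA; apply: nA.
have /choice[u /choice[v uvP]] (e : set V) : exists u v : V, F e ->
    [/\ A e u, ~ A e v, adj u v & e = edge u v].
  have [Fe|nF] := pselect (F e); last by exists s, s.
  have [_ _ _ AF] := AP e Fe.
  have : [set e] e by []; rewrite -AF => -[[u [v [Au Av uv eE]]] _].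
  by exists u, v.
have /choice[phi phiP] (e : set V) : exists phi : Etop R G -> R,
    F e -> cut_function (A e) (fun _ _ t => t) phi.
  have [Fe|nF] := pselect (F e); last by exists (cst 0).
  have [fA _ _ _] := AP e Fe; have [phi h] := cut_function_id R lf fA; by exists phi.
have finA e : F e -> finite_set (cut (A e)) by move=> /AP[].
have sA e : F e -> A e s by move=> /AP[].
have s'A e : F e -> ~ A e s' by move=> /AP[].
have cutA e : F e -> cut (A e) `&` F = [set e] by move=> /AP[].
have uA e : F e -> A e (u e) by move=> /uvP[].
have vA e : F e -> ~ A e (v e) by move=> /uvP[].
have uv e : F e -> adj (u e) (v e) by move=> /uvP[].
have uvE e : F e -> e = edge (u e) (v e) by move=> /uvP[].
have [f [fc f0 f1 farc]] :=
  arc_path linkF finA sA s'A cutA uA vA uv uvE lf conn inf FE phiP ss'.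
by exists f; split=> // t; exact: (arc_edge_space uv uvE (farc t)).
Qed.

Lemma linked_path F (s s' : V) : F `<=` @edges G -> linked [set s; s'] F ->
  exists f : R -> Etop R G, [/\ continuous f, f 0 = OfPoint (vertex_point R s),
    f 1 = OfPoint (vertex_point R s') & forall t, edge_space F (f t)].
Proof.
move=> FE linkF; have [<-|ss'] := pselect (s = s').
  exists (cst (OfPoint (vertex_point R s))); split=> //; first exact: cst_continuous.
  by move=> t; exact: edge_space_vertex.
have [F' F'F minF'] := linked_minimal FE linkF.
have [f [fc f0 f1 fF]] := minimal_linked_path minF' ss'.
by exists f; split=> // t; exact: edge_space_sub F'F _ (fF t).
Qed.

End LinkedPath.

(** * Topological trees from linked sets *)

Section Pasting.
Local Open Scope ring_scope.
Variable R : realType.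

Lemma continuous_paste (T : topologicalType) (a b : R -> T) (c : R) :
  continuous a -> continuous b -> a c = b c ->
  continuous (fun t => if t <= c then a t else b t).
Proof.
move=> ac bc abc t N /= gN.
suff [M tM MN] : exists2 M, nbhs t M &
    forall x, M x -> N (if x <= c then a x else b x) by exact: filterS MN tM.
case: (ltgtP t c) gN => [tc|ct|->] gN.
- exists (a @^-1` N `&` [set x | x < c]).
    by apply: filterI; [exact: ac t N gN|exact: lt_nbhsl].
  by move=> x [/= ax xc]; rewrite (ltW xc).
- exists (b @^-1` N `&` [set x | c < x]).
    by apply: filterI; [exact: bc t N gN|exact: lt_nbhsr].
  by move=> x [/= bx cx]; rewrite leNgt cx.
- exists (a @^-1` N `&` b @^-1` N); last by move=> x [/= ax bx]; case: ifP.
  by apply: filterI; [exact: ac c N gN|apply: (bc c N); rewrite -abc].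
Qed.

End Pasting.

Section LinkedTree.
Local Open Scope ring_scope.
Variables (R : realType) (G : graph).
Local Notation V := (vertex G).
Hypotheses (lf : locally_finite G) (conn : connected_graph G).
Hypothesis inf : infinite_set [set: V].

Definition path_component_in (Z : set (Etop R G)) (p0 : Etop R G) : set (Etop R G) :=
  [set p | exists f : R -> Etop R G,
    [/\ continuous f, f 0 = p0, f 1 = p & forall t, Z (f t)]].

Lemma path_component_in_sub Z p0 : path_component_in Z p0 `<=` Z.
Proof. by move=> _ [f [_ _ <- fZ]]. Qed.

Lemma continuous_scale (r : R) : continuous (fun t : R => r * t).
Proof. by move=> t; apply: cvgM; [exact: cvg_cst|exact: cvg_id]. Qed.

(** A point on a curve that starts at [p0] is itself reached by a shorter such
curve, so two curves from [p0] can be joined at [p0]. *)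
Lemma path_component_in_connected Z p0 : Z p0 -> path_connected R (path_component_in Z p0).
Proof.
move=> Zp0.
have trace (f : R -> Etop R G) r : continuous f -> f 0 = p0 -> (forall t, Z (f t)) ->
    path_component_in Z p0 (f r).
  move=> fc f0 fZ; exists (fun t => f (r * t)); split=> //; rewrite ?mulr0 ?mulr1//.
  move=> t; apply: (@continuous_comp R R _ (fun t => r * t) f t); last exact: fc.
  exact: continuous_scale.
split.
  by exists p0, (cst p0); split=> //; exact: cst_continuous.
move=> _ _ [f [fc f0 <- fZ]] [g [gc g0 <- gZ]].
exists (fun t => if t <= 2^-1 then f (1 - 2 * t) else g (2 * t - 1)).
have lin (a b : R) : continuous (fun t : R => a * t + b).
  by move=> t; apply: cvgD; [exact: continuous_scale|exact: cvg_cst].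
split.
- apply: continuous_subspaceT; apply: continuous_paste.
  + move=> t; apply: (@continuous_comp R R _ (fun t => 1 - 2 * t) f t); last exact: fc.
    rewrite (_ : (fun _ => _) = fun t : R => (- 2) * t + 1); first exact: lin.
    by apply/funext => x; ring.
  + move=> t; apply: (@continuous_comp R R _ (fun t => 2 * t - 1) g t); last exact: gc.
    exact: lin.
  + by rewrite mulfV ?pnatr_eq0// subrr f0 g0.
- by rewrite invr_ge0 ler0n mulr0 subr0.
- by rewrite leNgt invf_lt1 ?ltr1n// mulr1 (_ : 2 - 1 = 1 :> R)//; ring.
- by move=> t _; case: ifP => _; exact: trace.
Qed.

(** The minimal linked subset excludes circles, and passing to one path component
of its space makes the tree path-connected without losing a vertex of [S]. *)
Lemma linked_topological_tree S F : F `<=` @edges G -> linked S F ->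
  exists2 T : set (Etop R G), topological_steiner_tree S T & top_edges T `<=` F.
Proof.
move=> FE linkF; have [F' F'F minF'] := linked_minimal FE linkF.
have [F'E linkF' _] := minF'.
have [s0 s0S] : exists s0, forall s, S s -> S s0.
  have [[s Ss]|S0] := pselect (S !=set0); first by exists s.
  have [v _] := conn.1; exists v => s Ss; by case: S0; exists s.
pose T := path_component_in (edge_space F') (OfPoint (vertex_point R s0)).
have TF' : T `<=` edge_space F' by exact: path_component_in_sub.
exists T; first split.
- split; first by apply: path_component_in_connected; exact: edge_space_vertex.
  move=> [C CT [f [g [fc _ fC _]]]]; apply: (no_circle lf minF' fc).
    move=> x y; rewrite !inE => Cx Cy E.
    by rewrite -(fC x Cx).2 -(fC y Cy).2 E.
  by move=> z Cz; apply/TF'/CT; exact: (fC z Cz).1.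
- move=> s Ss.
  have [|f [fc f0 f1 fF]] := linked_path R lf conn inf (s := s0) (s' := s) F'E.
    apply: linked_sub linkF' => x [] /= ->; [exact: s0S Ss|exact: Ss].
  by exists f.
- move=> _ [u [v [uv -> uvT]]]; apply: F'F.
  have cP : (exists a, edge_coord u v (2^-1) = vertex_coord R a) \/
     (exists a b r, [/\ adj a b, 0 <= r <= 1 & edge_coord u v (2^-1 : R) = edge_coord a b r]).
    right; exists u, v, 2^-1; split=> //.
    by rewrite invr_ge0 ler0n invf_le1 ?ler1n.
  pose x := Point cP; have xE : coord x = edge_coord u v 2^-1 by [].
  have h01 : 0 < (2^-1 : R) < 1 by rewrite invr_gt0 ltr0n invf_lt1 ?ltr1n.
  apply: (TF' (OfPoint x) _ x u v 2^-1) => //; apply: uvT.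
  by exists 2^-1 => //; case/andP: h01 => ? ?; rewrite !ltW.
Qed.

End LinkedTree.

(** * Contraction to a finite graph *)

Lemma path_crosses (T : Type) (r : rel T) (B : set T) x p :
  path r x p -> B x -> ~ B (last x p) -> exists y z, [/\ r y z, B y & ~ B z].
Proof.
elim: p x => [|y p IH] x //= /andP[xy pp] Bx nB.
have [By|By] := pselect (B y); first exact: IH pp By nB.
by exists x, y.
Qed.

Section Walks.
Variable G : graph.
Local Notation V := (vertex G).
Implicit Types (X Y : set (set V)).

Lemma path_edges_cons (u w : V) p :
  path_edges u (w :: p) = edge u w |` path_edges w p.
Proof.
apply/seteqP; split=> [e [x /=]|e].
  by rewrite in_cons => /orP[/eqP -> ->|xp ->]; [left|right; exists x].
case=> [->|[x xp ->]]; first by exists (u, w) => //=; rewrite in_cons eqxx.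
by exists x => //=; rewrite in_cons xp orbT.
Qed.

(** Walks in a set of edges are handled as components of the graph without the
complementary edges; shortening gives the repetition-free paths of the
definition of edge-connectivity. *)
Lemma component_path X u v : component X u v ->
  exists2 p, is_path u v p & path_edges u p `<=` ~` X.
Proof.
move=> [p pp pv]; case/shortenP: pp pv => {p} p pp up _ pv.
exists p; first split=> //.
  by apply: sub_path pp => a b /andP[].
elim: p u pp {up pv} => [|w p IH] u /=; first by move=> _ e [].
rewrite path_edges_cons => /andP[/andP[uw /negP nX] pp] e [->|].
  by move=> Xe; apply: nX; exact/mem_set.
exact: IH.
Qed.

Lemma path_component Y u v p : is_path u v p -> path_edges u p `<=` Y ->
  component (~` Y) u v.
Proof.
move=> [pp pv _] pY; exists p => //.
elim: p u pp pY {pv} => [//|w p IH] u /= /andP[uw pp].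
rewrite path_edges_cons subUset => -[uwY pY]; rewrite IH// andbT.
rewrite /adj_minus uw; apply/negP => /set_mem; apply; exact: uwY.
Qed.

Lemma component0 (u v : V) : connected_graph G -> component set0 u v.
Proof.
move=> [_ /(_ u v)[p pP]]; rewrite -setCT; exact: path_component pP _.
Qed.

End Walks.

(** The fibres of [q] are contracted. The edges in [X], which include all edges
between distinct fibres, may become parallel, so each of them is subdivided by a
new vertex to keep the graph simple. *)
Section Contraction.
Variables (G : graph) (W : finType) (q : vertex G -> W) (X : set (set (vertex G))).
Local Notation V := (vertex G).
Hypothesis conn : connected_graph G.
Hypotheses (finX : finite_set X) (XE : X `<=` @edges G).
Hypothesis qX : forall a b, adj a b -> q a <> q b -> X (edge a b).

Definition cvertex : choiceType := (set_type (range q) + set_type X)%type.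

Definition class a : cvertex := inl (SigSub (mem_set (imageT q a))).

Definition incident (w : set_type (range q)) (e : set_type X) : bool :=
  `[< exists2 a, val e a & q a = val w >].

Definition cadj : rel cvertex := fun x y =>
  match x, y with
  | inl w, inr e => incident w e
  | inr e, inl w => incident w e
  | _, _ => false
  end.

Lemma cadj_sym : symmetric cadj. Proof. by case=> x [y|y]. Qed.
Lemma cadj_irr : irreflexive cadj. Proof. by case. Qed.

Definition contraction := Graph cadj_sym cadj_irr.

Lemma finite_contraction : finite_set [set: vertex contraction].
Proof.
have fin (T : choiceType) (A : set T) : finite_set A -> finite_set [set: set_type A].
  move=> fA; rewrite (_ : [set: _] = val @^-1` A); last first.
    by apply/seteqP; split=> // x _; exact: set_mem (valP x).
  by apply: finite_preimage fA => x y _ _; exact: val_inj.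
rewrite (_ : [set: _] = inl @` [set: set_type (range q)] `|` inr @` [set: set_type X]).
  rewrite finite_setU; split; apply: finite_image; apply: fin => //.
  exact: finite_finset.
by apply/seteqP; split=> // -[w|e] _; [left; exists w|right; exists e].
Qed.

Lemma class_surj (w : set_type (range q)) : exists a, class a = inl w.
Proof.
case: w => w wq; have [a _ aw] := set_mem wq; exists a.
by congr inl; apply: val_inj.
Qed.

Lemma incident_class a (e : set_type X) : val e a -> cadj (class a) (inr e).
Proof. by move=> ea; apply/asboolP; exists a. Qed.

(** What the edges in [Y] become under subdivision. *)
Definition halves (Y : set (set V)) : set (set (vertex contraction)) :=
  [set h | exists w e, [/\ incident w e, Y (val e) & h = @edge contraction (inl w) (inr e)]].

Lemma halves_disjoint (Y Y' : set (set V)) : Y `&` Y' = set0 -> halves Y `&` halves Y' = set0.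
Proof.
move=> YY'; rewrite -subset0 => h [[w [e [_ Ye ->]]] [w' [e' [_ Ye']]]].
case/edge_inj => -[//] _ [ee]; have : (Y `&` Y') (val e) by split=> //; rewrite ee.
by rewrite YY'.
Qed.

Lemma class_component Y a b : component (~` Y) a b ->
  component (~` halves Y) (class a : vertex contraction) (class b).
Proof.
move=> [p pp <-] {b}; elim: p a pp => [|b p IH] a /=; first by move=> _; exact: component_refl.
move=> /andP[/andP[ab /negP nY] /IH]; apply: component_trans.
have Yab : Y (edge a b) by apply: contrapT => h; apply: nY; exact/mem_set.
have [qab|qab] := pselect (q a = q b).
  suff -> : class a = class b by exact: component_refl.
  by congr inl; apply: val_inj.
pose e : set_type X := SigSub (mem_set (qX ab qab)).
have half c : edge a b c -> component (~` halves Y) (class c : vertex contraction) (inr e).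
  move=> ec; apply: component_adj (component_refl _ _) _; apply/andP; split.
    exact: incident_class.
  apply/negP => /set_mem; apply.
  by exists (SigSub (mem_set (imageT q c))), e; split=> //; exact: incident_class.
apply: component_trans (half a _) _; first by left.
by apply/component_sym/half; right.
Qed.

Lemma connected_contraction : connected_graph contraction.
Proof.
split; first by have [v _] := conn.1; exists (class v).
pose Z := ~` halves setT.
suff key (x y : vertex contraction) : component Z x y.
  by move=> x y; have [p pP _] := component_path (key x y); exists p.
suff base (z : vertex contraction) : exists a, component Z (class a) z.
  have [[a ax] [b bY]] := (base x, base y).
  apply: component_trans (component_sym ax) _; apply: component_trans bY.
  by apply: class_component; rewrite setCT; exact: component0.
case: z => [w|e]; first by have [a <-] := class_surj w; exists a; exact: component_refl.
have [a [b [ab eE]]] := XE (set_mem (valP e)).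
have ea : val e a by rewrite eE; left.
exists a; apply: component_adj (component_refl _ _) _; apply/andP; split.
  exact: incident_class.
apply/negP => /set_mem; apply.
by exists (SigSub (mem_set (imageT q a))), e; split=> //; exact: incident_class.
Qed.

Lemma edge_connected_contraction m S : edge_connected_in m S ->
  @edge_connected_in contraction m (class @` S).
Proof.
move=> h _ _ [a Sa <-] [b Sb <-]; have [P [pP dP]] := h a b Sa Sb.
have /choice[P' P'P] i : exists p, @is_path contraction (class a) (class b) p /\
    path_edges (class a : vertex contraction) p `<=` halves (path_edges a (P i)).
  have [p pp pe] := component_path (class_component (path_component (pP i) (@subset_refl _ _))).
  by exists p; split=> // e /pe; rewrite setCK.
exists P'; split=> [i|i j ij]; first exact: (P'P i).1.
apply: subsetI_eq0 (halves_disjoint (dP i j ij)); first exact: (P'P i).2.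
exact: (P'P j).2.
Qed.

(** Follow a path of the tree from one side to the other. Count the subdivision
vertex of an edge among the vertices in [B] when the tree joins it to one of
them; the step that leaves this set then completes an edge whose two halves are
both in the tree. *)
Lemma tree_crosses (T : subgraph contraction) (B : set W) a b : sub_connected T ->
  sub_vertices T (class a) -> sub_vertices T (class b) -> B (q a) -> ~ B (q b) ->
  exists e : set_type X, (exists x y, [/\ adj x y, B (q x), ~ B (q y) & val e = edge x y]) /\
    forall w, incident w e -> sub_edges T (@edge contraction (inl w) (inr e)).
Proof.
move=> [_ Tconn] Ta Tb Ba Bb; have [p pp pl] := Tconn _ _ Ta Tb.
pose side (x : vertex contraction) := match x with
  | inl w => B (val w)
  | inr e => exists w, B (val w) /\ sub_edges T (@edge contraction (inl w) (inr e))
  end.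
have [||x [y [/set_mem xy sx sy]]] := path_crosses (B := side) pp; rewrite ?pl//.
have inc w e : sub_edges T (@edge contraction (inl w) (inr e)) -> incident w e.
  move=> /(@sub_edgesP _ T) [x' [y' [xy' E]]].
  by case: (edge_inj E) xy' => -[<- <-].
case: x y xy sx sy => [w|e] [w'|e'] /= xy sx sy.
- have /(@sub_edgesP _ T) [x' [y' [xy' E]]] := xy.
  by case: (edge_inj E) xy' => -[<- <-].
- by case: sy; exists w.
- have [w [Bw we]] := sx; rewrite edgeC in xy.
  have /asboolP[x ex qx] := inc _ _ we; have /asboolP[y ey qy] := inc _ _ xy.
  have [u [v [uv eE]]] := XE (set_mem (valP e)).
  have xyE : adj x y /\ val e = edge x y.
    have nxy : x <> y by move=> E; apply: sy; rewrite -qy -E qx.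
    rewrite eE in ex ey *; case: ex ey => /= xE [] /= yE; subst x y => //.
    by rewrite adj_sym edgeC.
  exists e; split; first by exists x, y; rewrite qx qy; case: xyE.
  move=> w1 /asboolP[z]; rewrite xyE.2 => -[] /= -> zw.
    by have -> : w1 = w; [apply: val_inj; rewrite /= -zw qx|].
  by have -> : w1 = w'; [apply: val_inj; rewrite /= -zw qy|rewrite edgeC in xy *].
- have /(@sub_edgesP _ T) [x' [y' [xy' E]]] := xy.
  by case: (edge_inj E) xy' => -[<- <-].
Qed.

End Contraction.

(** * Disjoint linked sets by compactness *)

Definition finite_packing k : Prop := forall (G : graph) (S : set (vertex G)),
  finite_set [set: vertex G] -> connected_graph G -> edge_connected_in (2 * k) S ->
  exists T : 'I_k -> subgraph G,
    (forall i, steiner_tree S (T i)) /\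
    (forall i j, i != j -> edge_disjoint_subgraphs (T i) (T j)).

Section Colouring.
Variables (k : nat) (G : graph) (S : set (vertex G)).
Local Notation V := (vertex G).
Hypotheses (k_gt0 : 0 < k) (pack : finite_packing k).
Hypotheses (conn : connected_graph G) (SC : edge_connected_in (2 * k) S).
Implicit Types (A : set V) (c : set V -> 'I_k).

Definition separating A : Prop :=
  [/\ finite_set (cut A), exists2 u, S u & A u & exists2 v, S v & ~ A v].

Definition rainbow c A : Prop := forall i, exists2 e, cut A e & c e = i.

(** Two vertices have the same image under [q] when no set in [As] distinguishes
them; an edge gets the colour of the tree that contains both of its halves. *)
Lemma finite_rainbow (As : seq (set V)) : (forall A, A \in As -> separating A) ->
  exists c, forall A, A \in As -> rainbow c A.
Proof.
move=> sepAs; pose n := size As; pose q (a : V) := [ffun j : 'I_n => `[< nth set0 As j a >]].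
pose X := \bigcup_(A in [set` As]) cut A.
have fX : finite_set X by apply: bigcup_finite => // A /sepAs[].
have XE : X `<=` @edges G by move=> e [A _]; exact: cut_sub_edges.
have qX a b : adj a b -> q a <> q b -> X (edge a b).
  move=> ab qab; apply: contrapT => nX; apply: qab; apply/ffunP => j; rewrite !ffunE.
  have Aj : nth set0 As j \in As by exact: mem_nth.
  apply: asbool_equiv_eq; apply: notin_cut => // c; apply: nX.
  by exists (nth set0 As j).
have [T [TS TD]] := pack (finite_contraction q fX) (connected_contraction conn XE qX)
  (edge_connected_contraction qX SC).
pose full (i : 'I_k) (e : set V) := exists e' : set_type X, val e' = e /\
  forall w : set_type (range q), incident w e' -> sub_edges (T i) (@edge (contraction q X) (inl w) (inr e')).
have full_inj i j e : full i e -> full j e -> i = j.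
  move=> [f [fe fi]] [g [ge gj]]; have gf : g = f by apply: val_inj; rewrite ge fe.
  subst g; apply/eqP; apply: contraT => /TD TT.
  have [u [v [uv fE]]] := XE _ (set_mem (valP f)).
  pose w : set_type (range q) := SigSub (mem_set (imageT q u)).
  have inc : incident w f by apply/asboolP; exists u => //; rewrite fE; left.
  have : (sub_edges (T i) `&` sub_edges (T j)) (@edge (contraction q X) (inl w) (inr f)).
    by split; [exact: fi|exact: gj].
  by rewrite TT.
have /choice[c cP] (e : set V) : exists i, forall j, full j e -> i = j.
  have [[i fi]|none] := pselect (exists i, full i e).
    by exists i => j; exact: full_inj.
  by exists (Ordinal k_gt0) => j fj; case: none; exists j.
exists c => A AAs i; have [fA [u Su Au] [v Sv Av]] := sepAs A AAs.
have An : index A As < n by rewrite index_mem.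
pose j := Ordinal An.
have nthj : nth set0 As j = A by rewrite nth_index.
have [[Tconn _] TiS] := TS i.
have [|||||e [[x [y [xy Bx By eE]]] fe]] := @tree_crosses _ _ q X XE (T i) [set w : {ffun 'I_n -> bool} | w j] u v.
- exact: Tconn.
- by apply: TiS; exists u.
- by apply: TiS; exists v.
- by rewrite /= ffunE nthj; apply/asboolP.
- by rewrite /= ffunE nthj => /asboolP.
move: Bx By; rewrite /= !ffunE nthj => /asboolP Ax nAy.
have Ay : ~ A y by move=> h; apply: nAy; apply/asboolP.
exists (val e); first by exists x, y.
by apply: cP; exists e.
Qed.

(** Take an ultrafilter on finite lists of cuts that contains, for each list, the
set of all lists that include it, and give each edge the colour that it has for
almost all lists. Each cut is finite, so some list that contains it colours all
its edges in this way. *)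
Lemma exists_rainbow : exists c, forall A, separating A -> rainbow c A.
Proof.
have /choice[col colP] (As : seq (set V)) : exists c, forall A, A \in As -> separating A ->
    rainbow c A.
  have [|c cP] := @finite_rainbow [seq A <- As | `[< separating A >]].
    by move=> A; rewrite mem_filter => /andP[/asboolP].
  by exists c => A AAs sA; apply: cP; rewrite mem_filter AAs andbT; apply/asboolP.
pose Fi : set_system (seq (set V)) :=
  [set Q : set (seq (set V)) | exists As : seq (set V), forall Bs : seq (set V),
     {subset As <= Bs} -> Q Bs].
have FiP : ProperFilter Fi.
  split; first by move=> [As /(_ As)]; exact.
  split.
  - by exists [::].
  - move=> P Q [As hP] [Bs hQ]; exists (As ++ Bs) => Cs sub; split.
      by apply: hP => A AAs; apply: sub; rewrite mem_cat AAs.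
    by apply: hQ => A ABs; apply: sub; rewrite mem_cat ABs orbT.
  - by move=> P Q PQ [As hP]; exists As => Bs /hP /PQ.
have [U [UU FiU]] := ultraFilterLemma FiP.
have /choice[c cP] (e : set V) : exists i, U [set As | col As e = i].
  have Ucov : U (\bigcup_(i in [set: 'I_k]) [set As | col As e = i]).
    rewrite (_ : \bigcup_(_ in _) _ = setT); first exact: filterT.
    by apply/seteqP; split=> // As _; exists (col As e).
  by have [i _ Ui] := ultra_bigcup UU finite_finset Ucov; exists i.
exists c => A sA i; have [fA _ _] := sA.
pose bad := \bigcup_(e in cut A) [set As | col As e <> c e].
have UA : U [set As : seq (set V) | A \in As].
  by apply: FiU; exists [:: A] => Bs; apply; exact: mem_head.
have [Ub|Ug] := in_ultra_setVsetC bad UU.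
  have [e Ae Ue] := ultra_bigcup UU fA Ub.
  by have [As [h nh]] := filter_ex (filterI (cP e) Ue); case: nh.
have [As [AAs good]] := filter_ex (filterI UA Ug).
have [e Ae ei] := colP As A AAs sA i; exists e => //.
by rewrite -ei; apply: contrapT => ne; apply: good; exists e => // E; apply: ne.
Qed.

Lemma exists_disjoint_linked : exists F : 'I_k -> set (set V),
  [/\ forall i, F i `<=` @edges G, forall i, linked S (F i) &
      forall i j, i != j -> F i `&` F j = set0].
Proof.
have [c cP] := exists_rainbow.
exists (fun i => [set e | edges e /\ c e = i]); split.
- by move=> i e [].
- move=> i A fA Su Sv; have [|e Ae ei] := cP A _ i; first by split.
  by exists e; split=> //; split=> //; exact: cut_sub_edges Ae.
- move=> i j ij; rewrite -subset0 => e [[_ ei] [_ ej]].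
  by move: ij; rewrite -ei -ej eqxx.
Qed.

End Colouring.

Lemma topological_packing (R : realType) k (G : graph) (S : set (vertex G)) :
  0 < k -> finite_packing k -> connected_graph G -> locally_finite G ->
  infinite_set [set: vertex G] -> edge_connected_in (2 * k) S ->
  exists T : 'I_k -> set (Etop R G),
    (forall i, topological_steiner_tree S (T i)) /\
    (forall i j, i != j -> edge_disjoint_top (T i) (T j)).
Proof.
move=> k0 pack conn lf inf SC.
have [F [FE FL FD]] := exists_disjoint_linked k0 pack conn SC.
have /choice[T TP] i : exists T : set (Etop R G),
    topological_steiner_tree S T /\ top_edges T `<=` F i.
  by have [T ? ?] := linked_topological_tree R lf conn inf (FE i) (FL i); exists T.
exists T; split=> [i|i j ij]; first exact: (TP i).1.
by apply: subsetI_eq0 (FD i j ij); [exact: (TP i).2|exact: (TP j).2].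
Qed.

(** * Curves cross finite cuts along whole edges *)

Section CrossingPath.
Local Open Scope ring_scope.
Variables (R : realType) (G : graph).
Local Notation V := (vertex G).
Hypothesis lf : locally_finite G.
Implicit Types (A S : set V) (p : Etop R G).

(** The cut function of a single vertex measures the distance to that vertex. *)
Lemma cutf1_eq0 (z : V) (phi : Etop R G -> R) p :
  cut_function [set z] (fun _ _ t => t) phi -> phi p = 0 -> p = OfPoint (vertex_point R z).
Proof.
move=> phiP; case: p => [x|w]; last first.
  by rewrite (cutf_end_out phiP (@end_out1 _ _ _)) => /eqP; rewrite oner_eq0.
have [a ->|u v t uv /andP[t0 t1] xE] := point_case x.
  have [-> //|az] := pselect (a = z).
  by rewrite (cutf_out phiP az) => /eqP; rewrite oner_eq0.
have t01 : 0 <= t <= 1 by rewrite !ltW.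
rewrite (cutf_edge phiP uv t01 xE) /cut_value.
case: asboolP => /= [uz|_]; case: asboolP => /= [vz|_] val; exfalso; last 3 first.
- by lra.
- by lra.
- by lra.
by move: uv; rewrite uz vz adj_irr.
Qed.

(** Along a curve that avoids [z], the distance to [z] has a positive minimum. *)
Lemma misses_near_vertex (f : R -> Etop R G) (z y : V) :
  {within `[0, 1], continuous f} -> adj z y ->
  (forall t, 0 <= t <= 1 -> f t <> OfPoint (vertex_point R z)) ->
  exists c, 0 < c < 1 /\ forall x t, 0 <= t <= 1 -> coord x = edge_coord z y c ->
    f t <> OfPoint x.
Proof.
move=> fc zy miss; have [phi phiP] := cut_function_id R lf (finite_cut1 z lf).
have kc : {within `[0, 1], continuous (phi \o f)}.
  by move=> t; apply: continuous_comp (fc t) _; exact: cutf_continuous phiP _.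
have [t0 t01 min] := EVT_min (@ler01 R) kc.
have m0 : 0 < phi (f t0).
  rewrite lt_neqAle; have /andP[-> _] := cutf01 (f t0) phiP; rewrite andbT eq_sym.
  by apply/eqP => /(cutf1_eq0 phiP); apply: miss; move: t01; rewrite in_itv.
pose c := Num.min (phi (f t0)) 1 / 2.
have m1 : 0 < Num.min (phi (f t0)) 1 by rewrite lt_min m0 ltr01.
have mle : Num.min (phi (f t0)) 1 <= phi (f t0) by rewrite ge_min lexx.
have mle1 : Num.min (phi (f t0)) 1 <= 1 by rewrite ge_min lexx orbT.
have c0 : 0 < c by rewrite /c; lra.
have c1 : c < 1 by rewrite /c; lra.
have cm : c < phi (f t0) by rewrite /c; lra.
exists c; rewrite c0 c1; split=> // x t t01' xE ft.
have : phi (f t0) <= phi (f t) by apply: min; rewrite in_itv.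
have c01 : 0 <= c <= 1 by rewrite !ltW.
rewrite ft (cutf_edge phiP zy c01 xE) /cut_value asboolT// asboolF; first lra.
by move=> /= E; move: zy; rewrite E adj_irr.
Qed.

(** The piecewise linear profile from 0 to 1 that takes the value 1/2 exactly at
[c]. *)
Definition bent (c t : R) : R := Num.min (t / (2 * c)) 2^-1 + Num.max 0 ((t - c) / (2 * (1 - c))).

Lemma continuous_bent c : continuous (bent c).
Proof.
move=> t; apply: cvgD.
  apply: (@continuous_min R R (fun t => t / (2 * c)) (cst 2^-1) t).
    by apply: cvgM; [exact: cvg_id|exact: cvg_cst].
  exact: cst_continuous.
apply: (@continuous_max R R (cst 0) (fun t => (t - c) / (2 * (1 - c))) t).
  exact: cst_continuous.
apply: cvgM; last exact: cvg_cst.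
by apply: cvgB; [exact: cvg_id|exact: cvg_cst].
Qed.

Lemma bent_left c t : 0 < c < 1 -> t <= c -> bent c t = t / (2 * c).
Proof.
move=> /andP[c0 c1] tc; rewrite /bent.
have -> : Num.min (t / (2 * c)) 2^-1 = t / (2 * c).
  apply: min_idPl; rewrite ler_pdivrMr ?mulr_gt0//; lra.
have -> : Num.max 0 ((t - c) / (2 * (1 - c))) = 0.
  by apply: max_idPl; rewrite ler_pdivrMr ?mulr_gt0 ?subr_gt0//; lra.
by rewrite addr0.
Qed.

Lemma bent_right c t : 0 < c < 1 -> c <= t -> bent c t = 2^-1 + (t - c) / (2 * (1 - c)).
Proof.
move=> /andP[c0 c1] ct; rewrite /bent.
have -> : Num.min (t / (2 * c)) 2^-1 = 2^-1.
  by apply: min_idPr; rewrite ler_pdivlMr ?mulr_gt0//; lra.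
have -> // : Num.max 0 ((t - c) / (2 * (1 - c))) = (t - c) / (2 * (1 - c)).
by apply: max_idPr; rewrite divr_ge0 ?subr_ge0// mulr_ge0 ?subr_ge0// ltW.
Qed.

Lemma bent_half c t : 0 < c < 1 -> bent c t = 2^-1 -> t = c.
Proof.
move=> c01; have /andP[c0 c1] := c01; case: (ltgtP t c) => // h.
  have d : 2 * c != 0 by rewrite mulf_neq0 ?gt_eqF.
  by rewrite bent_left ?ltW// => E; have := divfK d t; rewrite E; lra.
rewrite bent_right ?ltW//.
have : 0 < (t - c) / (2 * (1 - c)) by rewrite divr_gt0 ?mulr_gt0 ?subr_gt0.
lra.
Qed.

(** Suppose that the curve misses a point of each edge of the cut; by
[misses_near_vertex] this point may be chosen inside the edge. A cut function
whose profile takes the value 1/2 exactly at the missing points contradicts the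
intermediate value theorem. *)
Lemma curve_crosses A (f : R -> Etop R G) a b : finite_set (cut A) ->
  {within `[0, 1], continuous f} ->
  f 0 = OfPoint (vertex_point R a) -> f 1 = OfPoint (vertex_point R b) ->
  A a -> ~ A b ->
  exists u v, [/\ A u, ~ A v, adj u v &
    forall x, edge_points u v x -> exists2 t, 0 <= t <= 1 & f t = OfPoint x].
Proof.
move=> fA fc f0 f1 Aa Ab; apply: contrapT => none.
have [c cP] : exists c : V -> V -> R, forall u v, A u -> ~ A v -> adj u v ->
    0 < c u v < 1 /\ forall x t, 0 <= t <= 1 -> coord x = edge_coord u v (c u v) ->
      f t <> OfPoint x.
  suff /choice[c cP] : forall e : V * V, exists c : R, A e.1 -> ~ A e.2 -> adj e.1 e.2 ->
      0 < c < 1 /\ forall x t, 0 <= t <= 1 -> coord x = edge_coord e.1 e.2 c ->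
      f t <> OfPoint x.
    by exists (fun u v => c (u, v)) => u v; exact: (cP (u, v)).
  move=> [u v] /=.
  have [[Au [Av uv]]|h] := pselect (A u /\ ~ A v /\ adj u v); last first.
    by exists 0 => Au Av uv; case: h.
  have [x [[t t01 xE] miss]] : exists x, edge_points u v x /\
      forall s, 0 <= s <= 1 -> f s <> OfPoint x.
    apply: contrapT => h; apply: none; exists u, v; split=> // x xuv.
    apply: contrapT => h'; apply: h; exists x; split=> // s s01 fs.
    by apply: h'; exists s.
  have [t0|t0] := eqVneq t 0.
    have xu : x = vertex_point R u by apply: vertex_pointP; rewrite xE t0 edge_coord0.
    rewrite xu in miss; have [c [c01 cm]] := misses_near_vertex fc uv miss.
    by exists c.
  have [t1|t1] := eqVneq t 1.
    have xv : x = vertex_point R v by apply: vertex_pointP; rewrite xE t1 edge_coord1.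
    rewrite xv in miss; have vu : adj v u by rewrite adj_sym.
    have [c [/andP[c0 c1] cm]] := misses_near_vertex fc vu miss.
    exists (1 - c) => _ _ _; split; first by apply/andP; split; lra.
    by move=> y s s01 yE; apply: cm => //; rewrite yE edge_coordC; congr edge_coord; lra.
  exists t => _ _ _; split; first by rewrite !lt_neqAle t1 eq_sym t0.
  by move=> y s s01 yE; rewrite (@coord_inj _ _ y x) ?yE//; exact: miss.
have [|phi phiP] := cut_function_exists (R := R) lf (A := A) (g := fun u v => bent (c u v)) fA.
  move=> u v Au Av uv; have [c01 _] := cP u v Au Av uv; have /andP[c0 c1] := c01.
  split; first exact: continuous_bent.
    by rewrite bent_left ?ltW// mul0r.
  by rewrite bent_right ?ltW//; field; rewrite subr_eq0 gt_eqF.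
have kc : {within `[0, 1], continuous (phi \o f)}.
  by move=> t; apply: continuous_comp (fc t) _; exact: cutf_continuous phiP _.
have [|t t01 /= ft] := @IVT R (phi \o f) 0 1 (2^-1) ler01 kc.
  rewrite /= f0 f1 (cutf_in phiP Aa) (cutf_out phiP Ab) ge_min le_max invr_ge0 ler0n.
  by rewrite invf_le1 ?ler1n ?orbT.
have [||x [u [v [s [fx [Au Av] uv [s01 xE] sE]]]]] := cutf_inner phiP (p := f t).
- by rewrite ft invr_eq0 pnatr_eq0.
- by rewrite ft; apply/eqP; lra.
have [c01 miss] := cP u v Au Av uv.
have sc : s = c u v by apply: bent_half => //; rewrite -sE.
apply: (miss x t _ _ fx); last by rewrite xE sc.
by move: t01; rewrite in_itv.
Qed.

Lemma top_edges_linked S (T : set (Etop R G)) : path_connected R T ->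
  S `<=` top_vertices T -> linked S (top_edges T).
Proof.
move=> [_ Tconn] ST A fA [a Sa Aa] [b Sb Ab].
have [f [fc f0 f1 fT]] := Tconn _ _ (ST a Sa) (ST b Sb).
have [u [v [Au Av uv uvf]]] := curve_crosses fA fc f0 f1 Aa Ab.
exists (edge u v); split; first by exists u, v.
by exists u, v; split=> // x /uvf[t t01 <-]; exact: fT.
Qed.

End CrossingPath.

(** * Trees in finite graphs, and the equivalence *)

Section FiniteTree.
Variable G : graph.
Local Notation V := (vertex G).
Implicit Types (S : set V) (F : set (set V)).

Lemma sub_adj_edge (T : subgraph G) u v : sub_adj T u v ->
  adj u v /\ sub_edges T (edge u v).
Proof.
move=> /set_mem uvT; split=> //.
have [a [b [ab E]]] := @sub_edgesP _ T _ uvT.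
by case: (edge_inj E) => -[-> ->] //; rewrite adj_sym.
Qed.

Lemma uncut_path (T : subgraph G) A (x : V) p :
  path (sub_adj T) x p ->
  (forall a b, (a, b) \in zip (x :: p) p -> sub_adj T a b -> ~ cut A (edge a b)) ->
  (A x <-> A (last x p)).
Proof.
elim: p x => [|y p IH] x //= /andP[xy pp] unc; have [axy _] := sub_adj_edge xy.
have ncut : ~ cut A (edge x y) by apply: (unc x y _ xy); rewrite /= in_cons eqxx.
rewrite (notin_cut axy ncut).
by apply: IH => // a b ab; apply: unc; rewrite in_cons ab orbT.
Qed.

Lemma mem_zip_source (T : eqType) (x y a b : T) q :
  (a, b) \in zip (y :: rcons q x) (rcons q x) -> a \in y :: q.
Proof.
elim: q y => [|z q IH] y /=; rewrite !in_cons xpair_eqE.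
  by rewrite orbF => /andP[->].
by move=> /orP[/andP[-> //]|/IH]; rewrite in_cons => ->; rewrite orbT.
Qed.

(** If [x], [y], ... is a cycle, then the rest of the cycle joins [y] to [x]
without using the edge from [x] to [y], so it does not cross the private cut of
this edge. *)
Lemma minimal_linked_acyclic S F (T : subgraph G) : minimal_linked S F ->
  sub_edges T `<=` F -> sub_acyclic T.
Proof.
move=> [_ _ minF] TF [[|x [|y [|z p]]] [//= _ /andP[]]] //.
move=> /andP[xy /andP[yz pp]] /andP[]; rewrite !inE !negb_or => /and3P[xny xnz xnp].
move=> /andP[/andP[ynz ynp] _].
have [axy Txy] := sub_adj_edge xy.
have [A [_ _ _ AF]] := minF _ (TF _ Txy).
have cxy : cut A (edge x y).
  by have : [set edge x y] (edge x y) by []; rewrite -AF => -[].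
have only a b : sub_adj T a b -> cut A (edge a b) -> edge a b = edge x y.
  move=> /sub_adj_edge[_ /TF Fab] cab.
  by have : (cut A `&` F) (edge a b) by []; rewrite AF.
have path_all : path (sub_adj T) y (rcons (z :: p) x) by rewrite /= yz.
apply: (mem_cut A axy).1 cxy _; apply: iff_sym.
have := uncut_path (A := A) path_all; rewrite last_rcons; apply => a b ab abT cab.
have ay := mem_zip_source ab.
case: (edge_inj (only a b abT cab)) => -[aE bE]; subst a b.
  by move: ay; rewrite !inE (negPf xny) (negPf xnz) (negPf xnp).
move: ab; rewrite /= in_cons xpair_eqE eqxx (negPf xnz) /= => /mem_zip_source.
by rewrite inE (negPf ynz) (negPf ynp).
Qed.

(** The edges of a minimal linked subset within the component of [S]: the cut of
this component contains no edge of the subset, so the component contains [S]. *)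
Lemma finite_linked_tree S F : finite_set [set: V] -> connected_graph G ->
  F `<=` @edges G -> linked S F ->
  exists2 T : subgraph G, steiner_tree S T & sub_edges T `<=` F.
Proof.
move=> finV [[v0 _] _] FE linkF; have [F' F'F minF'] := linked_minimal FE linkF.
have [F'E linkF' _] := minF'.
have finE : finite_set (@edges G).
  apply: (@sub_finite_set _ _ ((fun x => edge x.1 x.2) @` [set: V * V])).
    by move=> _ [a [b [_ ->]]]; exists (a, b).
  by apply: finite_image; rewrite -setXTT; exact: finite_setX.
have [s0 s0S] : exists s0, forall s, S s -> S s0.
  have [[s Ss]|S0] := pselect (S !=set0); first by exists s.
  by exists v0 => s Ss; case: S0; exists s.
pose C := component (~` F') s0.
have sE : F' `&` [set e | e `<=` C] `<=` @edges G by move=> e [/F'E].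
have sV e : (F' `&` [set e | e `<=` C]) e -> e `<=` C by case.
pose T := Subgraph sE sV.
have walkT u p : C u -> path (adj_minus (~` F')) u p -> path (sub_adj T) u p.
  elim: p u => [|w p IH] u //= Cu /andP[uw pp].
  have Cw : C w by exact: component_adj Cu uw.
  rewrite IH// andbT; apply/mem_set; split; last by move=> z [] /= ->.
  by case/andP: uw => _ /negP n; apply: contrapT => h; apply: n; exact/mem_set.
exists T; last by move=> e [/F'F].
split; last first.
  move=> s Ss; rewrite /=; apply: contrapT => nCs.
  have [||e [Ce Fe]] := linkF' C (sub_finite_set (@cut_sub_edges _ C) finE).
  - by exists s0; [exact: s0S Ss|exact: component_refl].
  - by exists s.
  - exact: (@cut_component G (~` F') s0 e Ce Fe).
split; last by apply: minimal_linked_acyclic minF' _ => e [].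
split; first by exists s0; exact: component_refl.
move=> u v Cu Cv; have [p pp pl] := component_trans (component_sym Cu) Cv.
by exists p => //; exact: walkT.
Qed.

End FiniteTree.

Section Tailed.
Variables (G : graph) (x0 : vertex G).
Local Notation V := (vertex G).

Definition tailed_vertex : choiceType := (V + nat)%type.

(** The graph with a ray attached at [x0]. *)
Definition tailed_adj : rel tailed_vertex := fun x y =>
  match x, y with
  | inl u, inl v => adj u v
  | inl u, inr n | inr n, inl u => (u == x0) && (n == 0)
  | inr n, inr m => (n.+1 == m) || (m.+1 == n)
  end.

Lemma tailed_sym : symmetric tailed_adj.
Proof. by case=> [u|n] [v|m] //=; [exact: adj_sym|exact: orbC]. Qed.

Lemma tailed_irr : irreflexive tailed_adj.
Proof. by case=> [u|n] /=; [exact: adj_irr|apply/negP; lia]. Qed.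

Definition tailed := Graph tailed_sym tailed_irr.

Definition emb (u : V) : vertex tailed := inl u.
Definition tail_vertex (n : nat) : vertex tailed := inr n.

Lemma emb_edge u v : emb @` edge u v = edge (emb u) (emb v).
Proof. by rewrite /edge image_setU !image_set1. Qed.

Lemma image_emb_inj (e e' : set V) : emb @` e = emb @` e' -> e = e'.
Proof.
have sub (d d' : set V) : emb @` d = emb @` d' -> d `<=` d'.
  move=> E x dx; have : (emb @` d') (emb x) by rewrite -E; exists x.
  by move=> [y d'y [<-]].
by move=> E; apply/seteqP; split; apply: sub.
Qed.

Lemma emb_path u p : path (@adj tailed) (emb u) (map emb p) = path (@adj G) u p.
Proof. by elim: p u => //= v p IH u; rewrite IH. Qed.

Lemma emb_path_edges u p : path_edges (emb u) (map emb p) = (fun e => emb @` e) @` path_edges u p.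
Proof.
elim: p u => [|v p IH] u /=; last by rewrite !path_edges_cons IH image_setU image_set1 emb_edge.
have nil (H : graph) (w : vertex H) : path_edges w [::] = set0.
  by rewrite -subset0 => e [].
by rewrite !nil image_set0.
Qed.

Lemma emb_is_path u v p : is_path u v p -> is_path (emb u) (emb v) (map emb p).
Proof.
move=> [pp <- up]; split; first by rewrite emb_path.
  by rewrite last_map.
by rewrite -map_cons map_inj_uniq// => ? ? [].
Qed.

Lemma tailed_connected : connected_graph G -> connected_graph tailed.
Proof.
move=> conn; split; first by exists (emb x0).
suff base (x : vertex tailed) : component set0 (emb x0) x.
  move=> x y; have [p pP _] := component_path (component_trans (component_sym (base x)) (base y)).
  by exists p.
have am (u v : vertex tailed) : adj u v -> adj_minus set0 u v.
  by move=> uv; rewrite /adj_minus uv; apply/negP => /set_mem.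
case: x => [u|n].
  have [p /emb_is_path pP] := conn.2 x0 u.
  by have := path_component pP (@subsetT _ _); rewrite setCT.
elim: n => [|n IH].
  by apply: component_adj (component_refl _ _) (am _ _ _); rewrite /= !eqxx.
by apply: component_adj IH (am _ _ _); rewrite /= eqxx.
Qed.

Lemma tailed_locally_finite : finite_set [set: V] -> locally_finite tailed.
Proof.
move=> finV [u|n].
  apply: (@sub_finite_set _ _ (emb @` setT `|` [set tail_vertex 0])).
    by move=> [v|m] /=; [left; exists v|move=> /andP[_ /eqP ->]; right].
  by rewrite finite_setU; split; [exact: finite_image|exact: finite_set1].
apply: (@sub_finite_set _ _ ([set emb x0] `|` ([set tail_vertex n.+1] `|` [set tail_vertex n.-1]))).
  move=> [v|m] /=; first by move=> /andP[/eqP -> _]; left.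
  by move=> /orP[/eqP <-|/eqP <-]; right; [left|right].
by rewrite !finite_setU; split; [|split]; exact: finite_set1.
Qed.

Lemma tailed_infinite : infinite_set [set: vertex tailed].
Proof.
move=> fin; apply: infinite_nat.
rewrite -(preimage_setT tail_vertex).
by apply: finite_preimage fin => m n _ _ [].
Qed.

Lemma tailed_edge_connected m S : edge_connected_in m S ->
  @edge_connected_in tailed m (emb @` S).
Proof.
move=> h _ _ [u Su <-] [v Sv <-]; have [P [pP dP]] := h u v Su Sv.
exists (fun i => map emb (P i)); split=> [i|i j ij]; first exact: emb_is_path.
rewrite !emb_path_edges -subset0 => _ [[e ei <-] [e' ej /image_emb_inj E]].
have : (path_edges u (P i) `&` path_edges u (P j)) e by split=> //; rewrite -E.
by rewrite dP.
Qed.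

(** A set of vertices extends to the attached ray, on the side of [x0], without
new edges in its cut. *)
Lemma tailed_linked S (E : set (set (vertex tailed))) : finite_set [set: V] ->
  linked (emb @` S) E -> linked S [set e | edges e /\ E (emb @` e)].
Proof.
move=> finV linkE A fA [u Su Au] [v Sv Av].
pose A' : set (vertex tailed) := fun x => match x with inl a => A a | inr _ => A x0 end.
have A'A : cut A' `<=` (fun e => emb @` e) @` cut A.
  move=> _ [[a|n] [[b|m] [/= Aa Ab ab ->]]] //.
  - by exists (edge a b); [exists a, b|rewrite emb_edge].
  - by move: ab Ab => /andP[/eqP <- _].
  - by move: ab Ab => /andP[/eqP -> _].
have [||_ [/A'A[e Ae <-] Ee]] := linkE A' (sub_finite_set A'A (finite_image _ fA)).
- by exists (emb u) => //; exists u.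
- by exists (emb v) => //; exists v.
by exists e; split=> //; split=> //; exact: cut_sub_edges Ae.
Qed.

End Tailed.

Theorem theorem2p1 (R : realType) :
  (forall (k : nat) (G : graph) (S : set (vertex G)),
     (0 < k)%N -> finite_set [set: vertex G] -> connected_graph G ->
     edge_connected_in (2 * k)%N S ->
     exists T : 'I_k -> subgraph G,
       (forall i, steiner_tree S (T i)) /\
       (forall i j, i != j -> edge_disjoint_subgraphs (T i) (T j)))
  <->
  (forall (k : nat) (G : graph) (S : set (vertex G)),
     (0 < k)%N -> connected_graph G -> locally_finite G ->
     infinite_set [set: vertex G] ->
     edge_connected_in (2 * k)%N S ->
     exists T : 'I_k -> set (Etop R G),
       (forall i, topological_steiner_tree S (T i)) /\
       (forall i j, i != j -> edge_disjoint_top (T i) (T j))).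
Proof.
split=> [finite_pack k G S k0 conn lf inf SC|top_pack k G S k0 fin conn SC].
  by apply: topological_packing => // H S'; exact: finite_pack.
have [x0 _] := conn.1.
have [T [TS TD]] := top_pack k (tailed x0) _ k0 (tailed_connected x0 conn)
  (tailed_locally_finite fin) (@tailed_infinite _ x0) (@tailed_edge_connected G x0 _ _ SC).
pose F i := [set e | edges e /\ top_edges (T i) (@emb G x0 @` e)].
have FE i : F i `<=` @edges G by move=> e [].
have FL i : linked S (F i).
  apply: tailed_linked => //; have [[Tconn _] ST] := TS i.
  exact: top_edges_linked (tailed_locally_finite fin) _ _ Tconn ST.
have /choice[T' T'P] i : exists T' : subgraph G, steiner_tree S T' /\ sub_edges T' `<=` F i.
  by have [T' ? ?] := finite_linked_tree fin conn (FE i) (FL i); exists T'.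
exists T'; split=> [i|i j ij]; first exact: (T'P i).1.
rewrite /edge_disjoint_subgraphs -subset0 => e [/(T'P i).2[_ ei] /(T'P j).2[_ ej]].
have : (top_edges (T i) `&` top_edges (T j)) (@emb G x0 @` e) by [].
by rewrite TD.
Qed.
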